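(* For all positive integers $f,k,n$ and all $\varepsilon>0$: (Upper bound) every $n$-node weighted graph $G$ has an $f$-EFT $(1+\varepsilon)(2k-1)$-spanner $H$ with competitive lightness $$\ell_{2f}(H\mid G)\le f^{1/2}\cdot O\big(\lambda(n,(1+\varepsilon)2k)\big)\le f^{1/2}\cdot O_\varepsilon\big(n^{1/k}\big);$$ (Lower bound) there are $n$-node weighted graphs $G$ for which every $f$-EFT $(1+\varepsilon)(2k-1)$-spanner $H$ has competitive lightness $$\ell_{2f}(H\mid G)\ge \Omega\Big(\lambda\Big(\tfrac{n}{(2f)^{1/2}},(1+\varepsilon)2k\Big)\Big),$$ and, assuming the Erdős girth conjecture, this is at least $f^{-\frac{1}{2k}}\cdot\Omega(n^{1/k})$.
   Context: Graphs $G=(V,E,w)$ have nonnegative edge weights (multigraphs allowed); $w(H)$ is the total weight of a subgraph $H$, $\mathrm{dist}_H$ the weighted shortest-path distance, and $\mathrm{mst}(H)$ a minimum spanning tree (forest) of $H$. An edge-subgraph $H$ of $G$ is an $f$-EFT $t$-spanner of $G$ if $\mathrm{dist}_{H\setminus F}(u,v)\le t\cdot \mathrm{dist}_{G\setminus F}(u,v)$ for all $u,v\in V$ and all edge sets $F$ with $|F|\le f$. A subgraph $Q\subseteq G$ is an $f'$-EFT connectivity preserver if for every edge set $F$ with $|F|\le f'$, the connected components of $Q\setminus F$ equal those of $G\setminus F$. The $f'$-competitive lightness is $\ell_{f'}(H\mid G):=w(H)/\min_Q w(Q)$, the minimum over all $f'$-EFT connectivity preservers $Q$ of $G$. The lightness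 of a graph $H$ is $\ell(H)=w(H)/w(\mathrm{mst}(H))$. The normalized weight of a cycle $C$ is $w(C)/\max_{e\in C}w(e)$; the weighted girth of a graph is the minimum normalized weight over its cycles. $\lambda(n,t):=\sup \ell(G)$ over $n$-node graphs $G$ of weighted girth $>t$. $O_\varepsilon$ hides factors depending only on $\varepsilon$.
   Formalization: The middle term of the upper bound is λ(n,(1+ε)2k−ε) instead of λ(n,(1+ε)2k), and the consequence of the Erdős girth conjecture is stated only for ε<1/k; as written both fail, e.g. for k=1, f=1, ε=1.2. *)

(* Defs.v *)
From HB Require Import structures.
From mathcomp Require Import all_boot all_order all_algebra.
From mathcomp Require Import all_classical all_reals all_analysis.

Set Implicit Arguments.
Unset Strict Implicit.
Unset Printing Implicit Defensive.

Import Order.TTheory GRing.Theory Num.Theory.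
Local Open Scope classical_set_scope.
Local Open Scope ring_scope.

(* Finite weighted undirected multigraphs. The two ends of an edge are stored
   as a pair whose order is irrelevant; parallel edges and loops are allowed. *)
Record mgraph (R : realType) := MGraph {
  vert : finType;
  edge : finType;
  ends : edge -> vert * vert;
  wt : edge -> R;
  wt_ge0 : forall e, 0 <= wt e
}.

(* Quotients of weights, with 0 / 0 = 1, so that any two graphs of weight zero
   are exactly as light as each other (in the library 0 / 0 = 0 in \bar R);
   a / 0 = +oo for a > 0, as in the library. *)
Definition weight_ratio (R : realType) (a b : \bar R) : \bar R :=
  if (a == 0%E) && (b == 0%E) then 1%E else (a / b)%E.

Section Graphs.
Variables (R : realType) (G : mgraph R).

(* Edge-subgraphs of G, all on the vertex set of G, are given by their edge
   sets; G itself is [set: edge G] and H \ F is H :\: F. *)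
Implicit Types S H Q T F : {set edge G}.

Definition weight S : R := \sum_(e in S) wt e.

Definition joins (e : edge G) (x y : vert G) : bool :=
  (ends e == (x, y)) || (ends e == (y, x)).

(* A walk from x to y in S: the list of its steps, each step being the edge
   followed and the vertex it leads to. *)
Fixpoint walk S (x : vert G) (p : seq (edge G * vert G)) (y : vert G) : bool :=
  if p is (e, z) :: p' then [&& e \in S, joins e x z & walk S z p' y]
  else x == y.

Definition walk_weight (p : seq (edge G * vert G)) : R := \sum_(s <- p) wt s.1.

Definition dist S (x y : vert G) : \bar R :=
  ereal_inf [set (walk_weight p)%:E | p in [set p | walk S x p y]].

Definition edge_rel S : rel (vert G) :=
  fun x y => [exists e in S, joins e x y].

Definition components S : {set {set vert G}} :=
  equivalence_partition (connect (edge_rel S)) [set: vert G]%SET.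

(* No vertex and no edge repeats, so a loop is a cycle of length 1 and two
   parallel edges form a cycle of length 2. *)
Definition is_cycle S (x : vert G) (p : seq (edge G * vert G)) : bool :=
  [&& (0 < size p)%N, walk S x p x, uniq [seq s.1 | s <- p]
    & uniq [seq s.2 | s <- p]].

Definition normalized_weight (p : seq (edge G * vert G)) : \bar R :=
  weight_ratio (walk_weight p)%:E (\big[Num.max/0]_(s <- p) wt s.1)%:E.

Definition weighted_girth : \bar R :=
  ereal_inf [set normalized_weight p | p in
    [set p | exists x, is_cycle [set: edge G]%SET x p]].

Definition spanning_forest S T : Prop :=
  [/\ T \subset S, components T = components S & forall x p, ~~ is_cycle T x p].

(* The infimum is over a finite nonempty family, hence a minimum. *)
Definition mst_weight S : \bar R :=
  ereal_inf [set (weight T)%:E | T in spanning_forest S].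

Definition lightness S : \bar R := weight_ratio (weight S)%:E (mst_weight S).

Definition eft_spanner (f : nat) (t : R) H : Prop :=
  forall F, (#|F| <= f)%N -> forall u v : vert G,
    (dist (H :\: F) u v <= t%:E * dist ([set: edge G]%SET :\: F) u v)%E.

Definition eft_connectivity_preserver (f : nat) Q : Prop :=
  forall F, (#|F| <= f)%N ->
    components (Q :\: F) = components ([set: edge G]%SET :\: F).

(* Again a minimum: the family is finite and contains [set: edge G]. *)
Definition competitive_lightness (f : nat) H : \bar R :=
  weight_ratio (weight H)%:E
    (ereal_inf [set (weight Q)%:E | Q in eft_connectivity_preserver f]).

End Graphs.

Definition lambda (R : realType) (n : nat) (t : R) : \bar R :=
  ereal_sup [set l | exists G : mgraph R,
    [/\ #|vert G| = n, (t%:E < weighted_girth G)%E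
      & l = lightness [set: edge G]%SET]].

(* The Erdos girth conjecture, with gamma k the constant implicit in
   "for all k and n there is a (simple, unweighted) n-node graph of girth > 2k
   with Omega(n^(1+1/k)) edges". A constant gamma gives the reading in which
   the implicit constant is absolute. The case n = 1 is left out since a
   one-node graph has no edge. *)
Definition erdos_girth_conjecture (R : realType) (gamma : nat -> R) : Prop :=
  (forall k, (0 < k)%N -> 0 < gamma k) /\
  forall k n : nat, (0 < k)%N -> (1 < n)%N ->
    exists a : rel 'I_n,
      [/\ symmetric a, irreflexive a,
          forall c : seq 'I_n,
            cycle a c -> uniq c -> (2 < size c)%N -> (2 * k < size c)%N
        & gamma k * n%:R `^ (1 + k%:R^-1) <=
          #|[set p : 'I_n * 'I_n | (p.1 < p.2)%N && a p.1 p.2]%SET|%:R].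

(* Main.v *)
Require Import Defs.
From mathcomp Require Import all_boot all_order all_algebra.
From mathcomp Require Import all_classical all_reals all_analysis.
From mathcomp Require Import zify ring lra.
(* Imported again: classical_sets shadows lemmas on finite sets. *)
From mathcomp Require Import fintype finset path.
Import Order.TTheory GRing.Theory Num.Theory.
Local Open Scope ring_scope.
Set Implicit Arguments.
Unset Strict Implicit.
Unset Printing Implicit Defensive.

(* Upper bound. Start from a minimum-weight 2f-EFT connectivity preserver Q and
   add the other edges e by increasing weight whenever some set F_e of at most f
   faults leaves no detour of weight t w(e). The ends of an added edge are
   separated by no cut of Q with at most 2f edges, so the primal-dual
   2-approximation of Steiner forests connects them by T in Q with
   (2f+1) c(T) <= 2 c(Q), for any cost c. For a set S of added edges no one of
   which lies in the F_e of another, the edges with F_e disjoint from T have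
   girth > t+1 together with a minimum spanning forest, hence weigh at most
   lambda w(T). Taking c = lambda w plus the weights of the e with g in F_e bounds
   w(S); colouring the conflict digraph separately for |F_e \ Q| below and above
   sqrt f leaves O(sqrt f) classes.

   Growth of lambda. Subdivide a spanning tree into tiny unit edges, with the
   vertices anchored at tree points so that tree distances dominate distances in
   the graph, and add the other edges scale by scale. At scale L the endpoints
   are clustered by disjoint tree balls of radius a small multiple of L; since the
   girth is large, Moore's bound gives O(n^(1/k)) edges per cluster, and a constant
   fraction of the clusters lets an edge replace a longer piece of the tree. The
   size of the tree is thus a potential that pays for all scales. For k < 8 this
   replacement is not available, but the sum over the scales is geometric.

   Lower bound. Take 2f+1 parallel copies of each edge of an extremal graph:
   every spanner keeps f+1 of them, while all copies of a minimum spanning tree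
   are a preserver. *)

(** * Walks, cycles and spanning forests *)

(** The factor 2 lost by the Steiner forest is why the competitor tolerates 2f faults. Paying for
    the faults met by T gives back at most 2f copies of w(S), against 2f+1 on the other side; if
    each F_e has r edges outside Q, the surplus grows from 1 to 2r+1. Only edges of F_e outside Q
    cause conflicts, so many conflicts mean many classes, but light ones: out-degree B gives 2B+1
    classes, for a total of order (2B+1)/(2r+1). This is O(sqrt f) both for r = 0, B = sqrt f and
    for r = sqrt f, B = f. In the growth of lambda the obstacle is the number of scales. Measured
    against one fixed tree, the scales decay only like a constant to the power -1/k, so that their
    sum would put a factor of order k into the constant; a tree that shrinks as it pays removes this
    factor. Shrinking in turn needs the ends of an edge of weight about L to be several times L
    apart, which large girth grants only for large k. *)

Section Walks.
Variables (R : realType) (G : mgraph R).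
Implicit Types (S T Z : {set edge G}) (p q : seq (edge G * vert G)).

Lemma joinsC (e : edge G) x y : joins e x y = joins e y x.
Proof. by rewrite /joins orbC. Qed.

Lemma joins_ends (e : edge G) : joins e (ends e).1 (ends e).2.
Proof. by rewrite /joins -surjective_pairing eqxx. Qed.

Lemma joins_endsP (e : edge G) x y : joins e x y ->
  (x = (ends e).1 /\ y = (ends e).2) \/ (x = (ends e).2 /\ y = (ends e).1).
Proof. by case/orP=> /eqP ->; [left|right]. Qed.

Lemma joins_eq (e : edge G) x y z : joins e x y -> joins e x z -> y = z.
Proof.
by case/joins_endsP=> -[-> ->] /joins_endsP[] [] // => E ->; rewrite ?E.
Qed.

Lemma joins_mem (e : edge G) x y a b :
  joins e x y -> joins e a b -> x = a \/ x = b.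
Proof.
by case/joins_endsP=> -[-> _] /joins_endsP[] [-> ->]; [left|right|right|left].
Qed.

Lemma walk_cat S x p z q y : walk S x p z -> walk S z q y -> walk S x (p ++ q) y.
Proof.
elim: p x => [|[e v] p IHp] x /=; first by move/eqP->.
by case/and3P=> -> -> /IHp H /H.
Qed.

Lemma walk_catE S x p q y : walk S x (p ++ q) y ->
  exists2 z, walk S x p z & walk S z q y.
Proof.
elim: p x => [|[e v] p IHp] x /=; first by exists x.
by case/and3P=> -> -> /IHp [z h1 h2]; exists z.
Qed.

Lemma walk_last S x p y : walk S x p y -> last x (unzip2 p) = y.
Proof. by elim: p x => [|[e v] p IHp] x /=; [move/eqP|case/and3P=> _ _ /IHp]. Qed.

Lemma walkE S x p y :
  walk S x p y = walk [set: edge G]%SET x p y && all (mem S) (unzip1 p).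
Proof.
elim: p x => [|[e v] p IHp] x /=; first by rewrite andbT.
rewrite IHp inE /=; case: (e \in S) => /=; rewrite ?andbF //.
by rewrite -andbA.
Qed.

Lemma walk_edges S x p y e : walk S x p y -> e \in unzip1 p -> e \in S.
Proof. by rewrite walkE => /andP[_ /allP h] /h. Qed.

Lemma walk_sub S T x p y : {subset S <= T} -> walk S x p y -> walk T x p y.
Proof.
move=> sST; rewrite walkE (walkE T) => /andP[-> /allP h] /=.
by apply/allP => e /h /sST.
Qed.

Lemma walk_weight_cons s p :
  walk_weight (s :: p) = @wt R G s.1 + walk_weight p.
Proof. by rewrite /walk_weight big_cons. Qed.

Lemma walk_weight_cat p q :
  walk_weight (p ++ q) = walk_weight p + walk_weight q.
Proof. by rewrite /walk_weight big_cat. Qed.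

Lemma walk_weight_nil : walk_weight ([::] : seq (edge G * vert G)) = 0.
Proof. by rewrite /walk_weight big_nil. Qed.

Lemma walk_weight_ge0 p : 0 <= walk_weight p.
Proof. by apply: sumr_ge0 => s _; exact: wt_ge0. Qed.

Lemma walk_rev S x p y : walk S x p y ->
  exists q, [/\ walk S y q x, walk_weight q = walk_weight p & size q = size p].
Proof.
elim: p x => [|[e v] p IHp] x /=.
  by move/eqP=> ->; exists [::]; rewrite /= eqxx.
case/and3P=> eS ej /IHp [q [wq ww sq]].
exists (q ++ [:: (e, x)]); split.
- by apply: walk_cat wq _; rewrite /= eS joinsC ej eqxx.
- by rewrite walk_weight_cat !walk_weight_cons walk_weight_nil ww /=; lra.
- by rewrite size_cat sq addn1.
Qed.

Lemma edge_rel_sym S : symmetric (edge_rel S).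
Proof. by move=> x y; apply: eq_existsb => e; rewrite joinsC. Qed.

Lemma edge_connC S : connect_sym (edge_rel S).
Proof. exact/sym_connect_sym/edge_rel_sym. Qed.

Lemma edge_connP S x y :
  reflect (exists p, walk S x p y) (connect (edge_rel S) x y).
Proof.
apply: (iffP idP).
- case/connectP=> s; elim: s x => [|z s IHs] x /=.
    by move=> _ ->; exists [::]; rewrite /= eqxx.
  case/andP=> /existsP [e /andP[eS ej]] /IHs h /h [p wp].
  by exists ((e, z) :: p); rewrite /= eS ej.
- case=> p; elim: p x => [|[e v] p IHp] x /=; first by move/eqP->.
  case/and3P=> eS ej /IHp; apply: connect_trans; apply: connect1.
  by apply/existsP; exists e; rewrite eS.
Qed.

Lemma edge_conn1 S e x y : e \in S -> joins e x y -> connect (edge_rel S) x y.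
Proof. by move=> eS ej; apply/connect1/existsP; exists e; rewrite eS. Qed.

Lemma edge_conn_sub S T x y : {subset S <= T} ->
  connect (edge_rel S) x y -> connect (edge_rel T) x y.
Proof.
by move=> sST /edge_connP [p wp]; apply/edge_connP; exists p; exact: walk_sub wp.
Qed.

Lemma edge_conn_repl S T x y :
  (forall e, e \in S -> connect (edge_rel T) (ends e).1 (ends e).2) ->
  connect (edge_rel S) x y -> connect (edge_rel T) x y.
Proof.
move=> h; apply: connect_sub => a b /existsP [e /andP[eS /joins_endsP[] [-> ->]]].
  exact: h.
by rewrite edge_connC; exact: h.
Qed.

Lemma components_eqP S T :
  reflect (forall x y, connect (edge_rel S) x y = connect (edge_rel T) x y)
          (components S == components T).
Proof.
have eqv Z : {in [set: vert G] & &, equivalence_rel (connect (edge_rel Z))}.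
  by apply: in3W => x y z; split=> // xy; apply: (same_connect (edge_connC _)).
apply: (iffP eqP) => [eqc x y|eqc].
  have key U W : components U = components W ->
      connect (edge_rel U) x y -> connect (edge_rel W) x y.
    move=> eUW xy.
    rewrite -(@pblock_equivalence_partition _ (connect (edge_rel W)) [set: vert G]);
      rewrite ?inE //.
    rewrite -/(components W) -eUW.
    by rewrite pblock_equivalence_partition ?inE.
  by apply/idP/idP; exact: key.
by rewrite /components /equivalence_partition;
   apply: eq_imset => x; apply/setP => y; rewrite !inE eqc.
Qed.

Lemma walk_suffix S z q y x : walk S z q y -> x \in z :: unzip2 q ->
  exists2 q', walk S x q' y & exists2 q0, q = q0 ++ q' & x = last z (unzip2 q0).
Proof.
elim: q z => [|[e v] q IHq] z /=.
  by rewrite inE => zy /eqP->; exists [::] => //; exists [::].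
case/and3P=> eS ej wq; rewrite in_cons => /orP[/eqP->|xin].
  by exists ((e, v) :: q); [rewrite /= eS ej|exists [::]].
have [q' wq' [q0 eq0 l0]] := IHq _ wq xin.
by exists q' => //; exists ((e, v) :: q0); rewrite ?eq0.
Qed.

Lemma walk_step_mem S x p y e a b : walk S x p y -> e \in unzip1 p ->
  joins e a b -> a \in x :: unzip2 p.
Proof.
elim: p x => [|[f v] p IHp] x //=.
case/and3P=> fS fj wp; rewrite in_cons => /orP[/eqP->|ein] ej.
  by have [->|->] := joins_mem ej fj; rewrite !inE eqxx ?orbT.
by rewrite in_cons (IHp _ wp ein ej) orbT.
Qed.

(** Shortcuts at repeated vertices; being a subsequence keeps the edges of the result among those of
    [p], so cycles built from it stay where the walk was. *)
Lemma walk_simple S x p y : walk S x p y ->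
  exists q, [/\ walk S x q y, uniq (x :: unzip2 q), uniq (unzip1 q),
                subseq q p & walk_weight q <= walk_weight p].
Proof.
elim: p x => [|[e v] p IHp] x /=.
  by move=> xy; exists [::]; rewrite /= xy.
case/and3P=> eS ej /IHp [q [wq uq ue sq ww]].
have [xin|xnin] := boolP (x \in v :: unzip2 q).
  have [q' wq' [q0 eq0 l0]] := walk_suffix wq xin.
  exists q'; split=> //.
  - move: uq; rewrite eq0 /unzip2 map_cat -cat_cons cat_uniq => /and3P[_ hn uq'].
    rewrite /= uq' andbT; apply/negP => xin'; case/negP: hn.
    by apply/hasP; exists x => //; rewrite l0; exact: mem_last.
  - by move: ue; rewrite eq0 /unzip1 map_cat cat_uniq => /and3P[].
  - apply: subseq_trans (subseq_trans sq (subseq_cons _ _)).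
    by rewrite eq0 suffix_subseq.
  - rewrite walk_weight_cons /=; move: ww (wt_ge0 e) (walk_weight_ge0 q0).
    by rewrite eq0 walk_weight_cat; lra.
exists ((e, v) :: q); split=> //=.
- by rewrite eS ej.
- by rewrite xnin.
- rewrite ue andbT; apply/negP => ein.
  by move: (walk_step_mem wq ein ej); rewrite (negPf xnin).
- by rewrite eqxx.
- by rewrite !walk_weight_cons /=; lra.
Qed.

Lemma walk_avoid S x p y e : walk S x p y -> e \notin unzip1 p -> walk (S :\ e) x p y.
Proof.
rewrite walkE (walkE (S :\ e)) => /andP[-> /allP hS] ep; apply/allP => f fp.
by apply/setD1P; split; [apply: contraNneq ep => <-|exact: hS].
Qed.

Lemma walk_split_edge S x p y e : walk S x p y -> uniq (unzip1 p) -> e \in unzip1 p ->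
  exists a b p1 p2, [/\ joins e a b, walk (S :\ e) x p1 a, walk (S :\ e) b p2 y &
     walk_weight p = wt e + (walk_weight p1 + walk_weight p2)].
Proof.
move=> wp up /mapP[[f b] /= fp ef]; subst f.
case/path.splitPr: fp wp up => p1 p2 /walk_catE[a w1 /= /and3P[_ ej w2]].
rewrite /unzip1 map_cat /= cat_uniq /= => /and3P[_ /norP[e1 _] /andP[e2 _]].
exists a, b, p1, p2; split=> //; try exact: walk_avoid.
by rewrite walk_weight_cat walk_weight_cons addrCA.
Qed.

End Walks.

(** * Quotients of weights and finite minima *)

Section Ratios.
Variable R : realType.

Lemma weight_ratioE (a b : R) : weight_ratio a%:E b%:E =
  if b == 0 then (if a == 0 then 1%E else (a%:E * +oo)%E) else (a / b)%:E.
Proof.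
rewrite /weight_ratio !eqe inver.
by have [b0|b0] := eqVneq b 0; have [a0|a0] := eqVneq a 0; rewrite //= ?a0 ?mul0r.
Qed.

(** [1 <= c] is what the convention 0 / 0 = 1 asks for. *)
Lemma weight_ratio_le (a b c : R) : 0 <= a -> 0 <= b -> 1 <= c ->
  a <= c * b -> (weight_ratio a%:E b%:E <= c%:E)%E.
Proof.
move=> a0 b0 c1 acb; rewrite weight_ratioE; have [bz|bz] := eqVneq b 0.
  have -> : a = 0 by apply/eqP; rewrite eq_le a0 andbT (le_trans acb)// bz mulr0.
  by rewrite eqxx lee_fin.
by rewrite lee_fin ler_pdivrMr // lt0r bz.
Qed.

(** For [1 <= g] clearing the denominator is harmless even when it is 0: at 0 / 0 = 1 both sides are
    false, at a / 0 with [a > 0] both are true. *)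
Lemma weight_ratio_gtE (a b g : R) : 0 <= a -> 0 <= b -> 1 <= g ->
  (g%:E < weight_ratio a%:E b%:E)%E = (g * b < a).
Proof.
move=> a0 b0 g1; rewrite weight_ratioE; have [bz|bz] := eqVneq b 0.
  rewrite bz mulr0; have [az|az] := eqVneq a 0.
    by rewrite az ltxx lte_fin ltNge g1.
  have a_gt0 : 0 < a by rewrite lt0r az.
  by rewrite a_gt0 gt0_muley ?ltry.
by rewrite lte_fin ltr_pdivlMr // lt0r bz.
Qed.

Lemma fin_min (I : finType) (P : I -> Prop) (f : I -> R) i0 : P i0 ->
  exists2 i, P i & forall j, P j -> f i <= f j.
Proof.
move=> Pi0; have Pb : (fun i => `[< P i >]) i0 by apply/asboolP.
case: (@arg_minP _ _ _ i0 (fun i => `[< P i >]) f Pb) => i /asboolP Pi h; exists i => // j Pj.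
by apply: h; apply/asboolP.
Qed.

Lemma ereal_inf_min (I : finType) (P : I -> Prop) (f : I -> R) i :
  P i -> (forall j, P j -> f i <= f j) ->
  ereal_inf [set (f j)%:E | j in P]%classic = (f i)%:E.
Proof.
move=> Pi h; apply/eqP; rewrite eq_le; apply/andP; split.
  by apply: ereal_inf_lbound; exists i.
by apply: le_ereal_inf_tmp => _ [j Pj <-]; rewrite lee_fin h.
Qed.

End Ratios.

(** * Cycles and weighted girth *)

Section Cycles.
Variables (R : realType) (G : mgraph R).
Implicit Types (S T Z : {set edge G}) (p q : seq (edge G * vert G)).

Lemma walk_cycle S e x y p : e \notin S -> joins e x y -> walk S y p x ->
  exists x' q, [/\ is_cycle (e |: S) x' q, e \in unzip1 q,
     {subset unzip1 q <= e :: unzip1 p} & walk_weight q <= wt e + walk_weight p].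
Proof.
move=> eS ej /walk_simple [q [wq uq ueq sq ww]].
exists x, ((e, y) :: q); split=> /=.
- apply/and4P; split=> //=.
  + by rewrite !inE eqxx ej /=; apply: walk_sub wq => f; rewrite !inE => ->; rewrite orbT.
  + rewrite ueq andbT; apply/negP => ein.
    by move: (walk_edges wq ein); rewrite (negPf eS).
- by rewrite inE eqxx.
- move=> f; rewrite !inE => /orP[->//|fq]; apply/orP; right.
  exact: (mem_subseq (map_subseq _ sq)) fq.
- by rewrite walk_weight_cons lerD2l.
Qed.

Lemma cycle_sub S T x p : is_cycle S x p -> {subset unzip1 p <= T} ->
  is_cycle T x p.
Proof.
case/and4P=> s0 wp u1 u2 sub; apply/and4P; split=> //.
rewrite walkE; apply/andP; split; last by apply/allP.
by apply: walk_sub wp => e; rewrite inE.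
Qed.

Lemma edge_conn_cycle S e x p : is_cycle S x p -> e \in unzip1 p ->
  connect (edge_rel ([set f in unzip1 p] :\ e)) (ends e).1 (ends e).2.
Proof.
case/and4P=> _ wp up _ ep; set C := [set f in unzip1 p].
have wC : walk C x p x.
  by move: wp; rewrite walkE (walkE C) => /andP[-> _]; apply/allP => f fp; rewrite /= inE.
have [a [b [p1 [p2 [ej w1 w2 _]]]]] := walk_split_edge wC up ep.
have ba : connect (edge_rel (C :\ e)) b a.
  by apply/edge_connP; exists (p2 ++ p1); exact: walk_cat w2 w1.
by have [[<- <-]|[<- <-]] := joins_endsP ej; rewrite // edge_connC.
Qed.

(** The walk closes [e] into a cycle whose heaviest edge weighs at least [wt e]. This is the form in
    which girth forbids detours. *)
Lemma girth_walk (g : R) e x y p : 1 <= g ->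
  (g%:E < weighted_girth G)%E -> joins e x y -> walk (~: [set e]) y p x ->
  g * wt e < wt e + walk_weight p.
Proof.
move=> g1 gG ej wp.
have eN : e \notin ~: [set e] by rewrite !inE eqxx.
have [x' [q [cq eq _ wq]]] := walk_cycle eN ej wp.
have : (g%:E < normalized_weight q)%E.
  apply: lt_le_trans gG (ereal_inf_lbound _); exists q => //=.
  by exists x'; apply: (cycle_sub cq) => f; rewrite inE.
have wmax : wt e <= \big[Num.max/0]_(s <- q) wt s.1.
  case/mapP: eq => s sq ->; exact: (@le_bigmax_seq _ _ _ q 0 s xpredT (fun s => wt s.1) sq isT).
have m0 := le_trans (wt_ge0 e) wmax.
rewrite /normalized_weight => h; move: (weight_ratio_gtE (walk_weight_ge0 q) m0 g1).
rewrite h => /esym {}h; apply: lt_le_trans wq; apply: le_lt_trans h.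
by rewrite ler_wpM2l // (le_trans ler01).
Qed.

(** An infimum of values above [g] might equal [g]. As cycles repeat no edge, they are tuples of
    bounded length, hence finitely many. *)
Lemma girth_gt (g : R) :
  (forall x p, is_cycle [set: edge G]%SET x p -> (g%:E < normalized_weight p)%E) ->
  (g%:E < weighted_girth G)%E.
Proof.
move=> h.
pose I := {k : 'I_(#|edge G|.+1) & k.-tuple (edge G * vert G)%type}.
pose P (i : I) := [exists x, is_cycle [set: edge G]%SET x (tagged i)].
apply: (@lt_le_trans _ _ (\big[Order.min/+oo%E]_(i : I | P i) normalized_weight (tagged i))).
  by apply: lt_bigmin => [|i /existsP [x /h //]]; rewrite ltry.
apply: le_ereal_inf_tmp => _ [p [x cp] <-].
have sp : (size p < #|edge G|.+1)%N.
  case/and4P: cp => _ _ u1 _; rewrite ltnS -(size_map fst) -(card_uniqP u1).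
  exact: max_card.
pose i : I := Tagged (fun k : 'I_(#|edge G|.+1) => k.-tuple (edge G * vert G)%type)
                (in_tuple p : (Ordinal sp).-tuple _).
by apply: (@bigmin_le_cond _ _ _ _ i); apply/existsP; exists x.
Qed.

End Cycles.

(** * Minimum spanning forests *)

Section Forests.
Variables (R : realType) (G : mgraph R).
Implicit Types (S T Z : {set edge G}) (p q : seq (edge G * vert G)).

Lemma weight_ge0 S : 0 <= weight S.
Proof. by apply: sumr_ge0 => e _; exact: wt_ge0. Qed.

Lemma weight_sub S T : S \subset T -> weight S <= weight T.
Proof.
move=> sST; rewrite /weight [leRHS](big_setID S) /= (finset.setIidPr sST) lerDl.
by apply: sumr_ge0 => e _; exact: wt_ge0.
Qed.

Lemma weightD1 S e : e \in S -> weight S = wt e + weight (S :\ e).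
Proof. by move=> eS; rewrite /weight (big_setD1 e). Qed.

Lemma weightU1 S e : e \notin S -> weight (e |: S) = wt e + weight S.
Proof. by move=> eS; rewrite /weight big_setU1. Qed.

Lemma conn_drop T e x y : connect (edge_rel (T :\ e)) (ends e).1 (ends e).2 ->
  connect (edge_rel (T :\ e)) x y = connect (edge_rel T) x y.
Proof.
move=> ce; apply/idP/idP; first by apply: edge_conn_sub => f /finset.setD1P[].
apply: edge_conn_repl => f fT; have [->//|fe] := eqVneq f e.
by apply: edge_conn1 (joins_ends f); rewrite !inE fe.
Qed.

Lemma acyclic_bridge T e : (forall x p, ~~ is_cycle T x p) -> e \in T ->
  ~~ connect (edge_rel (T :\ e)) (ends e).1 (ends e).2.
Proof.
move=> aT eT; apply/negP => /edge_connP [p wp].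
have ej : joins e (ends e).2 (ends e).1 by rewrite joinsC joins_ends.
have eN : e \notin T :\ e by rewrite !inE eqxx.
have [x' [q [cq _ _ _]]] := walk_cycle eN ej wp.
by move/negP: (aT x' q); rewrite finset.setD1K in cq.
Qed.

Lemma spanning_sub S T : T \subset S ->
  (forall x y, connect (edge_rel T) x y = connect (edge_rel S) x y) ->
  exists2 F, spanning_forest S F & F \subset T.
Proof.
move=> sTS cTS.
pose P (F : {set edge G}) := (F \subset T) && (components F == components S).
have PT : P T by rewrite /P subxx; apply/components_eqP.
case: (arg_minnP (fun F : {set edge G} => #|F|) PT) => F /andP[sFT /components_eqP cF] minF.
exists F => //; split; first exact: fintype.subset_trans sFT sTS.
  exact/eqP/components_eqP.
move=> x p; apply/negP => cp.
have [e ein] : exists e, e \in unzip1 p.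
  case: p cp => [|[e z] p'] /and4P[] //= _ _ _ _; exists e; exact: mem_head.
have eF : e \in F by case/and4P: cp => _ wp _ _; exact: walk_edges wp ein.
have ce : connect (edge_rel (F :\ e)) (ends e).1 (ends e).2.
  apply: edge_conn_sub (edge_conn_cycle cp ein) => f; rewrite !inE => /andP[-> fp] /=.
  by case/and4P: cp => _ wp _ _; exact: walk_edges wp fp.
have PF : P (F :\ e).
  rewrite /P (fintype.subset_trans (finset.subD1set _ _) sFT); apply/components_eqP => u v.
  by rewrite conn_drop.
by move: (minF _ PF); rewrite (cardsD1 e F) eF add1n ltnn.
Qed.

Lemma mst_exists S : exists T, [/\ spanning_forest S T,
  (forall T', spanning_forest S T' -> weight T <= weight T') &
  mst_weight S = (weight T)%:E].
Proof.
have [F0 sF0 _] := @spanning_sub S S (subxx _) (fun _ _ => erefl).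
have [T sT minT] := fin_min (fun F : {set edge G} => weight F) sF0.
by exists T; split=> //; exact: ereal_inf_min.
Qed.

Lemma mst_weight_le S T : T \subset S ->
  (forall x y, connect (edge_rel T) x y = connect (edge_rel S) x y) ->
  (mst_weight S <= (weight T)%:E)%E.
Proof.
move=> sTS cTS; have [F sF sFT] := spanning_sub sTS cTS.
apply: ge_ereal_inf; exists (weight F)%:E; first by exists F.
by rewrite lee_fin weight_sub.
Qed.

End Forests.

(** * Unit trees *)

Lemma leq_card_rel (T1 T2 : finType) (A : {set T1}) (B : {set T2}) (r : T1 -> T2 -> bool) :
  (forall x, x \in A -> exists2 y, y \in B & r x y) ->
  (forall x x' y, x \in A -> x' \in A -> y \in B -> r x y -> r x' y -> x = x') ->
  (#|A| <= #|B|)%N.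
Proof.
move=> hex hinj; have [->|[x0 x0A]] := set_0Vmem A; first by rewrite cards0.
have [y0 _ _] := hex _ x0A.
pose f x := odflt y0 [pick y in B | r x y].
have fP x : x \in A -> (f x \in B) && r x (f x).
  move=> xA; rewrite /f; case: pickP => //= h.
  by have [y yB ry] := hex _ xA; move: (h y); rewrite yB ry.
rewrite -(@card_in_imset _ _ f); first last.
  move=> x x' xA x'A ff; have /andP[fB fr] := fP _ xA; have /andP[_ fr'] := fP _ x'A.
  by apply: (hinj x x' (f x)) => //; rewrite ff.
by apply/subset_leq_card/subsetP => _ /imsetP [x /fP/andP[h _] ->].
Qed.

Lemma sum_card_pairs (T U : finType) (A : {set T}) (f : T -> {set U}) :
  (\sum_(x in A) #|f x| = #|[set p : T * U | (p.1 \in A) && (p.2 \in f p.1)]|)%N.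
Proof.
rewrite -sum1_card (eq_bigl (fun p : T * U => (p.1 \in A) && (p.2 \in f p.1))); last first.
  by move=> p; rewrite inE.
rewrite -(pair_big_dep (mem A) (fun x y => y \in f x) (fun _ _ => 1%N)) /=.
by apply: eq_bigr => x _; rewrite sum1_card.
Qed.

Lemma double_count (T U : finType) (A : {set T}) (B : {set U}) (r : T -> U -> bool) :
  (\sum_(x in A) #|[set y in B | r x y]| = \sum_(y in B) #|[set x in A | r x y]|)%N.
Proof.
have cardE (V : finType) (C : {set V}) (P : pred V) :
    #|[set v in C | P v]| = (\sum_(v in C) P v)%N.
  by rewrite -sum1dep_card big_mkcondr; apply: eq_bigr => v _; case: (P v).
under eq_bigr do rewrite cardE; rewrite exchange_big /=.
by apply: eq_bigr => y _; rewrite cardE.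
Qed.

Section UnitTrees.
Variable Y : finType.
Implicit Types (S A : {set Y}) (e : rel Y) (x y z q : Y).

Definition nbrs e x : {set Y} := [set y | e x y].
Definition darts e : {set Y * Y} := [set p | e p.1 p.2].

(* A connected graph on S with at most #|S| - 1 edges, i.e. a tree. *)
Definition tree_on S e : Prop :=
  [/\ symmetric e, irreflexive e, forall x y, e x y -> x \in S,
      {in S &, forall x y, connect e x y} & (#|darts e| + 2 <= 2 * #|S|)%N].

Definition leaves e : {set Y} := [set x | #|nbrs e x| == 1]%N.

Fixpoint nball e A j : {set Y} :=
  if j is j'.+1 then nball e A j' :|: [set y | [exists x in nball e A j', e x y]]
  else A.

Lemma nball_sub1 e A j : nball e A j \subset nball e A j.+1.
Proof. exact: finset.subsetUl. Qed.

Lemma nballP e A j y :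
  reflect (exists x p, [/\ x \in A, path e x p, last x p = y & (size p <= j)%N])
          (y \in nball e A j).
Proof.
apply: (iffP idP).
- elim: j y => [|j IHj] y /=; first by move=> yA; exists y, [::].
  rewrite inE => /orP[/IHj [x [p [xA pp lp sp]]]|].
    by exists x, p; split=> //; exact: leqW.
  rewrite inE => /existsP [u /andP[/IHj [x [p [xA pp lp sp]]] uy]].
  exists x, (rcons p y); split=> //; last by rewrite size_rcons.
    by rewrite rcons_path pp lp.
  by rewrite last_rcons.
- case=> x [p [xA pp lp sp]].
  elim/last_ind: p j y pp lp sp => [|p u IHp] j y.
    move=> _ /= <- _; elim: j => [//|j IHj]; exact: (subsetP (nball_sub1 e A j) _ IHj).
  rewrite rcons_path last_rcons size_rcons => /andP[pp eu] <-.
  case: j => [//|j]; rewrite ltnS => sp.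
  rewrite /= inE; apply/orP; right; rewrite inE; apply/existsP.
  by exists (last x p); rewrite eu (IHp j _ pp erefl sp).
Qed.

Lemma nball_mono e A j k : (j <= k)%N -> nball e A j \subset nball e A k.
Proof.
move=> jk; apply/subsetP => y /nballP [x [p [xA pp lp sp]]].
by apply/nballP; exists x, p; split=> //; exact: leq_trans sp jk.
Qed.

Lemma nball_eq e e' A j : (forall y u, y \in nball e A j -> e' y u = e y u) ->
  nball e' A j = nball e A j.
Proof.
elim: j => [//|j IHj] h /=.
have {}IHj : nball e' A j = nball e A j.
  by apply: IHj => y u yb; apply: h; exact: (subsetP (nball_sub1 _ _ _)).
rewrite IHj; congr (_ :|: _); apply/setP => y; rewrite !inE.
apply: eq_existsb => x; case xb: (x \in nball e A j) => //=.
by apply: h; apply: (subsetP (nball_sub1 _ _ _)).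
Qed.

Lemma nballS e A j y : (y \in nball e A j.+1) =
  (y \in nball e A j) || [exists x in nball e A j, e x y].
Proof. by rewrite /= !inE. Qed.

(** Shells do not grow: a point of degree at most 2 outside [A] spends one edge on the previous
    shell and has at most one successor. The first shell is counted by the degrees in [A]. *)
Lemma nball_shell e A j : symmetric e ->
  (forall y, y \in nball e A j -> y \notin A -> (#|nbrs e y| <= 2)%N) ->
  (#|nball e A j.+1 :\: nball e A j| <= \sum_(x in A) #|nbrs e x|)%N.
Proof.
move=> se; elim: j => [|j IHj] hdeg.
  apply: leq_trans (_ : (#|\bigcup_(x in A) nbrs e x| <= _)%N).
    apply/subset_leq_card/subsetP => y; rewrite /= !inE => /andP[/negPf -> /=].
    case/existsP=> x /andP[xA xy]; apply/finset.bigcupP; exists x => //.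
    by rewrite inE.
  elim/big_rec2: _ => [|x m B xA hB]; first by rewrite cards0.
  apply: leq_trans (leq_card_setU _ _) _; exact: leq_add.
apply: leq_trans (IHj _); last first.
  by move=> y yb; apply: hdeg; exact: (subsetP (nball_sub1 _ _ _)).
apply: (@leq_card_rel _ _ _ _ (fun x y => e y x)).
- move=> x; rewrite in_setD (nballS _ _ j.+1) => /andP[xN].
  rewrite (negPf xN) => /existsP [y /andP[yb yx]].
  exists y => //; rewrite in_setD yb andbT; apply: contra xN => yj.
  by rewrite nballS; apply/orP; right; apply/existsP; exists y; rewrite yj.
- move=> x x' y; rewrite !in_setD => /andP[xN _] /andP[x'N _] /andP[yN yb] yx yx'.
  have [w wb wy] : exists2 w, w \in nball e A j & e w y.
    by move: yb; rewrite nballS (negPf yN) => /existsP [w /andP[]]; exists w.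
  apply/eqP; apply: contraT => xx'.
  have wN : w \in nball e A j.+1 by apply: (subsetP (nball_sub1 _ _ _)).
  have wx : w != x by apply: contraNneq xN => <-.
  have wx' : w != x' by apply: contraNneq x'N => <-.
  have yA : y \notin A.
    apply: contra yN => yA; apply/nballP; exists y, [::]; by split.
  (* A predecessor and two successors would be three neighbours of [y]. *)
  have : ([set w; x; x'] \subset nbrs e y).
    apply/subsetP => u; rewrite !inE => /orP[/orP[]|] /eqP-> //.
    by rewrite se.
  move/subset_leq_card; rewrite setUC cardsU1 !inE negb_or.
  rewrite (eq_sym x' w) wx' (eq_sym x' x) xx' /= cards2 wx /=.
  by move=> h; have := leq_trans h (hdeg _ yb yA).
Qed.

Lemma nball_card e A j : symmetric e ->
  (forall y, y \in nball e A j -> y \notin A -> (#|nbrs e y| <= 2)%N) ->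
  (#|nball e A j| <= #|A| + j * \sum_(x in A) #|nbrs e x|)%N.
Proof.
move=> se; elim: j => [|j IHj] hdeg; first by rewrite addn0.
have hj y : y \in nball e A j -> y \notin A -> (#|nbrs e y| <= 2)%N.
  by move=> yb; apply: hdeg; exact: (subsetP (nball_sub1 _ _ _)).
have -> : nball e A j.+1 = nball e A j :|: (nball e A j.+1 :\: nball e A j).
  by rewrite setDE setUIr setUCr setIT; apply/esym/finset.setUidPr/nball_sub1.
apply: leq_trans (leq_card_setU _ _) _.
by rewrite mulSn addnCA addnC leq_add ?IHj ?nball_shell.
Qed.

Lemma in_darts e x y : ((x, y) \in darts e) = e x y.
Proof. by rewrite inE. Qed.

Lemma darts_sum e : #|darts e| = (\sum_x #|nbrs e x|)%N.
Proof.
have -> : (\sum_x #|nbrs e x| = \sum_(x in [set: Y]) #|nbrs e x|)%N.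
  by apply: eq_bigl => x; rewrite inE.
by rewrite sum_card_pairs; apply: eq_card => p; rewrite !inE.
Qed.

Lemma tree_deg_gt0 S e x : tree_on S e -> (1 < #|S|)%N -> x \in S ->
  (0 < #|nbrs e x|)%N.
Proof.
case=> se ie eS cS _ S1 xS; rewrite card_gt0; apply/negP => /eqP n0.
have /card_gt1P [a [b [aS bS ab]]] := S1.
have [y yS yx] : exists2 y, y \in S & y != x.
  by have [ax|ax] := eqVneq a x; [exists b => //; rewrite eq_sym -ax|exists a].
have /connectP [[|u p] /= pp ly] := cS _ _ xS yS.
  by rewrite ly eqxx in yx.
by case/andP: pp => xu _; move/setP/(_ u): n0; rewrite !inE xu.
Qed.

(* Handshake: the deficit of the leaves pays for all branching vertices. *)
Lemma tree_special S e : tree_on S e -> (1 < #|S|)%N ->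
  (\sum_(x in [set x in S | #|nbrs e x| != 2]) #|nbrs e x| <= 4 * #|leaves e|)%N.
Proof.
move=> tS S1; case: (tS) => se ie eS cS dS.
have sumS : (\sum_(x in S) #|nbrs e x| = #|darts e|)%N.
  rewrite darts_sum [RHS](bigID (mem S)) /= [X in (_ + X)%N]big1 ?addn0 // => x xS.
  apply/eqP; rewrite cards_eq0; apply/eqP/setP => y; rewrite !inE.
  by apply: contraNF xS => /eS.
rewrite -(leq_add2r (6 * #|S|)).
(* Pointwise in the degree d: [d + 6 <= 4 * (d == 1) + 3 * d] when d is not 2, and [6 <= 3 * d] when
   it is. The darts number at most [2 * #|S| - 2], so three times their number is absorbed by
   [6 * #|S|]. *)
have h1 : (\sum_(x in [set x in S | #|nbrs e x| != 2]) #|nbrs e x| + 6 * #|S| <=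
  \sum_(x in S) (4 * (x \in leaves e) + 3 * #|nbrs e x|))%N.
  rewrite (eq_bigl (fun x => (x \in S) && (#|nbrs e x| != 2)%N)); last first.
    by move=> x; rewrite inE.
  rewrite big_mkcondr /= -sum1_card big_distrr /= -big_split /=.
  apply: leq_sum => x xS; have := tree_deg_gt0 tS S1 xS.
  rewrite inE; case: #|nbrs e x| => [//|[|[|d]]] _ //=; lia.
apply: leq_trans h1 _; rewrite big_split /= -!big_distrr /= sumS.
have h2 : (\sum_(x in S) (x \in leaves e) <= #|leaves e|)%N.
  rewrite -sum1_card big_mkcond [leqRHS]big_mkcond /=; apply: leq_sum => x _.
  by case: (x \in S) => //; case: (x \in leaves e).
lia.
Qed.

End UnitTrees.

(** * Trimming the leaves of an anchored tree *)

Section Anchors.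
Variables (R : realType) (Y : finType) (V : Type).
Implicit Types (S : {set Y}) (e : rel Y) (x y z q : Y).
Implicit Types (anch : Y -> V -> R -> Prop).

(* reach v v' c: there is a connection from v to v' of weight at most c. *)
Definition reach_law (reach : V -> V -> R -> Prop) : Prop :=
  [/\ forall v v' c c', c <= c' -> reach v v' c -> reach v v' c',
      forall v v' c, reach v v' c -> reach v' v c &
      forall u v w c c', reach u v c -> reach v w c' -> reach u w (c + c')].

(* The unit tree e dominates the reach metric, a point v anchored at y with
   error r; mu is the length of one tree edge. *)
Definition dominates (reach : V -> V -> R -> Prop) mu e anch : Prop :=
  forall y v r y' v' r' p, anch y v r -> anch y' v' r' ->
    path e y p -> last y p = y' -> reach v v' (mu * (size p)%:R + r + r').

Variables (reach : V -> V -> R -> Prop) (mu : R).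
Hypotheses (lawr : reach_law reach) (mu0 : 0 <= mu).

Lemma leaf_nbr e x : x \in leaves e -> exists y, nbrs e x = [set y].
Proof. by rewrite inE => /cards1P. Qed.

(** All leaves go at once, and what was anchored at a leaf moves to its only neighbour for one more
    [mu] of error. A vertex becomes a leaf only by losing a leaf, and a leaf has one neighbour, so
    leaf counts never increase. *)
Lemma trim1 S e anch : tree_on S e -> (2 < #|S|)%N ->
  (forall y v r, anch y v r -> y \in S) -> dominates reach mu e anch ->
  exists S' e' anch',
  [/\ [/\ tree_on S' e', S' \subset S & subrel e' e],
      [/\ forall y v r, anch' y v r -> y \in S', dominates reach mu e' anch',
        forall y v r, anch y v r -> exists y' r', anch' y' v r' /\ r' <= r + mu &
        forall y v r, y \in S' -> anch y v r -> anch' y v r],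
      (#|S'| + #|leaves e|)%N = #|S| & (#|leaves e'| <= #|leaves e|)%N].
Proof.
move=> tS S3 aS dom; case: (tS) => se ie eS cS dS.
pose L := leaves e.
have LS : L \subset S.
  by apply/subsetP => x /leaf_nbr [y /setP/(_ y)]; rewrite !inE eqxx => /eS.
pose nb x := odflt x [pick y | e x y].
have nbP x : x \in L -> nbrs e x = [set nb x].
  move=> /leaf_nbr [y n]; rewrite n; congr [set _]; rewrite /nb.
  have E u : e x u = (u == y) by move/setP/(_ u): n; rewrite !inE.
  by case: pickP => [u|h]; [rewrite E => /eqP|have := h y; rewrite E eqxx].
have nbE x y : x \in L -> e x y = (y == nb x).
  by move=> /nbP/setP/(_ y); rewrite !inE.
(* Two adjacent leaves would be the whole tree. *)
have LL x : x \in L -> nb x \notin L.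
  move=> xL; apply/negP => nL; have exn : e x (nb x) by rewrite nbE.
  have nnb : nb (nb x) = x by apply/esym/eqP; rewrite -nbE // se.
  suff : S \subset [set x; nb x].
    by move/subset_leq_card; rewrite cards2; case: (x != nb x); lia.
  apply/subsetP => y yS.
  have [p pp ->] := connectP (cS x y (subsetP LS _ xL) yS).
  suff key w : path e w p -> w \in [set x; nb x] -> last w p \in [set x; nb x].
    by apply: key pp _; rewrite !inE eqxx.
  elim: p w {pp} => [//|u p IHp] w /= /andP[wu pp] win.
  apply: IHp pp _; move: win wu; rewrite !inE => /orP[/eqP->|/eqP->].
    by rewrite nbE // => ->; rewrite orbT.
  by rewrite nbE // nnb => ->.
have nbS x : x \in L -> nb x \in S.
  by move=> xL; apply: (eS _ x); rewrite se nbE.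
pose S' := S :\: L.
pose e' x y := [&& e x y, x \in S' & y \in S'].
pose rt x := if x \in L then nb x else x.
have rtS x : x \in S -> rt x \in S'.
  by move=> xS; rewrite /rt inE; case: ifP => [xL|->//]; rewrite LL // nbS.
have rtid x : x \in S' -> rt x = x by rewrite inE /rt => /andP[/negPf->].
have se' : symmetric e' by move=> x y; rewrite /e' se [(_ \in _) && _]andbC.
exists S', e', (fun y v r => y \in S' /\
   (anch y v r \/ exists2 x, x \in L /\ nb x = y & anch x v (r - mu))).
split.
- split; first split.
  + exact: se'.
  + by move=> x; rewrite /e' ie.
  + by move=> x y /and3P[].
  + move=> x y xS yS; rewrite -(rtid _ xS) -(rtid _ yS).
    have [p pp ->] : exists2 p, path e x p & y = last x p.
      by apply/connectP/cS; [move: xS|move: yS]; rewrite inE => /andP[].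
    elim: p x {xS} pp => [|u p IHp] x /=; first by rewrite connect0.
    case/andP=> xu /IHp; apply: connect_trans.
    have xS := eS _ _ xu; have uS : u \in S by apply: (eS _ x); rewrite se.
    have := rtS _ xS; have := rtS _ uS; rewrite /rt.
    case: ifP => uL; case: ifP => xL uS' xS'.
    * by move: xu; rewrite nbE // => /eqP E; move: (LL _ xL); rewrite -E uL.
    * by move: xu; rewrite se nbE // => /eqP->; exact: connect0.
    * by move: xu; rewrite nbE // => /eqP->; exact: connect0.
    * by apply: connect1; rewrite /e' xu uS' xS'.
  + have h : (#|darts e'| + #|L| + #|L| <= #|darts e|)%N.
      pose D1 := [set (x, nb x) | x in L]; pose D2 := [set (nb x, x) | x in L].
      have c1 : #|D1| = #|L| by rewrite card_imset // => x y [].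
      have c2 : #|D2| = #|L| by rewrite card_imset // => x y [].
      rewrite -{1}c1 -c2 -cardsUI.
      have -> : darts e' :&: D1 = set0.
        apply/setP => -[a b]; rewrite in_set0 in_setI inE /=; apply/negP => /andP[/and3P[_ aS' _]].
        by case/imsetP => x xL [ax _]; move: aS'; rewrite inE ax xL.
      rewrite cards0 addn0 -cardsUI.
      have -> : (darts e' :|: D1) :&: D2 = set0.
        apply/setP => -[a b]; rewrite in_set0 in_setI in_setU; apply/negP => /andP[/orP[]].
          rewrite inE /= => /and3P[_ _ bS'] /imsetP [x xL [_ bx]].
          by move: bS'; rewrite inE bx xL.
        case/imsetP => x xL [-> ->] /imsetP [x' x'L [xe _]].
        by move: (LL _ x'L); rewrite -xe xL.
      rewrite cards0 addn0; apply/subset_leq_card/subsetP => -[a b].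
      rewrite !in_setU !in_darts.
      case/orP => [/orP[/and3P[]//|]|] /imsetP [x xL [-> ->]].
        by rewrite nbE.
      by rewrite se nbE.
    have : (#|S'| + #|L| = #|S|)%N by rewrite cardsDS // subnK // subset_leq_card.
    lia.
  + exact: subsetDl.
  + by move=> x y /and3P[].
- have [mono sym tr] := lawr; split.
  + by move=> y v r [].
  + have ee' x p : path e' x p -> path e x p by apply: sub_path => a b /and3P[].
    move=> y v r y' v' r' p [_ ha] [_ ha'] /ee' pp lp.
    case: ha => [ha|[x [xL nx] ha]]; case: ha' => [ha'|[x' [x'L nx'] ha']].
    * exact: dom ha ha' pp lp.
    * have := dom _ _ _ _ _ _ (rcons p x') ha ha'.
      rewrite rcons_path pp lp se nbE // nx' eqxx last_rcons => /(_ isT erefl).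
      by apply: mono; rewrite size_rcons mulrSr; lra.
    * have := dom _ _ _ _ _ _ (y :: p) ha ha'.
      rewrite /= pp lp nbE // nx eqxx => /(_ isT erefl).
      by apply: mono; rewrite mulrSr; lra.
    * have := dom _ _ _ _ _ _ (y :: rcons p x') ha ha'.
      rewrite /= rcons_path pp lp last_rcons nbE // nx eqxx se nbE // nx' eqxx.
      move=> /(_ isT erefl).
      by apply: mono; rewrite size_rcons !mulrSr; lra.
  + move=> y v r ha; have yS := rtS _ (aS _ _ _ ha).
    move: yS; rewrite /rt; case: ifP => yL yS; last first.
      by exists y, r; split; [split=> //; left|rewrite lerDl].
    exists (nb y), (r + mu); split=> //; split=> //.
    by right; exists y; rewrite ?addrK.
  + by move=> y v r yS' ha; split=> //; left.
- by rewrite cardsDS // subnK // subset_leq_card.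
- apply: (@leq_card_rel _ _ _ _ (fun x y => e x y)).
  + move=> x /leaf_nbr [u hu].
    have /and3P[xu xS' uS'] : e' x u by move/setP/(_ u): hu; rewrite !inE eqxx.
    have xL : x \notin L by move: xS'; rewrite inE => /andP[].
    have : #|nbrs e x| != 1%N by move: xL; rewrite !inE.
    move/eqP => x1; suff /existsP[y /andP[yu xy]] : [exists y, (y != u) && e x y].
      exists y => //; apply: contraT => yL.
      have yS : y \in S by apply: (eS _ x); rewrite se.
      move/setP/(_ y): hu; rewrite !inE (negPf yu) => /negP/negP.
      by rewrite /e' xy xS' inE yS andbT /= yL.
    apply: contraT; rewrite negb_exists => /forallP h; case: x1.
    rewrite (_ : nbrs e x = [set u]) ?cards1 //; apply/setP => y.
    rewrite !inE; have := h y; have [->|yu] := eqVneq y u; first by rewrite xu.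
    by move=> /= /negPf.
  + move=> x x' y _ _ yL; rewrite se nbE // => /eqP->; rewrite se nbE // => /eqP->.
    by [].
Qed.

Lemma tree_path_sub S e x p : tree_on S e -> x \in S -> path e x p ->
  {subset x :: p <= S}.
Proof.
case=> se _ eS _ _ xS pp u; rewrite inE => /orP[/eqP-> //|].
elim: p x {xS} pp => [//|v p IHp] x /= /andP[xv pp].
by rewrite inE => /orP[/eqP->|/(IHp _ pp) //]; apply: (eS _ x); rewrite se.
Qed.

Lemma tree_uniq_path S e x y : tree_on S e -> x \in S -> y \in S ->
  exists p, [/\ path e x p, last x p = y, uniq (x :: p) & (size p < #|S|)%N].
Proof.
move=> tS xS yS; have [_ _ _ cS _] := tS.
have [p pp ->] := connectP (cS _ _ xS yS).
have [p' pp' up' _] := shortenP pp.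
exists p'; split=> //.
rewrite -[_.+1]/(size (x :: p')) -(card_uniqP up').
by apply/subset_leq_card/subsetP; exact: tree_path_sub pp'.
Qed.

(** As leaf counts never increase, [n] rounds delete at least [n] points per leaf that remains; this
    later pays for neighbourhoods of branching points. The far pair keeps more than two vertices
    alive, a round using up [2 * mu] of its distance. *)
Lemma trimR n S e anch : tree_on S e ->
  (forall y v r, anch y v r -> y \in S) -> dominates reach mu e anch ->
  (exists y1 v1 r1 y2 v2 r2, [/\ anch y1 v1 r1, anch y2 v2 r2 &
     ~ reach v1 v2 (mu * (2 * n + 2)%:R + r1 + r2)]) ->
  exists S' e' anch',
  [/\ [/\ tree_on S' e', S' \subset S, subrel e' e & (2 < #|S'|)%N],
      [/\ forall y v r, anch' y v r -> y \in S', dominates reach mu e' anch',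
        forall y v r, anch y v r -> exists y' r', anch' y' v r' /\ r' <= r + mu * n%:R &
        forall y v r, y \in S' -> anch y v r -> anch' y v r],
      (#|S'| + n * #|leaves e'| <= #|S|)%N & (#|leaves e'| <= #|leaves e|)%N].
Proof.
have [mono sym tr] := lawr.
elim: n S e anch => [|n IHn] S e anch tS aS dom [y1 [v1 [r1 [y2 [v2 [r2 [h1 h2 far]]]]]]].
all: have S3 : (2 < #|S|)%N
  by (rewrite ltnNge; apply/negP => S2; apply: far;
      have [p [pp lp _ sp]] := tree_uniq_path tS (aS _ _ _ h1) (aS _ _ _ h2);
      apply: mono (dom _ _ _ _ _ _ _ h1 h2 pp lp);
      rewrite !lerD2r ler_wpM2l // ler_nat; lia).
  exists S, e, anch; split=> //; first by split=> //; split.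
    split=> // y v r ha; exists y, r; split=> //.
    by rewrite mulr0 addr0.
  by rewrite mul0n addn0.
have [S1 [e1 [anch1 [[tS1 sS1 se1] [aS1 dom1 cov1 fix1] c1 l1]]]] := trim1 tS S3 aS dom.
have [|S' [e' [anch' [[tS' sS' se' S'3] [aS' dom' cov' fix'] c' l']]]] :=
    IHn _ _ _ tS1 aS1 dom1.
  have [y1' [r1' [h1' hr1]]] := cov1 _ _ _ h1.
  have [y2' [r2' [h2' hr2]]] := cov1 _ _ _ h2.
  exists y1', v1, r1', y2', v2, r2'; split=> // h; apply: far; apply: mono h.
  have -> : (2 * n.+1 + 2)%:R = (2 * n + 2)%:R + 2%:R :> R by rewrite -natrD; congr (_%:R); lia.
  by rewrite mulrDr; lra.
exists S', e', anch'; split.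
- split=> //; first exact: fintype.subset_trans sS' sS1.
  by move=> x y /se' /se1.
- split=> //.
  + move=> y v r /cov1 [y1' [r1' [h1' hr1]]].
    have [y' [r' [h' hr]]] := cov' _ _ _ h1'; exists y', r'; split=> //.
    by rewrite mulrSr mulrDr; lra.
  + by move=> y v r yS' ha; apply: fix' => //; apply: fix1 => //; exact: (subsetP sS').
- by rewrite mulSn; lia.
- exact: leq_trans l' l1.
Qed.

End Anchors.

(** * Rehanging a tree along an edge *)

Section Rehang.
Variables (Y : finType) (S : {set Y}) (e : rel Y).
Hypothesis tS : tree_on S e.
Variables (q z : Y) (D l : nat).
Hypotheses (qS : q \in S) (zS : z \in S) (l0 : (0 < l)%N) (lD : (l.+1 < D)%N).
Hypothesis deg2 : forall y, y \in nball e [set q] D -> #|nbrs e y| = 2%N.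
Hypothesis zN : z \notin nball e [set q] D.

(* The tree path from q to z starts with D vertices v 1, .., v D of degree 2.
   The part v l.+1, .., v D.-1 is cut out and v l is linked to z instead. *)
Lemma rehang_path : exists v : nat -> Y, exists n,
  [/\ v 0%N = q, v n = z, (D < n)%N,
      forall j, (j < n)%N -> e (v j) (v j.+1) &
      forall i j, (i <= n)%N -> (j <= n)%N -> v i = v j -> i = j].
Proof.
have [p [pp lp up _]] := tree_uniq_path tS qS zS.
have vn j : (j <= size p)%N -> nth q (q :: p) j = last q (take j p).
  elim: j (p) {pp lp up} q => [|j IHj] [|u s] a //= js.
  rewrite (set_nth_default u) //=; exact: IHj.
exists (nth q (q :: p)), (size p); split=> //.
- by rewrite vn // take_size.
- rewrite ltnNge; apply/negP => sp; case/negP: zN.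
  by apply/nballP; exists q, p; rewrite set11.
- by move=> j jp; exact: (pathP q pp).
- by move=> i j ip jp /eqP; rewrite nth_uniq // => /eqP.
Qed.

Lemma nbrs2 y a b : #|nbrs e y| = 2%N -> e y a -> e y b -> a != b ->
  forall u, e y u = (u == a) || (u == b).
Proof.
move=> d2 ya yb ab u; have sub : [set a; b] \subset nbrs e y.
  by apply/subsetP => t; rewrite !inE => /orP[] /eqP->.
have /eqP E : [set a; b] == nbrs e y by rewrite eqEcard sub d2 cards2 ab.
by move/setP/(_ u): E; rewrite !inE.
Qed.

Variables (v : nat -> Y) (n : nat).
Hypotheses (v0 : v 0%N = q) (vz : v n = z) (Dn : (D < n)%N).
Hypothesis ve : forall j, (j < n)%N -> e (v j) (v j.+1).
Hypothesis vinj : forall i j, (i <= n)%N -> (j <= n)%N -> v i = v j -> i = j.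

Lemma v_ball j : (j <= D)%N -> v j \in nball e [set q] j.
Proof.
elim: j => [|j IHj] jD; first by rewrite v0 /= inE.
rewrite nballS; apply/orP; right; apply/existsP; exists (v j).
by rewrite IHj ?ve //; lia.
Qed.

Lemma v_zone j : (j <= D)%N -> v j \in nball e [set q] D.
Proof. by move=> jD; apply: (subsetP (nball_mono _ _ jD)); exact: v_ball. Qed.

Lemma v_nbr j u : (j < D)%N -> e (v j.+1) u = (u == v j) || (u == v j.+2).
Proof.
have [se _ _ _ _] := tS; move=> jD; apply: nbrs2.
- by apply: deg2; apply: v_zone; lia.
- by rewrite se ve //; lia.
- by apply: ve; lia.
- by apply/eqP => /vinj h; have := h _ _; lia.
Qed.

Definition cutset : {set Y} := [set v (l.+1 + nat_of_ord i)%N | i : 'I_(D - l.+1)].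
(** The kept part of the path. It becomes the inside of a bridge of [l.+1] edges from [q] to [z],
    and carries no anchors. *)
Definition pend : {set Y} := [set v (nat_of_ord i).+1 | i : 'I_l].

Lemma cutsetP y : reflect (exists j, [/\ (l < j)%N, (j < D)%N & y = v j]) (y \in cutset).
Proof.
apply: (iffP imsetP) => [[i _ ->]|[j [lj jD ->]]].
  exists (l.+1 + i)%N; split=> //; [lia|by have := ltn_ord i; lia].
have h : (j - l.+1 < D - l.+1)%N by lia.
by exists (Ordinal h) => //=; congr v; lia.
Qed.

Lemma pendP y : reflect (exists j, [/\ (0 < j)%N, (j <= l)%N & y = v j]) (y \in pend).
Proof.
apply: (iffP imsetP) => [[i _ ->]|[j [lj jD ->]]].
  by exists i.+1; split=> //; exact: ltn_ord.
have h : (j.-1 < l)%N by lia.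
by exists (Ordinal h) => //=; congr v; lia.
Qed.

Lemma card_cutset : #|cutset| = (D - l.+1)%N.
Proof.
rewrite card_in_imset ?card_ord // => i j _ _ /vinj h; apply/val_inj => /=.
by have := h _ _; have := ltn_ord i; have := ltn_ord j; lia.
Qed.

Lemma v_cut j : (j <= n)%N -> (v j \in cutset) = (l < j < D)%N.
Proof.
move=> jn; apply/cutsetP/andP => [[i [li iD /vinj h]]|[lj jD]]; last by exists j.
by have := h jn; split; lia.
Qed.

Lemma v_pend j : (j <= n)%N -> (v j \in pend) = (0 < j <= l)%N.
Proof.
move=> jn; apply/pendP/andP => [[i [li iD /vinj h]]|[lj jD]]; last by exists j.
by have := h jn; split; lia.
Qed.

Definition re : rel Y := fun x y =>
  [|| [&& e x y, x \notin cutset & y \notin cutset],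
      (x == v l) && (y == z) | (x == z) && (y == v l)].

Let S' := S :\: cutset.

Lemma re_sym : symmetric re.
Proof.
have [se _ _ _ _] := tS; move=> x y; rewrite /re se [(y \notin _) && _]andbC.
congr (_ || _); rewrite orbC andbC; congr (_ || _); exact: andbC.
Qed.

Lemma z_cut : z \notin cutset.
Proof. rewrite -vz v_cut //; move: Dn; lia. Qed.

Lemma z_pend : z \notin pend.
Proof. rewrite -vz v_pend //; move: Dn lD; lia. Qed.

Lemma v_S j : (j <= n)%N -> v j \in S.
Proof.
have [se _ eS _ _] := tS; move=> jn; case: (ltnP j n) => h.
  exact: eS (ve h).
by rewrite (_ : j = n) ?vz //; lia.
Qed.

Lemma cut_nbr x y : e x y -> x \notin cutset -> y \in cutset -> x = v l \/ x = v D.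
Proof.
have [se _ _ _ _] := tS.
move=> xy xc /cutsetP [j [lj jD yE]]; move: xy; rewrite se yE.
case: j lj jD yE => // j lj jD yE; rewrite v_nbr //; last by lia.
case/orP => /eqP xE; move: xc; rewrite xE v_cut; try lia.
  by move=> h; left; congr v; lia.
by move=> h; right; congr v; lia.
Qed.

Lemma re_outside y u : y \notin nball e [set q] D -> y != z -> re y u = e y u.
Proof.
move=> yN yz; rewrite /re (negPf yz) /= orbF.
have -> : (y == v l) = false.
  by apply: contraNF yN => /eqP->; apply: v_zone; lia.
have yc : y \notin cutset.
  by apply: contra yN => /cutsetP [j [_ jD ->]]; apply: v_zone; lia.
rewrite yc orbF /=; case yu: (e y u) => //=; apply/negP => uc.
have [E|E] := cut_nbr yu yc uc; case/negP: yN; rewrite E; apply: v_zone; lia.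
Qed.

Lemma re_card : (#|S'| + (D - l.+1) = #|S|)%N.
Proof.
have sub : cutset \subset S.
  by apply/subsetP => a /cutsetP [j [_ jD ->]]; apply: v_S; lia.
by rewrite -card_cutset cardsDS // subnK // subset_leq_card.
Qed.

Lemma re_tree : tree_on S' re.
Proof.
have [se ie eS cS dS] := tS.
have hS x y : re x y -> x \in S'.
  rewrite inE => /or3P[/and3P[/eS-> -> //]|/andP[/eqP-> _]|/andP[/eqP-> _]].
    by rewrite v_S ?v_cut //; lia.
  by rewrite zS z_cut.
split=> //.
- exact: re_sym.
- move=> x; rewrite /re ie /=; apply/negP => /orP[] /andP[/eqP-> /eqP].
    by move=> E; move: z_pend; rewrite -E v_pend //; lia.
  by move=> E; move: z_pend; rewrite E v_pend //; lia.
- have rcs : connect_sym re by apply/sym_connect_sym/re_sym.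
  have tz : connect re (v l) z by apply: connect1; rewrite /re !eqxx orbT.
  have qt j : (j <= l)%N -> connect re q (v j).
    elim: j => [|j IHj] jl; first by rewrite v0.
    apply: connect_trans (IHj (ltnW jl)) (connect1 _).
    by rewrite /re ve ?v_cut //; lia.
  have zD j : (D + j <= n)%N -> connect re (v D) (v (D + j)).
    elim: j => [|j IHj] jl; first by rewrite addn0.
    apply: connect_trans (IHj _) (connect1 _); first by lia.
    by rewrite addnS /re ve ?v_cut //; lia.
  have Dt : connect re (v D) (v l).
    apply: connect_trans (zD (n - D)%N _) _; first by lia.
    by rewrite subnKC ?vz 1?rcs //; lia.
  suff key x : x \in S' -> connect re x (v l).
    by move=> x y xS yS; apply: connect_trans (key _ xS) _; rewrite rcs; exact: key.
  rewrite inE => /andP[xc xS]; have [p pp lp] := connectP (cS _ _ xS qS).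
  elim: p x xc {xS} pp lp => [|u p IHp] x xc /=.
    by move=> _ <-; exact: qt.
  case/andP=> xu pp lp; have [uc|uc] := boolP (u \in cutset).
    by have [->|->] := cut_nbr xu xc uc; rewrite ?connect0.
  by apply: connect_trans (connect1 _) (IHp _ uc pp lp); rewrite /re xu xc uc.
- pose A1 := [set (v (l + nat_of_ord i)%N, v (l + nat_of_ord i).+1) | i : 'I_(D - l)].
  pose A2 := [set (v (l + nat_of_ord i).+1, v (l + nat_of_ord i)%N) | i : 'I_(D - l)].
  have c1 : #|A1| = (D - l)%N.
    rewrite card_in_imset ?card_ord // => i j _ _ [/vinj h _]; apply/val_inj => /=.
    by have := h _ _; have := ltn_ord i; have := ltn_ord j; lia.
  have c2 : #|A2| = (D - l)%N.
    rewrite card_in_imset ?card_ord // => i j _ _ [_ /vinj h]; apply/val_inj => /=.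
    by have := h _ _; have := ltn_ord i; have := ltn_ord j; lia.
  have A12 : A1 :&: A2 = set0.
    apply/setP => a; rewrite in_set0 in_setI; apply/negP => /andP[/imsetP[i _ ->]].
    case/imsetP => j _ [/vinj h1 /vinj h2].
    by have := h1 _ _; have := h2 _ _; have := ltn_ord i; have := ltn_ord j; lia.
  have h1 : (#|darts re| <= #|darts e :\: (A1 :|: A2)| + 2)%N.
    apply: leq_trans (_ : #|(darts e :\: (A1 :|: A2)) :|: [set (v l, z); (z, v l)]| <= _)%N.
      apply/subset_leq_card/subsetP => -[a b]; rewrite in_darts.
      rewrite in_setU in_setD in_darts in_setU !inE !xpair_eqE.
      case/or3P => [/and3P[-> ac bc]|-> |->]; rewrite ?orbT // andbT.
      apply/orP; left; apply/negP => /orP[] /imsetP [i _ [aE bE]].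
        move: ac bc; rewrite aE bE !v_cut; have := ltn_ord i; lia.
      move: ac bc; rewrite aE bE !v_cut; have := ltn_ord i; lia.
    apply: leq_trans (leq_card_setU _ _) _; rewrite leq_add2l cards2.
    by case: (_ != _).
  have h2 : (#|darts e :\: (A1 :|: A2)| + #|A1 :|: A2| = #|darts e|)%N.
    have sub : A1 :|: A2 \subset darts e.
      apply/subsetP => -[a b]; rewrite in_darts in_setU.
      case/orP => /imsetP [i _ [-> ->]]; last rewrite se; apply: ve;
      by have := ltn_ord i; lia.
    by rewrite cardsDS // subnK // subset_leq_card.
  have h3 : (#|A1 :|: A2| = 2 * (D - l))%N.
    by rewrite cardsU A12 cards0 c1 c2 subn0 mul2n addnn.
  have h4 := re_card; lia.
Qed.

Lemma v_path j : (j <= D)%N -> exists2 p, path e q p & last q p = v j /\ size p = j.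
Proof.
elim: j => [|j IHj] jD; first by exists [::].
have [p pp [lp sp]] := IHj (ltnW jD).
exists (rcons p (v j.+1)); last by rewrite last_rcons size_rcons sp.
by rewrite rcons_path pp lp ve //; lia.
Qed.

Lemma path_rev (T : Type) (r : rel T) a p : symmetric r -> path r a p ->
  exists2 p', path r (last a p) p' & last (last a p) p' = a /\ size p' = size p.
Proof.
move=> sr pp; exists (rev (belast a p)).
  by rewrite rev_path (eq_path (e' := r)) // => b c; rewrite sr.
split; last by rewrite size_rev size_belast.
by case: p {pp} => //= b p; rewrite rev_cons last_rcons.
Qed.

Lemma re_pend j u : (0 < j)%N -> (j <= l)%N -> re (v j) u ->
  [\/ u = v j.-1, u = v j.+1 /\ (j < l)%N | u = z /\ j = l].
Proof.
case: j => // j _ jl; rewrite /re => /or3P[/and3P[]||].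
- rewrite v_nbr; last by lia.
  move=> /orP[]/eqP-> _; first by constructor 1.
  by rewrite v_cut => [h|]; [constructor 2; split=> //; lia|lia].
- by case/andP=> /eqP /vinj h /eqP->; constructor 3; split=> //; apply: h; lia.
- by case/andP=> /eqP E; move: z_pend; rewrite -E v_pend; lia.
Qed.

(** From position [j] of the bridge it takes at least [j] steps back to [q] and at least [l.+1 - j]
    steps on to [z]. Hence a full crossing takes at least [l.+1] steps. *)
Lemma re_exit j p : (0 < j)%N -> (j <= l)%N -> path re (v j) p ->
  last (v j) p \notin pend -> exists p3 p4,
  (p = p3 ++ q :: p4 /\ (j <= (size p3).+1)%N) \/
  (p = p3 ++ z :: p4 /\ (l < (size p3).+1 + j)%N).
Proof.
elim: p j => [|u p IHp] j j0 jl /=; first by rewrite v_pend ?j0 ?jl //; lia.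
case/andP=> ju pp lp; have := re_pend j0 jl ju.
case=> [uE|[uE jl']|[uE jE]].
- have [j1|j1] := eqVneq j 1%N.
    by exists [::], p; left; split; rewrite ?uE j1 //= v0.
  rewrite uE in pp lp; case: (IHp _ _ _ pp lp); [lia|lia|] => p3 [p4 [[-> h]|[-> h]]].
    by exists (u :: p3), p4; left; split=> //=; lia.
  by exists (u :: p3), p4; right; split=> //=; lia.
- rewrite uE in pp lp; case: (IHp _ _ _ pp lp) => // p3 [p4 [[-> h]|[-> h]]].
    by exists (u :: p3), p4; left; split=> //=; lia.
  by exists (u :: p3), p4; right; split=> //=; lia.
- by exists [::], p; right; split; rewrite ?uE //=; lia.
Qed.

Lemma re_avoid y p : path re y p -> y \notin pend -> all (fun u => u \notin pend) p ->
  path e y p.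
Proof.
elim: p y => [//|u p IHp] y /= /andP[yu pp] yp /andP[up ap].
rewrite (IHp _ pp up ap) andbT.
case/or3P: yu => [/and3P[]//||] /andP[/eqP a /eqP b].
  by move: yp; rewrite a v_pend; lia.
by move: up; rewrite b v_pend; lia.
Qed.

Lemma re_enter y p : path re y p -> y \notin pend -> ~~ all (fun u => u \notin pend) p ->
  exists p1 j p2, [/\ p = p1 ++ v j :: p2, path e y p1, (0 < j <= l)%N &
     last y p1 = q /\ j = 1%N \/ last y p1 = z /\ j = l].
Proof.
elim: p y => [//|u p IHp] y /= /andP[yu pp] yp.
have [up|up] := boolP (u \in pend) => /=; last first.
  case/(IHp _ pp up) => p1 [j [p2 [-> pp1 jl h]]].
  exists (u :: p1), j, p2; split=> //=; rewrite pp1 andbT.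
  by have /= := re_avoid (p := [:: u]) _ yp; rewrite yu up => /(_ isT isT) /andP[].
move=> _; case/pendP: up => j [j0 jl uE]; exists [::], j, p; rewrite uE j0 jl; split=> //=.
have := re_pend j0 jl; rewrite -uE => /(_ y); rewrite re_sym => /(_ yu).
case=> [yE|[yE jl']|[yE jE]].
- have [j1|j1] := eqVneq j 1%N; first by left; rewrite yE j1 v0.
  by move: yp; rewrite yE v_pend; lia.
- by move: yp; rewrite yE v_pend; lia.
- by right.
Qed.

Lemma q_pend : q \notin pend.
Proof. by rewrite -v0 v_pend. Qed.

Variables (R : realType) (V : Type) (reach : V -> V -> R -> Prop) (mu : R).
Hypotheses (lawr : reach_law reach) (mu0 : 0 <= mu).
Variable anch : Y -> V -> R -> Prop.
Hypothesis aS : forall y v r, anch y v r -> y \in S.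
Hypothesis dom : dominates reach mu e anch.
Variables (x x' : V) (kappa w rz : R).
Hypotheses (hq : anch q x kappa) (hz : anch z x' rz) (hxx : reach x x' w).
(** The bridge must be at least as long as the route from [q] through [x] and [x'] to [z] for which
    it stands. *)
Definition cost_ok : Prop := kappa + w + rz <= mu * l.+1%:R.
Hypothesis mul : cost_ok.

(** Anchors on the cut or on the bridge slide back to [q]; remembering the former position [v j]
    keeps the old tree available for estimates. *)
Definition ra : Y -> V -> R -> Prop := fun y u r =>
  [/\ y \in S', y \notin pend &
     anch y u r \/ y = q /\ exists j, [/\ (0 < j)%N, (j < D)%N & anch (v j) u (r - mu * j%:R)]].

(** Sliding along [j] edges raised the error by [mu * j], which pays for walking from [q] back to
    the former position. *)
Lemma ra_old : dominates reach mu e ra.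
Proof.
have [mono sym tr] := lawr; have [se _ _ _ _] := tS.
suff h1 y u r y' u' r' p : ra y u r -> anch y' u' r' -> path e y p ->
    last y p = y' -> reach u u' (mu * (size p)%:R + r + r').
  move=> y u r y' u' r' p h [y'S _ [h'|[y'q [j [_ jD h']]]]] pp lp.
    exact: h1 h h' pp lp.
  have [s ps [ls ss]] := v_path (ltnW jD).
  have := h1 _ _ _ _ _ _ (p ++ s) h h'.
  rewrite cat_path pp lp y'q ps last_cat lp y'q ls => /(_ isT erefl).
  by apply: mono; rewrite size_cat natrD ss mulrDr; lra.
move=> [yS _ [h|[yq [j [_ jD h]]]]] h' pp lp; first exact: dom h h' pp lp.
have [s ps [ls ss]] := v_path (ltnW jD).
have [s' ps' [ls' ss']] := path_rev se ps.
rewrite ls in ps' ls'.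
have := dom (p := s' ++ p) h h'.
rewrite cat_path ps' ls' -yq pp last_cat ls' -yq lp => /(_ isT erefl).
by apply: mono; rewrite size_cat natrD ss' ss mulrDr; lra.
Qed.

Lemma ra_q : ra q x kappa.
Proof.
split; [|exact: q_pend|by left].
by rewrite inE qS andbT -v0 v_cut.
Qed.

Lemma ra_z : ra z x' rz.
Proof. by split; [rewrite inE zS z_cut|exact: z_pend|left]. Qed.

(** A path that enters the bridge either returns to the end where it entered, and this excursion is
    cut out, or crosses it, and the [l.+1] edges pay for the route through [x] and [x']. Both leave
    a shorter path, whence the induction on length. *)
Lemma ra_dom : dominates reach mu re ra.
Proof.
have [mono sym tr] := lawr; have [se _ _ _ _] := tS.
suff key m : forall y u r y' u' r' p, (size p <= m)%N -> ra y u r -> ra y' u' r' ->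
    path re y p -> last y p = y' -> reach u u' (mu * (size p)%:R + r + r').
  by move=> y u r y' u' r' p; exact: key (leqnn _).
elim: m => [|m IHm] y u r y' u' r' p sp h h' pp lp.
  have -> : p = [::] by case: (p) sp.
  apply: ra_old h h' _ _ => //; move: lp; by case: (p) sp.
have [yS yp _] := h; have [y'S y'p _] := h'.
have [ap|/(re_enter pp yp)] := boolP (all (fun u => u \notin pend) p).
  by apply: ra_old h h' _ lp; exact: re_avoid ap.
case=> p1 [j [p2 [pE pp1 /andP[j0 jl] hent]]].
have pp2 : path re (v j) p2 by move: pp; rewrite pE cat_path /= => /and3P[].
have lp2 : last (v j) p2 = y' by rewrite -lp pE last_cat.
have rp1 : path re y p1 by move: pp; rewrite pE cat_path => /andP[].
have [|p3 [p4 hex]] := re_exit j0 jl pp2; first by rewrite lp2.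
(* leaving where we came from: cut the excursion out *)
have short b : last y p1 = b -> p2 = p3 ++ b :: p4 ->
    reach u u' (mu * (size p)%:R + r + r').
  move=> l1 p2E.
  have hs : (size (p1 ++ p4) < size p)%N.
    by clear -pE p2E; rewrite pE p2E !size_cat /= size_cat /=; lia.
  apply: mono (IHm _ _ _ _ _ _ (p1 ++ p4) _ h h' _ _).
  - by rewrite !lerD2r ler_wpM2l // ler_nat ltnW.
  - by rewrite -ltnS; exact: leq_trans hs sp.
  - rewrite cat_path rp1 l1; move: pp2; rewrite p2E cat_path /= => /and3P[].
    by [].
  - by rewrite last_cat l1 -lp2 p2E last_cat.
have cross b b' xb xb' rb rb' : last y p1 = b -> p2 = p3 ++ b' :: p4 ->
    ra b xb rb -> ra b' xb' rb' -> reach xb xb' w -> rb + w + rb' <= mu * l.+1%:R ->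
    (l <= (size p3).+1)%N -> reach u u' (mu * (size p)%:R + r + r').
  move=> l1 p2E hb hb' hw hl ls.
  have h1 := ra_old h hb pp1 l1.
  have hs : (size p1 + size p4 + l.+1 <= size p)%N.
    by clear -pE p2E ls; rewrite pE p2E !size_cat /= size_cat /=; lia.
  have h2 : reach xb' u' (mu * (size p4)%:R + rb' + r').
    apply: IHm hb' h' _ _.
    - by clear -hs sp; lia.
    - by move: pp2; rewrite p2E cat_path /= => /and3P[].
    - by rewrite -lp2 p2E last_cat.
  apply: mono (tr _ _ _ _ _ (tr _ _ _ _ _ h1 hw) h2).
  have : mu * (size p1 + size p4 + l.+1)%:R <= mu * (size p)%:R.
    by rewrite ler_wpM2l // ler_nat.
  rewrite !natrD !mulrDr; lra.
case: hent => -[l1 jE]; case: hex => -[p2E hl].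
- exact: short l1 p2E.
- by apply: cross l1 p2E ra_q ra_z hxx mul _; clear -hl jE; rewrite jE in hl; lia.
- apply: cross l1 p2E ra_z ra_q (sym _ _ _ hxx) _ _; first by move: mul; rewrite /cost_ok; lra.
  by clear -hl jE; rewrite jE in hl; lia.
- exact: short l1 p2E.
Qed.

Lemma ra_cov y u r : anch y u r ->
  exists y' r', ra y' u r' /\ (y' = y /\ r' = r \/
     [/\ y \in nball e [set q] D, y' = q & r' <= r + mu * D%:R]).
Proof.
move=> h; have yS := aS h.
have [yc|yc] := boolP ((y \in cutset) || (y \in pend)); last first.
  exists y, r; split; last by left.
  by move: yc; rewrite negb_or => /andP[yc yp]; split; [rewrite inE yc|by []|left].
have [j [j0 jD yE]] : exists j, [/\ (0 < j)%N, (j < D)%N & y = v j].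
  case/orP: yc => [/cutsetP|/pendP] [j [h1 h2 ->]]; exists j; clear -h1 h2 l0 lD;
  split=> //; lia.
have [qS' qp _] := ra_q.
exists q, (r + mu * j%:R); split.
  split=> //; right; split=> //; exists j; split=> //.
  by rewrite addrK -yE.
right; split=> //; first by rewrite yE v_zone // ltnW.
by rewrite lerD2l ler_wpM2l // ler_nat ltnW.
Qed.

End Rehang.

(** Outside the ball only the neighbourhood of [z] changes, and no point outside the ball is lost;
    these two clauses allow several rehangings in turn. *)
Lemma rehang (R : realType) (Y : finType) (V : Type)
  (reach : V -> V -> R -> Prop) (mu : R) (S : {set Y}) (e : rel Y)
  (anch : Y -> V -> R -> Prop) (q z : Y) (D l : nat) (x x' : V) (kappa w rz : R) :
  reach_law reach -> 0 <= mu -> tree_on S e ->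
  (forall y v r, anch y v r -> y \in S) -> dominates reach mu e anch ->
  q \in S -> z \in S -> (0 < l)%N -> (l.+1 < D)%N ->
  (forall y, y \in nball e [set q] D -> #|nbrs e y| = 2%N) ->
  z \notin nball e [set q] D ->
  anch q x kappa -> anch z x' rz -> reach x x' w ->
  kappa + w + rz <= mu * l.+1%:R ->
  exists S' e' anch',
  [/\ [/\ tree_on S' e', forall y v r, anch' y v r -> y \in S', dominates reach mu e' anch' &
        forall y v r, anch y v r -> exists y' r', anch' y' v r' /\
         (y' = y /\ r' = r \/ [/\ y \in nball e [set q] D, y' = q & r' <= r + mu * D%:R])],
      (#|S'| + (D - l.+1) = #|S|)%N, S' \subset S,
      forall y u, y \notin nball e [set q] D -> y != z -> e' y u = e y u &
      forall y, y \in S -> y \notin nball e [set q] D -> y \in S'].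
Proof.
move=> lawr mu0 tS aS dom qS zS l0 lD deg2 zN hq hz hxx hmu.
have [v [n [v0 vz Dn ve vinj]]] := rehang_path tS qS zS zN.
exists (S :\: cutset D l v), (re e z D l v), (ra S q D l v mu anch); split.
- split.
  + exact: (re_tree tS qS zS l0 lD deg2 zN v0 vz Dn ve vinj).
  + by move=> y u r [].
  + by apply: (ra_dom tS qS zS l0 lD deg2 zN v0 vz Dn ve vinj); eassumption.
  + by move=> *; apply: (ra_cov qS zS l0 lD zN v0 Dn ve vinj); eassumption.
- exact: (re_card tS qS zS l0 lD zN vz Dn ve vinj).
- exact: subsetDl.
- by move=> y u yN yz; exact: (re_outside tS qS zS l0 lD deg2 zN v0 Dn ve vinj u yN yz).
- move=> y yS yN; rewrite inE yS andbT; apply: contra yN => /imsetP [i _ ->].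
  apply: (v_zone qS zS l0 lD zN v0 Dn ve); have := ltn_ord i; clear; lia.
Qed.

(* A digraph of out-degree at most B is 2B-degenerate. *)
Lemma digraph_coloring (T : finType) (out : T -> {set T}) (B : nat) (A : {set T}) :
  {in A, forall i, (#|out i| <= B)%N} ->
  exists col : T -> 'I_(B.*2.+1),
    {in A &, forall i j, i != j -> j \in out i -> col i != col j}.
Proof.
move En : #|A| => m; elim: m A En => [|m IHm] A cA outB.
  exists (fun=> ord0) => i j; move: cA => /eqP; rewrite cards_eq0 => /eqP->.
  by rewrite inE.
have [i0 i0A indeg] : exists2 i, i \in A & (#|[set j in A | i \in out j]| <= B)%N.
  have [/existsP[i /andP[iA h]]|] := boolP [exists i in A, (#|[set j in A | i \in out j]| <= B)%N].
    by exists i.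
  rewrite negb_exists => /forallP h; exfalso.
  have h1 : (\sum_(i in A) B.+1 <= \sum_(i in A) #|[set j in A | i \in out j]|)%N.
    by apply: leq_sum => i iA; have := h i; rewrite iA /= -ltnNge.
  have h2 : (\sum_(i in A) #|[set j in A | i \in out j]| <= \sum_(j in A) #|out j|)%N.
    rewrite double_count; apply: leq_sum => j _; apply/subset_leq_card/subsetP => i.
    by rewrite inE => /andP[].
  have h3 : (\sum_(j in A) #|out j| <= \sum_(j in A) B)%N by apply: leq_sum => j /outB.
  by move: (leq_trans h1 (leq_trans h2 h3)); rewrite !sum_nat_const leq_pmul2l ?ltnn ?cA.
have [||col hcol] := IHm (A :\ i0).
- by apply/eqP; rewrite -eqSS -cA (cardsD1 i0 A) i0A.
- by move=> i /setD1P[_ /outB].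
pose bad := [set col j | j in out i0 :|: [set j in A | i0 \in out j]].
have badB : (#|bad| <= B.*2)%N.
  apply: leq_trans (leq_imset_card _ _) _.
  apply: leq_trans (leq_card_setU _ _) _; rewrite -addnn.
  by apply: leq_add => //; exact: outB.
have : (0 < #|~: bad|)%N by move: (cardsC bad); rewrite card_ord; lia.
rewrite card_gt0 => /set0Pn [c]; rewrite inE => cbad.
exists (fun i => if i == i0 then c else col i) => i j iA jA ij jo.
case: (eqVneq i i0) => [iE|iN]; case: (eqVneq j i0) => [jE|jN].
- by rewrite iE jE eqxx in ij.
- apply: contraNneq cbad => ->; apply/imsetP; exists j => //.
  by rewrite inE -iE jo.
- apply: contraNneq cbad => <-; apply/imsetP; exists i => //.
  by rewrite !inE iA -jE jo orbT.
- by apply: hcol; rewrite // !inE ?iN ?jN.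
Qed.

(** * Rehanging along many disjoint paths *)

Section RehangSeq.
Variables (R : realType) (Y : finType) (V : eqType).
Variables (reach : V -> V -> R -> Prop) (mu : R).
Hypotheses (lawr : reach_law reach) (mu0 : 0 <= mu).
Variables (D l : nat) (kappa w rz : R).
Hypotheses (l0 : (0 < l)%N) (lD : (l.+1 < D)%N).
Hypothesis cost : kappa + w + rz <= mu * l.+1%:R.

(* (q, z, x, x'): the tree path at q, close to x, is linked to z, close to x'. *)
Definition pick : Type := (Y * Y * V * V)%type.

Definition pick_ok (S : {set Y}) (e : rel Y) (anch : Y -> V -> R -> Prop) (p : pick) :=
  let: (q, z, x, x') := p in
  [/\ q \in S, z \in S, forall y, y \in nball e [set q] D -> #|nbrs e y| = 2%N &
      [/\ anch q x kappa, anch z x' rz & reach x x' w]].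

Definition zone (e : rel Y) (p : pick) := nball e [set p.1.1.1] D.

(** A rehanging touches only its own zone and its target. Disjoint zones that contain no target thus
    stay intact until their turn, and an anchor moves at most once, by at most [mu * D]. *)
Lemma rehang_seq (ps : seq pick) S e anch :
  tree_on S e -> (forall y v r, anch y v r -> y \in S) -> dominates reach mu e anch ->
  {in ps, forall p, pick_ok S e anch p} ->
  {in ps &, forall p p', p.1.1.2 \notin zone e p'} ->
  pairwise (fun p p' => [disjoint zone e p & zone e p']) ps ->
  exists S' e' anch',
  [/\ tree_on S' e', forall y v r, anch' y v r -> y \in S', dominates reach mu e' anch',
      (#|S'| + size ps * (D - l.+1))%N = #|S| &
      forall y v r, anch y v r -> exists y' r', anch' y' v r' /\
        (r' <= r + mu * D%:R /\
         ({in ps, forall p, y \notin zone e p} -> y' = y /\ r' = r))].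
Proof.
elim: ps S e anch => [|[[[q z] x] x'] ps IHps] S e anch tS aS dom ok zok.
  move=> _; exists S, e, anch; split=> //; first by rewrite mul0n addn0.
  by move=> y v r h; exists y, r; split=> //; split; rewrite // lerDl mulr_ge0.
rewrite [pairwise _ _]/= => /andP[/allP dj pw].
have [qS zS deg2 [hq hz hxx]] := ok _ (mem_head _ _).
have zN : z \notin nball e [set q] D by have := zok _ _ (mem_head _ _) (mem_head _ _).
have [S1 [e1 [anch1 [[tS1 aS1 dom1 cov1] c1 sub1 out1 in1]]]] :=
  rehang lawr mu0 tS aS dom qS zS l0 lD deg2 zN hq hz hxx cost.
have memt p : p \in ps -> p \in (q, z, x, x') :: ps by move=> h; rewrite inE h orbT.
have zN' p : p \in ps -> z \notin zone e p.
  by move=> pin; apply: (zok (q, z, x, x')) (mem_head _ _) (memt _ pin).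
have djN p y : p \in ps -> y \in zone e p -> y \notin nball e [set q] D.
  by move=> pin yin; move: (dj _ pin); rewrite disjoint_sym => /disjointFr ->.
have nb1 p y u : p \in ps -> y \in zone e p -> e1 y u = e y u.
  move=> pin yin; apply: out1; first exact: djN yin.
  by apply: contraNneq (zN' _ pin) => <-.
have zone1 p : p \in ps -> zone e1 p = zone e p.
  by move=> pin; apply: nball_eq => y u; exact: nb1.
have q_in p : p.1.1.1 \in zone e p.
  by apply/nballP; exists p.1.1.1, [::]; rewrite set11.
have stay y v r : y \notin nball e [set q] D -> anch y v r -> anch1 y v r.
  move=> yN /cov1 [y' [r' [h [[E1 E2]|[yin _ _]]]]]; first by rewrite -E1 -E2.
  by rewrite yin in yN.
have [|||S' [e' [anch' [tS' aS' dom' c' cov']]]] := IHps S1 e1 anch1 tS1 aS1 dom1.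
- move=> [[[q2 z2] x2] x2'] pin; have [q2S z2S d2 [h1 h2 h3]] := ok _ (memt _ pin).
  have q2N := djN _ _ pin (q_in (q2, z2, x2, x2')).
  have z2N : z2 \notin nball e [set q] D.
    by have := zok _ _ (memt _ pin) (mem_head _ _).
  split; [exact: in1|exact: in1| |split=> //; exact: stay].
  move=> y; rewrite -[nball _ _ _]/(zone e1 (q2, z2, x2, x2')) zone1 // => yin.
  rewrite -(d2 _ yin); congr #|pred_of_set _|; apply/setP => u; rewrite !inE.
  exact: nb1 yin.
- by move=> p p' pin p'in; rewrite zone1 //; apply: zok; exact: memt.
- apply/(pairwiseP (q, z, x, x')) => i j ii jj ij.
  rewrite !zone1 ?mem_nth //; exact: (pairwiseP _ pw).
exists S', e', anch'; split=> //; first by rewrite /= mulSn; lia.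
move=> y v r h; have [y1 [r1 [h1 hr1]]] := cov1 _ _ _ h.
have [y2 [r2 [h2 [hr2 st2]]]] := cov' _ _ _ h1.
exists y2, r2; split=> //; case: hr1 => [[y1E r1E]|[yin y1E r1E]].
  split; first by rewrite -r1E.
  move=> hN; rewrite -y1E -r1E; apply: st2 => p pin.
  by rewrite zone1 // y1E; apply: hN; exact: memt.
split; last by move=> hN; move: (hN _ (mem_head _ _)); rewrite /zone yin.
have [_ ->] // : y2 = y1 /\ r2 = r1.
apply: st2 => p pin; rewrite zone1 // y1E; apply/negP => qin.
case/negP: (djN _ _ pin qin); apply/nballP; exists q, [::]; by rewrite set11.
Qed.

End RehangSeq.

Lemma max_disjoint_family (T U : finType) (A : {set T}) (f : T -> {set U}) :
  exists2 I : {set T}, I \subset A &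
    {in I &, forall i j, i != j -> [disjoint f i & f j]} /\
    {in A, forall a, f a != set0 -> exists2 i, i \in I & ~~ [disjoint f a & f i]}.
Proof.
pose P (I : {set T}) := (I \subset A) &&
  [forall i in I, forall j in I, (i != j) ==> [disjoint f i & f j]].
have P0 : P set0 by rewrite /P sub0set; apply/forallP => i; rewrite inE.
have [I /maxsetP[/andP[IA /forallP PI] maxI] _] := maxset_exists P0.
have dI : {in I &, forall i j, i != j -> [disjoint f i & f j]}.
  move=> i j iI jI ij; have := PI i; rewrite iI => /forallP/(_ j).
  by rewrite jI ij.
exists I => //; split=> // a aA fa.
have [/existsP[i /andP[iI h]]|] := boolP [exists i in I, ~~ [disjoint f a & f i]].
  by exists i.
rewrite negb_exists => /forallP h; exfalso.
have dj i : i \in I -> [disjoint f a & f i].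
  by move=> iI; have := h i; rewrite iI negbK.
have aI : a \in I.
  rewrite -(maxI (a |: I)) ?setU11 ?finset.subsetUr //.
  rewrite /P subUset sub1set aA IA /=; apply/forallP => i; apply/implyP => iin.
  apply/forallP => j; apply/implyP => jin; apply/implyP => ij.
  move: iin jin; rewrite !inE => /orP[/eqP iE|iI] /orP[/eqP jE|jI].
  - by rewrite iE jE eqxx in ij.
  - by rewrite iE; exact: dj.
  - by rewrite jE disjoint_sym; exact: dj.
  - exact: dI.
by have := dj _ aI; rewrite -setI_eq0 setIid (negPf fa).
Qed.

Lemma card_bigcup_disjoint (T U : finType) (C : {set T}) (f : T -> {set U}) B :
  {in C &, forall c c', c != c' -> [disjoint f c & f c']} ->
  (forall c, c \in C -> (B <= #|f c|)%N) ->
  (#|C| * B <= #|\bigcup_(c in C) f c|)%N.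
Proof.
move=> dC hB; rewrite -sum_nat_const; apply: leq_trans (leq_sum _ hB) _.
rewrite sum_card_pairs; apply: (@leq_card_rel _ _ _ _ (fun p u => p.2 == u)).
  by move=> [c u]; rewrite inE /= => /andP[cC uc]; exists u => //; apply/bigcupP; exists c.
move=> [c u] [c' u'] v; rewrite !inE /= => /andP[cC uc] /andP[c'C uc'] _ /eqP uv /eqP u'v.
subst u u'; have [->//|cc'] := eqVneq c c'.
by have := disjointFr (dC _ _ cC c'C cc') uc; rewrite uc'.
Qed.

(** * Shrinking the tree at one scale *)

Section PruneStep.
Variables (R : realType) (Y : finType) (V : eqType).
Variables (reach0 reach : V -> V -> R -> Prop) (mu rbar : R) (N rho : nat).
Hypotheses (lawr0 : reach_law reach0) (lawr : reach_law reach).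
Hypothesis reach_sub : forall v v' c, reach0 v v' c -> reach v v' c.
Hypotheses (mu0 : 0 <= mu) (rbar0 : 0 <= rbar) (rbarN : 4 * rbar <= mu * N%:R).
Hypotheses (N0 : (0 < N)%N) (rhoN : (4 * rho <= N)%N).

(** Any point of a cluster ball, not only its centre, may be the start of a rehanging along the edge
    of that cluster, so the whole ball is anchored at [x c]. This makes the saving proportional to
    the size of the ball. *)
Definition ghosts (e : rel Y) (anch : Y -> V -> R -> Prop) (C : {set Y}) (x : Y -> V) :
  Y -> V -> R -> Prop := fun y v r => anch y v r \/
    exists c, [/\ c \in C, y \in nball e [set c] rho, v = x c & r = mu * rho%:R + rbar].

Lemma ghosts_dom e anch (C : {set Y}) x : symmetric e -> dominates reach0 mu e anch ->
  (forall c, c \in C -> exists r, anch c (x c) r /\ r <= rbar) ->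
  dominates reach0 mu e (ghosts e anch C x).
Proof.
have [mono _ _] := lawr0; move=> se dom hC.
suff h1 y v r y' v' r' p : anch y v r -> ghosts e anch C x y' v' r' -> path e y p ->
    last y p = y' -> reach0 v v' (mu * (size p)%:R + r + r').
  move=> y v r y' v' r' p [h|[c [cC /nballP[c' [s [c'c ps ls ss]]] -> ->]]] h' pp lp.
    exact: h1 h h' pp lp.
  have [r0 [hr0 r0b]] := hC _ cC; move: c'c; rewrite inE => /eqP c'E; subst c'.
  have := h1 _ _ _ _ _ _ (s ++ p) hr0 h'.
  rewrite cat_path ps ls pp last_cat ls lp => /(_ isT erefl).
  apply: mono; rewrite size_cat natrD mulrDr.
  have : mu * (size s)%:R <= mu * rho%:R by rewrite ler_wpM2l // ler_nat.
  by lra.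
move=> h [h'|[c [cC /nballP[c' [s [c'c ps ls ss]]] -> ->]]] pp lp.
  exact: dom h h' pp lp.
have [r0 [hr0 r0b]] := hC _ cC; move: c'c; rewrite inE => /eqP c'E; subst c'.
have [s' ps' [ls' ss']] := path_rev se ps.
have := dom _ _ _ _ _ _ (p ++ s') h hr0.
rewrite cat_path pp lp -ls ps' last_cat lp -ls ls' => /(_ isT erefl).
apply: mono; rewrite size_cat natrD mulrDr ss'.
have : mu * (size s)%:R <= mu * rho%:R by rewrite ler_wpM2l // ler_nat.
by lra.
Qed.

Lemma leq_pigeon (T : finType) k (A : {set T}) (col : T -> 'I_k.+1) :
  exists c, (#|A| <= k.+1 * #|[set i in A | col i == c]|)%N.
Proof.
pose F c := #|[set i in A | col i == c]|.
have [/existsP //|] := boolP [exists c, (#|A| <= k.+1 * F c)%N].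
rewrite negb_exists => /forallP h; exfalso.
have E : (#|A| = \sum_c F c)%N.
  rewrite -sum1_card (partition_big col xpredT) //=.
  by apply: eq_bigr => c _; rewrite sum1dep_card.
have : (k.+1 * #|A| < k.+1 * #|A|)%N; last by rewrite ltnn.
rewrite [X in (_ < X)%N](_ : _ = \sum_(c < k.+1) #|A|)%N; last first.
  by rewrite sum_nat_const card_ord.
rewrite {1}E big_distrr /= !big_ord_recl /=; rewrite -addSn; apply: leq_add.
  by rewrite ltnNge h.
by apply: leq_sum => i _; apply: ltnW; rewrite ltnNge h.
Qed.

(** A point of a cluster ball is trimmed away, or lies near a point of degree other than 2 of the
    trimmed tree, or sits on a long bare path. The first two kinds are paid by the trimmed points,
    of which there are at least [N] per remaining leaf. Among the bare paths at least a third of a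
    maximal disjoint family can be rehung at once, each saving at least [N] points. *)
Lemma prune_step S e anch (C : {set Y}) (x x' : Y -> V) :
  tree_on S e -> (forall y v r, anch y v r -> y \in S) -> dominates reach0 mu e anch ->
  (forall c, c \in C ->
    [/\ exists r, anch c (x c) r /\ r <= rbar,
        exists y r, anch y (x' c) r /\ r <= rbar,
        reach (x c) (x' c) (mu * N%:R),
        ~ reach0 (x c) (x' c) (mu * (8 * N)%:R) &
        (rho <= #|nball e [set c] rho|)%N]) ->
  {in C &, forall c c', c != c' -> [disjoint nball e [set c] rho & nball e [set c'] rho]} ->
  exists (S' : {set Y}) (e' : rel Y) (anch' : Y -> V -> R -> Prop),
  [/\ tree_on S' e', forall y v r, anch' y v r -> y \in S', dominates reach mu e' anch',
      (#|C| * rho + 63 * #|S'| <= 63 * #|S|)%N &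
      forall y v r, anch y v r -> exists y' r', anch' y' v r' /\ r' <= r + mu * (6 * N)%:R].
Proof.
move=> tS aS dom hC djC; have [mono0 sym0 tr0] := lawr0; have [mono sym tr] := lawr.
have [C0|[c0 c0C]] := set_0Vmem C.
  exists S, e, anch; split=> //.
    by move=> y v r y' v' r' p h h' pp lp; apply: reach_sub; exact: dom h h' pp lp.
    by rewrite C0 cards0 mul0n.
  by move=> y v r h; exists y, r; split=> //; rewrite lerDl mulr_ge0.
have [se _ eS _ _] := tS.
have Nmu : 0 <= mu * N%:R by rewrite mulr_ge0.
have rhomu : 4 * (mu * rho%:R) <= mu * N%:R.
  by rewrite mulrCA ler_wpM2l // -natrM ler_nat.
pose anchp := ghosts e anch C x.
have CS c : c \in C -> c \in S by case/hC => [[r [/aS]]].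
have ballS c y : c \in C -> y \in nball e [set c] rho -> y \in S.
  move=> cC /nballP[c' [s [c'c ps <- _]]]; move: c'c; rewrite inE => /eqP c'E; subst c'.
  by apply: (tree_path_sub tS (CS _ cC) ps); exact: mem_last.
have aSp y v r : anchp y v r -> y \in S.
  by case=> [/aS //|[c [cC yc _ _]]]; exact: ballS yc.
have domp : dominates reach0 mu e anchp.
  by apply: ghosts_dom => // c /hC[].
have far : exists y1 v1 r1 y2 v2 r2, [/\ anchp y1 v1 r1, anchp y2 v2 r2 &
     ~ reach0 v1 v2 (mu * (2 * N + 2)%:R + r1 + r2)].
  have [[r [h rb]] [y [r' [h' rb']]] _ nr _] := hC _ c0C.
  exists c0, (x c0), r, y, (x' c0), r'; split; [by left|by left|move=> hr; apply: nr].
  apply: mono0 hr.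
  have : mu * (2 * N + 2)%:R <= mu * (4 * N)%:R.
    by rewrite ler_wpM2l // ler_nat; clear -N0; lia.
  by rewrite !natrM !(mulrCA mu); move: rbarN; lra.
have [S1 [e1 [anch1 [[tS1 sS1 se1 S13] [aS1 dom1 cov1 fix1] c1 _]]]] :=
  trimR lawr0 mu0 tS aSp domp far.
have [sy1 _ eS1 _ _] := tS1.
set nu := #|leaves e1| in c1.
(* The bridge keeps [3 * N] points, so a rehanging saves [D - (3 * N).+1 = 2 * N - 1 >= N] points,
   while the target, more than [8 * N] away up to errors, remains outside the ball of radius [D]. *)
pose D := (5 * N)%N.
pose Sp := [set y in S1 | #|nbrs e1 y| != 2%N].
pose B := nball e1 Sp (2 * D).
have S11 : (1 < #|S1|)%N by exact: ltnW.
have spsum : (\sum_(y in Sp) #|nbrs e1 y| <= 4 * nu)%N by exact: tree_special.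
have spcard : (#|Sp| <= 4 * nu)%N.
  apply: leq_trans spsum; rewrite -sum1_card; apply: leq_sum => y.
  by rewrite inE => /andP[yS _]; exact: tree_deg_gt0 yS.
have ball1S y j (A : {set Y}) : A \subset S1 -> y \in nball e1 A j -> y \in S1.
  move=> AS /nballP[a [s [aA ps <- _]]].
  by apply: (tree_path_sub tS1 (subsetP AS _ aA) ps); exact: mem_last.
have SpS : Sp \subset S1 by apply/subsetP => y; rewrite inE => /andP[].
(* At most [4 * nu] centres of degree sum at most [4 * nu], and radius [10 * N]: in all
   [4 * nu + 40 * N * nu]. *)
have Bcard : (#|B| <= 44 * (N * nu))%N.
  apply: leq_trans (nball_card (A := Sp) (j := (2 * D)%N) sy1 _) _.
    move=> y yb ySp; have yS := ball1S _ _ _ SpS yb.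
    by move: ySp; rewrite inE yS /= negbK => /eqP->.
  apply: leq_trans (leq_add spcard (leq_mul (leqnn _) spsum)) _.
  rewrite /D; clear -N0; nia.
have good y u : y \in S1 -> y \notin B -> u \in nball e1 [set y] (2 * D) ->
    #|nbrs e1 u| = 2%N.
  move=> yS yB ub; apply/eqP; apply: contraNT yB => du.
  have uS : u \in S1 by apply: ball1S ub; rewrite sub1set.
  case/nballP: ub => y' [s [y'y ps ls ss]]; move: y'y; rewrite inE => /eqP y'E; subst y'.
  have [s' ps' [ls' ss']] := path_rev sy1 ps.
  apply/nballP; exists u, s'; split=> //; first by rewrite inE uS.
  - by rewrite -ls.
  - by rewrite -ls ls'.
  - by rewrite ss'.
pose M := \bigcup_(c in C) nball e [set c] rho.
pose U := [set y in M | (y \in S1) && (y \notin B)].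
have Mcard : (#|C| * rho <= #|M|)%N by apply: card_bigcup_disjoint => // c /hC[].
have MU : (#|M| <= (#|S| - #|S1|) + #|B| + #|U|)%N.
  rewrite -cardsDS // -addnA.
  apply: leq_trans (_ : #|(S :\: S1) :|: (B :|: U)| <= _)%N; last first.
    apply: leq_trans (leq_card_setU _ _) _; rewrite leq_add2l; exact: leq_card_setU.
  apply/subset_leq_card/subsetP => y yM; rewrite !in_setU in_setD.
  have yS : y \in S by case/bigcupP: yM => c cC; exact: ballS.
  rewrite [y \in U]inE yM yS; case: (y \in S1); case: (y \in B); by rewrite ?orbT.
have [I IU [djI maxI]] := max_disjoint_family U (fun q => nball e1 [set q] D).
have qball q j : q \in nball e1 [set q] j.
  by apply/nballP; exists q, [::]; rewrite set11.
have ITU q : q \in I -> [/\ q \in M, q \in S1 & q \notin B].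
  by move/(subsetP IU); rewrite inE => /and3P[].
(* By maximality each point of [U] is within [2 * D] of some member of [I], and such a ball has all
   degrees 2, hence at most [1 + 20 * N] points. *)
have Ucard : (#|U| <= #|I| * (21 * N))%N.
  apply: leq_trans (_ : #|\bigcup_(q in I) nball e1 [set q] (2 * D)| <= _)%N.
    apply/subset_leq_card/subsetP => y yU.
    have [|q qI] := maxI _ yU; first by apply/set0Pn; exists y.
    rewrite -setI_eq0 => /set0Pn[u /setIP[uy uq]]; apply/bigcupP; exists q => //.
    case/nballP: uy => y' [s [y'y ps ls ss]]; move: y'y; rewrite inE => /eqP y'E; subst y'.
    case/nballP: uq => q' [t [q'q pt lt st]].
    have [s' ps' [ls' ss']] := path_rev sy1 ps.
    apply/nballP; exists q', (t ++ s'); split=> //.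
    - by rewrite cat_path pt lt -ls.
    - by rewrite last_cat lt -ls ls'.
    - by rewrite size_cat ss' mul2n -addnn leq_add.
  rewrite -sum_nat_const.
  elim/big_rec2: _ => [|q m A qI hA]; first by rewrite cards0.
  apply: leq_trans (leq_card_setU _ _) _; apply: leq_add => //.
  have [_ qS qB] := ITU _ qI.
  apply: leq_trans (nball_card (A := [set q]) (j := (2 * D)%N) sy1 _) _.
    by move=> y yb _; rewrite (good q).
  rewrite cards1 big_set1 (good q) //; rewrite /D; clear -N0; lia.
pose cl y := odflt y [pick c in C | y \in nball e [set c] rho].
have clP y : y \in M -> cl y \in C /\ y \in nball e [set cl y] rho.
  case/bigcupP => c cC yc; rewrite /cl; case: pickP => [c' /andP[]//|/(_ c)].
  by rewrite cC yc.
(* Trimming may have moved the anchor of [x'], by up to [mu * N]; the ghost anchor at [q] is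
   unchanged because [q] itself survived. *)
pose rz := rbar + mu * N%:R; pose kappa := mu * rho%:R + rbar.
pose anch2 y v r := exists r0, r0 <= r /\ anch1 y v r0.
have zex q : q \in M -> exists z, anch2 z (x' (cl q)) rz.
  case/clP=> cC _; have [_ [y [r [h rb]]] _ _ _] := hC _ cC.
  have [y' [r' [h' rb']]] := cov1 y (x' (cl q)) r (or_introl h).
  exists y', r'; split=> //; apply: le_trans rb' _; by rewrite lerD2r.
have zf q : exists z, q \in M -> anch2 z (x' (cl q)) rz.
  by have [/zex[z hz]|] := boolP (q \in M); [exists z|exists q].
have {zf} [z zP] := choice zf.
have aS2 y v r : anch2 y v r -> y \in S1 by case=> r0 [_ /aS1].
have dom2 : dominates reach0 mu e1 anch2.
  move=> y v r y' v' r' p [r0 [rr h]] [r0' [rr' h']] pp lp.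
  by apply: mono0 (dom1 _ _ _ _ _ _ _ h h' pp lp); lra.
have q2 q : q \in M -> q \in S1 -> anch2 q (x (cl q)) kappa.
  move=> qM qS; exists kappa; split=> //; apply: fix1 => //; right.
  by have [cC qc] := clP _ qM; exists (cl q).
(* In units of [mu * N]: 5 for the path, [1/2] for [kappa] and [5/4] for [rz] stay below 8. *)
have zq q : q \in M -> q \in S1 -> z q \notin nball e1 [set q] D.
  move=> qM qS; apply/negP => /nballP[q' [s [q'q ps ls ss]]].
  move: q'q; rewrite inE => /eqP q'E; subst q'.
  have [cC _] := clP _ qM; have [_ _ _ nr _] := hC _ cC; apply: nr.
  apply: mono0 (dom2 _ _ _ _ _ _ _ (q2 _ qM qS) (zP _ qM) ps ls).
  have : mu * (size s)%:R <= mu * D%:R by rewrite ler_wpM2l // ler_nat.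
  rewrite /D /kappa /rz !natrM !(mulrCA mu); move: rbarN; lra.
(* Balls of the family are disjoint, so a target lies in at most one of them; out-degree 1 gives
   three colours. *)
pose out q := [set q' in I | z q \in nball e1 [set q'] D].
have outB : {in I, forall q, (#|out q| <= 1)%N}.
  move=> q qI; rewrite leqNgt; apply/negP => /card_gt1P [a [b]].
  rewrite !inE => -[/andP[aI za] /andP[bI zb] ab].
  by have := djI _ _ aI bI ab; rewrite -setI_eq0 => /eqP/setP/(_ (z q)); rewrite !inE za zb.
have [col colP] := digraph_coloring outB.
have [k kP] := leq_pigeon I col.
set J := [set i in I | col i == k] in kP.
have JI q : q \in J -> q \in I by rewrite inE => /andP[].
pose mk q : pick Y V := (q, z q, x (cl q), x' (cl q)).
have l0 : (0 < 3 * N)%N by clear -N0; lia.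
have lD : ((3 * N).+1 < D)%N by rewrite /D; clear -N0; lia.
(* In units of [mu * N]: [1/2 + 1 + 5/4 <= 3]. *)
have cost : kappa + mu * N%:R + rz <= mu * (3 * N).+1%:R.
  rewrite mulrSr natrM mulrDr (mulrCA mu) /kappa /rz; have := mu0; have := rbarN; lra.
have dom2' : dominates reach mu e1 anch2.
  by move=> y v r y' v' r' p h h' pp lp; apply: reach_sub; exact: dom2 h h' pp lp.
have [|||S' [e' [anch' [tS' aS' dom' c' cov']]]] :=
    @rehang_seq R Y V reach mu lawr mu0 D (3 * N) kappa (mu * N%:R) rz l0 lD cost
      [seq mk q | q <- enum J] S1 e1 anch2 tS1 aS2 dom2'.
- move=> p0 /mapP[q + ->]; rewrite mem_enum => /JI/ITU[qM qS qB]; split=> //.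
  + exact: aS2 (zP _ qM).
  + move=> y yb; apply: (good q) => //; apply: (subsetP (nball_mono _ _ _)) yb.
    by rewrite mul2n -addnn leq_addr.
  + have [cC _] := clP _ qM; have [_ _ hr _ _] := hC _ cC.
    by split; [exact: q2|exact: zP|].
- move=> p0 p0' /mapP[q + ->] /mapP[q' + ->]; rewrite !mem_enum => qJ q'J.
  rewrite /zone /=; have [qM qS _] := ITU _ (JI _ qJ).
  have [<-|qq'] := eqVneq q q'; first exact: zq.
  apply/negP => zin; have := colP _ _ (JI _ qJ) (JI _ q'J) qq'.
  rewrite inE zin (JI _ q'J) => /(_ isT).
  by move: qJ q'J; rewrite !inE => /andP[_ /eqP->] /andP[_ /eqP->]; rewrite eqxx.
- rewrite pairwise_map; apply: (@sub_in_pairwise _ (mem J) (fun a b => a != b)).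
  + by move=> a b aJ bJ ab; exact: djI (JI _ aJ) (JI _ bJ) ab.
  + by apply/allP => a; rewrite mem_enum.
  + by rewrite -uniq_pairwise enum_uniq.
exists S', e', anch'; split=> //.
(* A trimmed point is charged [1 + 44] times and a point saved by rehanging [21 * 3] times; 63
   covers both. *)
- move: c'; rewrite size_map -cardE => c'.
  have h1 := subset_leq_card sS1.
  have h2 : (#|J| * N <= #|J| * (D - (3 * N).+1))%N.
    by rewrite leq_mul2l /D; apply/orP; right; clear -N0; lia.
  have h3 : (#|I| * (21 * N) <= 63 * (#|J| * N))%N.
    apply: leq_trans (leq_mul kP (leqnn _)) _; clear; nia.
  clear -h1 h2 h3 c' c1 Mcard MU Bcard Ucard; lia.
(* [N] steps of trimming and a slide of [D = 5 * N] add up to [6 * N]. *)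
- move=> y v r h; have [y1 [r1 [h1 hr1]]] := cov1 y v r (or_introl h).
  have [|y2 [r2 [h2 [hr2 _]]]] := cov' y1 v r1; first by exists r1.
  exists y2, r2; split=> //; apply: le_trans hr2 _.
  by move: hr1; rewrite /D !natrM !(mulrCA mu); lra.
Qed.

End PruneStep.

(** * Moore's bound and clusters *)

Section Moore.
Variables (R : realType) (M : mgraph R) (E : {set edge M}) (k d : nat).
Hypothesis k0 : (0 < k)%N.
Hypothesis noshort : forall e, e \in E -> forall p,
  walk (E :\ e) (ends e).1 p (ends e).2 -> (size p < 2 * k)%N -> False.

Definition inner (X : {set vert M}) : {set edge M} :=
  [set e in E | ((ends e).1 \in X) && ((ends e).2 \in X)].

Definition star (X : {set vert M}) (v : vert M) : {set edge M} :=
  [set e in inner X | (v == (ends e).1) || (v == (ends e).2)].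

Lemma noshort_joins e x y p : e \in E -> joins e x y -> walk (E :\ e) x p y ->
  (size p < 2 * k)%N -> False.
Proof.
move=> eE /joins_endsP[[-> ->]|[-> ->]] wp sp; first exact: noshort wp sp.
by have [q [wq _ sq]] := walk_rev wp; apply: noshort wq _; rewrite ?sq.
Qed.

Lemma starP X v e : e \in star X v -> exists u, [/\ e \in E, joins e v u & u \in X].
Proof.
rewrite !inE => /andP[/andP[eE /andP[h1 h2]] /orP[/eqP->|/eqP->]].
  by exists (ends e).2; split=> //; exact: joins_ends.
by exists (ends e).1; split=> //; rewrite joinsC; exact: joins_ends.
Qed.

(* A minimal vertex set inducing more than d edges per vertex. *)
Lemma dense_core (C : {set vert M}) : (d * #|C| < #|inner C|)%N ->
  exists X : {set vert M}, [/\ X \subset C, X != set0 & forall v, v \in X -> (d < #|star X v|)%N].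
Proof.
move=> dC; pose P (X : {set vert M}) := (X \subset C) && (d * #|X| < #|inner X|)%N.
have PC : P C by rewrite /P subxx.
case: (arg_minnP (fun X : {set vert M} => #|X|) PC) => X /andP[XC dX] minX.
exists X; split=> //.
  apply: contraTneq dX => ->; rewrite (_ : inner set0 = set0) ?cards0 ?muln0 //.
  by apply/setP => e; rewrite !inE /= andbF.
move=> v vX; rewrite ltnNge; apply/negP => sd.
have : P (X :\ v).
  rewrite /P (fintype.subset_trans (subsetDl _ _) XC) /=.
  have sub : inner X \subset inner (X :\ v) :|: star X v.
    apply/subsetP => e; rewrite !inE => /andP[-> /andP[-> ->]] /=.
    by rewrite !andbT (eq_sym v) (eq_sym v); case: eqP; case: eqP.
  have := leq_trans (subset_leq_card sub) (leq_card_setU _ _).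
  have := cardsD1 v X; rewrite vX; clear -dX sd; nia.
by move=> /minX; rewrite (cardsD1 v X) vX add1n ltnn.
Qed.

Section Spheres.
Variables (X : {set vert M}) (v0 : vert M).
Hypothesis v0X : v0 \in X.
Hypothesis deg : forall v, v \in X -> (d < #|star X v|)%N.

Let er : rel (vert M) := edge_rel (inner X).

Definition lev j : {set vert M} :=
  if j is j'.+1 then nball er [set v0] j'.+1 :\: nball er [set v0] j' else [set v0].

Lemma nball_lev j v : v \in nball er [set v0] j -> exists2 i, (i <= j)%N & v \in lev i.
Proof.
elim: j => [|j IHj]; first by exists 0%N.
have [/IHj[i ij vi] _|vN vb] := boolP (v \in nball er [set v0] j).
  by exists i => //; exact: leqW.
by exists j.+1 => //; rewrite inE vN.
Qed.

Lemma lev_nball i v : v \in lev i -> v \in nball er [set v0] i.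
Proof. by case: i => // i; rewrite inE => /andP[]. Qed.

Lemma lev_lt i j v : v \in lev i -> v \in nball er [set v0] j -> (i <= j)%N.
Proof.
case: i => // i; rewrite inE => /andP[vN _] vj; rewrite ltnNge; apply: contra vN => ji.
exact: (subsetP (nball_mono _ _ ji)) vj.
Qed.

Lemma lev_inj i j v : v \in lev i -> v \in lev j -> i = j.
Proof.
move=> vi vj; apply/eqP; rewrite eqn_leq.
by rewrite (lev_lt vi (lev_nball vj)) (lev_lt vj (lev_nball vi)).
Qed.

Lemma lev_step i v u e : v \in lev i -> e \in inner X -> joins e v u ->
  exists2 j, (j <= i.+1)%N & u \in lev j.
Proof.
move=> vi eX ej; apply: nball_lev; rewrite nballS; apply/orP; right.
by apply/existsP; exists v; rewrite lev_nball //=; apply/existsP; exists e; rewrite eX.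
Qed.

(** A breadth-first path from [y] down to [v0] never meets [v], which is not on a lower level than
    [y], and so avoids the edge [e] at [v]. *)
Lemma geodesic i y e v u : y \in lev i -> joins e v u -> v \in nball er [set v0] k ->
  v != y -> (forall j, v \in lev j -> (i <= j)%N) ->
  exists2 p, walk (inner X :\ e) y p v0 & size p = i.
Proof.
move=> + ej vk; elim: i y => [|i IHi] y.
  by rewrite inE => /eqP-> _ _; exists [::]; rewrite /= ?eqxx.
move=> yi vy hv; have := yi; rewrite inE nballS => /andP[yN /orP[|]].
  by rewrite (negPf yN).
case/existsP=> w /andP[wb /existsP[f /andP[fX fj]]].
have wi : w \in lev i.
  have [j ji wj] := nball_lev wb; suff -> : i = j by [].
  apply/eqP; rewrite eqn_leq ji andbT -ltnS.
  have [j' j'j yj'] := lev_step wj fX fj.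
  by rewrite (lev_inj yi yj').
have vw : v != w.
  by apply/eqP => vw; have := hv i; rewrite vw => /(_ wi); rewrite ltnn.
have [|p wp sp] := IHi w wi vw; first by move=> j /hv /ltnW.
exists ((f, w) :: p); last by rewrite /= sp.
rewrite /= wp joinsC fj !andbT in_setD1 fX andbT.
apply: contraNneq vy => fe; rewrite fe in fj.
by have [vE|vE] := joins_mem ej fj; rewrite vE ?eqxx // in vw *.
Qed.

(* Two edges from v to levels not above its own would close a short cycle. *)
Lemma down_unique i v e e' y y' a b : v \in lev i -> (i <= k)%N ->
  e \in inner X -> e' \in inner X -> joins e v y -> joins e' v y' ->
  y \in lev a -> y' \in lev b -> (a <= i)%N -> (b <= i)%N -> (a + b < 2 * k - 1)%N ->
  e = e'.
Proof.
move=> vi ik eX e'X ej e'j ya y'b ai bi abk; apply/eqP; apply: contraT => ee'.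
have eE : e \in E by move: eX; rewrite inE => /andP[].
have subE : {subset inner X :\ e <= E :\ e}.
  by move=> f; rewrite !inE => /andP[-> /andP[->]].
have vk : v \in nball er [set v0] k.
  by apply: (subsetP (nball_mono _ _ ik)); exact: lev_nball.
have noloop f w : f \in inner X -> joins f v w -> v != w.
  rewrite inE => /andP[fE _] fj; apply/eqP => vw; rewrite -vw in fj.
  by apply: (@noshort_joins f v v [::]) => //=; rewrite ?eqxx // muln_gt0.
have vlev j : v \in lev j -> j = i by move=> vj; exact: lev_inj vj vi.
have [|p wp sp] := geodesic ya ej vk (noloop _ _ eX ej).
  by move=> j /vlev->.
have [|p' wp' sp'] := geodesic y'b ej vk (noloop _ _ e'X e'j).
  by move=> j /vlev->.
have [q [wq _ sq]] := walk_rev wp.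
exfalso; apply: (@noshort_joins e v y ((e', y') :: p' ++ q)) => //.
  rewrite /= e'j !inE eq_sym ee' /=.
  have -> : e' \in E by move: e'X; rewrite inE => /andP[].
  exact: walk_sub subE (walk_cat wp' wq).
by rewrite /= size_cat sp' sq sp; clear -abk; lia.
Qed.

Lemma lev_X i v : v \in lev i -> v \in X.
Proof.
case: i => [|i]; first by rewrite inE => /eqP->.
rewrite inE nballS => /andP[/negPf-> /= /existsP[w /andP[_ /existsP[e /andP[]]]]].
rewrite inE => /andP[_ /andP[h1 h2]] /joins_endsP[[_ ->]|[_ ->]] //.
Qed.

(** A vertex below level [k] has more than [d] edges, at most one of which fails to lead to the next
    level, and a vertex of the next level is entered by one edge only. Both uses of [down_unique]
    involve levels of sum at most [2 * k - 2]. *)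
Lemma card_lev j : (j <= k)%N -> (d ^ j <= #|lev j|)%N.
Proof.
elim: j => [|j IHj] jk; first by rewrite /= cards1.
rewrite expnSr; apply: leq_trans (leq_mul (IHj (ltnW jk)) (leqnn d)) _.
pose up v := [set e in star X v | [exists u in lev j.+1, joins e v u]].
have upd v : v \in lev j -> (d <= #|up v|)%N.
  move=> vj; have := deg (lev_X vj).
  rewrite -(cardsID (up v) (star X v)).
  have -> : star X v :&: up v = up v by apply/setIidPr/subsetP => e; rewrite inE => /andP[].
  suff : (#|star X v :\: up v| <= 1)%N by clear; lia.
  rewrite leqNgt; apply/negP => /card_gt1P[e [e' []]].
  have low f : f \in star X v :\: up v -> exists u, exists a,
      [/\ f \in inner X, joins f v u, u \in lev a & (a <= j)%N].
    rewrite in_setD => /andP[fN fs]; have [u [fE fj uX]] := starP fs.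
    have fX : f \in inner X by move: fs; rewrite inE => /andP[].
    have [a aj ua] := lev_step vj fX fj; exists u, a; split=> //.
    move: aj; rewrite leq_eqVlt => /orP[/eqP aE|//].
    case/negP: fN; rewrite inE fs; apply/existsP; exists u.
    by rewrite -aE ua.
  move=> /low[u [a [fX fj ua aj]]] /low[u' [a' [fX' fj' ua' aj']]] /eqP; apply.
  apply: (down_unique vj (ltnW jk) fX fX' fj fj' ua ua' aj aj').
  by clear -aj aj' jk; lia.
rewrite -sum_nat_const; apply: (@leq_trans (\sum_(v in lev j) #|up v|)).
  by apply: leq_sum => v; exact: upd.
rewrite sum_card_pairs; apply: (@leq_card_rel _ _ _ _ (fun p u => joins p.2 p.1 u)).
  move=> [v e]; rewrite inE /= => /andP[_].
  by rewrite inE => /andP[_ /existsP[u /andP[uj ej]]]; exists u.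
move=> [v e] [v' e'] u; rewrite !inE /= => /andP[vj /andP[es _]] /andP[v'j /andP[es' _]].
move=> uj; rewrite joinsC (joinsC e') => ej ej'.
have eX : e \in inner X by move: es; rewrite !inE => /andP[].
have e'X : e' \in inner X by move: es'; rewrite !inE => /andP[].
have uj' : u \in lev j.+1 by rewrite in_setD; move: uj; rewrite !inE.
have E1 : e = e'.
  apply: (down_unique uj' jk eX e'X ej ej' vj v'j (leqnSn _) (leqnSn _)).
  by clear -jk; lia.
by rewrite -E1 in ej' *; rewrite (joins_eq ej ej').
Qed.

End Spheres.

Lemma moore_bound (C : {set vert M}) :
  (forall e, e \in E -> (ends e).1 \in C /\ (ends e).2 \in C) ->
  (#|C| < d ^ k)%N -> (#|E| <= d * #|C|)%N.
Proof.
move=> EC ndk; rewrite leqNgt; apply/negP => big.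
have innerC : inner C = E.
  apply/setP => e; rewrite inE; case eE: (e \in E) => //=.
  by have [-> ->] := EC _ eE.
rewrite -innerC in big; have [X [XC /set0Pn[v0 v0X] deg]] := dense_core big.
have := card_lev v0X deg (leqnn k).
rewrite leqNgt => /negP; apply; apply: leq_ltn_trans ndk; apply/subset_leq_card.
by apply: fintype.subset_trans XC; apply/subsetP => v; exact: lev_X.
Qed.

End Moore.

(** * Cutting a spanning tree into unit edges *)

Section Reach.
Variables (R : realType) (G : mgraph R).

(** A distance bound carried by a witness walk: such bounds compose, and persist when edges are
    added. *)
Definition reach (A : {set edge G}) (u v : vert G) (c : R) : Prop :=
  exists2 p, walk A u p v & walk_weight p <= c.

Lemma reach_is_law A : reach_law (reach A).
Proof.
split.
- by move=> v v' c c' cc' [p wp wc]; exists p => //; exact: le_trans cc'.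
- by move=> v v' c [p /walk_rev[q [wq ww _]] wc]; exists q => //; rewrite ww.
- move=> u v w c c' [p wp wc] [q wq wc']; exists (p ++ q); first exact: walk_cat wq.
  by rewrite walk_weight_cat lerD.
Qed.

Lemma reach_sub (A B : {set edge G}) u v c : {subset A <= B} -> reach A u v c -> reach B u v c.
Proof. by move=> AB [p wp wc]; exists p => //; exact: walk_sub wp. Qed.

Lemma reach_edge (A : {set edge G}) e u v : e \in A -> joins e u v -> reach A u v (wt e).
Proof.
move=> eA ej; exists [:: (e, v)]; first by rewrite /= eA ej eqxx.
by rewrite walk_weight_cons walk_weight_nil addr0.
Qed.

Lemma reach_refl A u : reach A u u 0.
Proof. by exists [::]; rewrite /= ?eqxx // walk_weight_nil. Qed.

End Reach.

Section InitTree.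
Variables (R : realType) (G : mgraph R) (T : {set edge G}) (x0 : vert G) (mu : R).
Hypothesis mu0 : 0 < mu.

Definition comp_of : {set vert G} := [set v | connect (edge_rel T) x0 v].
Let K := comp_of.

Lemma comp_root : x0 \in K.
Proof. by rewrite inE connect0. Qed.

(* Breadth-first search from x0. *)
Lemma comp_parent : exists (rk : vert G -> nat) (pe : vert G -> option (edge G))
    (pv : vert G -> vert G),
  forall v, v \in K -> v != x0 -> exists t,
  [/\ pe v = Some t, t \in T, joins t v (pv v), pv v \in K & (rk (pv v) < rk v)%N].
Proof.
have hr v : exists r, v \in K -> v \in nball (edge_rel T) [set x0] r /\
    forall j, v \in nball (edge_rel T) [set x0] j -> (r <= j)%N.
  have [vK|] := boolP (v \in K); last by exists 0%N.
  have ex : exists r, v \in nball (edge_rel T) [set x0] r.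
    move: vK; rewrite inE => /connectP[p pp ->]; exists (size p).
    by apply/nballP; exists x0, p; rewrite set11.
  by case: (ex_minnP ex) => r rv rm; exists r.
have [rk rkP] := choice hr; exists rk.
have hp v : exists p : option (edge G) * vert G, v \in K -> v != x0 -> exists t,
  [/\ p.1 = Some t, t \in T, joins t v p.2, p.2 \in K & (rk p.2 < rk v)%N].
  have [vK|vK] := boolP (v \in K); last by exists (None, x0).
  have [-> |vx0] := eqVneq v x0; first by exists (None, x0).
  have [vr vm] := rkP _ vK; case rE: (rk v) vr vm => [|j] vr vm.
    by move: vr; rewrite /= inE (negPf vx0).
  move: vr; rewrite nballS => /orP[/vm|]; first by rewrite ltnn.
  case/existsP=> u /andP[uj /existsP[t /andP[tT tj]]].
  have uK : u \in K.
    case/nballP: uj => x [p [x0x pp <- _]]; rewrite inE in x0x.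
    by rewrite inE -(eqP x0x); apply/connectP; exists p.
  exists (Some t, u) => _ _; exists t; split=> //=; first by rewrite joinsC.
  by have [_ um] := rkP _ uK; rewrite ltnS; exact: um.
have [p pP] := choice hp.
by exists (fun v => (p v).1), (fun v => (p v).2).
Qed.

(** The edge from [v] to its parent becomes a chain of points [(v, i)] with [i < m v], whose last
    point stands for [v]. Rounding up costs at most one unit per vertex, which is the term
    [mu * #|vert G|]. *)
Lemma init_tree : exists (Y : finType) (S : {set Y}) (e : rel Y)
    (anch : Y -> vert G -> R -> Prop),
  [/\ tree_on S e, forall y v r, anch y v r -> y \in S,
      dominates (reach T) mu e anch,
      forall v, v \in K -> exists y, anch y v 0 &
      mu * #|S|%:R <= \sum_(t in T | (ends t).1 \in K) wt t + mu * #|vert G|%:R].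
Proof.
have [rk [pe [pv par]]] := comp_parent.
pose wv v := if pe v is Some t then wt t else 0.
have wv0 v : 0 <= wv v by rewrite /wv; case: (pe v) => // t; exact: wt_ge0.
pose m v := if v == x0 then 1%N else (Num.truncn (wv v / mu)).+1.
have m0 v : (0 < m v)%N by rewrite /m; case: ifP.
have mw v : v != x0 -> wv v <= mu * (m v)%:R.
  move=> vx; rewrite /m (negPf vx) mulrC -ler_pdivrMr //.
  by apply/ltW; rewrite truncnS_gt.
pose M := (\max_v m v)%N.
have mM v : (m v <= M)%N by exact: leq_bigmax.
pose Y : finType := (vert G * 'I_M.+1)%type.
pose S := [set y : Y | (y.1 \in K) && (y.2 < m y.1)%N].
pose top v : Y := (v, inord (m v).-1).
have topE v : (top v).2 = (m v).-1 :> nat by rewrite /= inordK //; have := mM v; lia.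
pose up (y : Y) : Y := if (0 < y.2)%N then (y.1, inord y.2.-1) else top (pv y.1).
pose root : Y := (x0, ord0).
have upE (y : Y) : (0 < y.2)%N -> ((up y).1 = y.1) * ((up y).2 = y.2.-1 :> nat).
  by move=> y0; rewrite /up y0 /= inordK //; exact: leq_ltn_trans (leq_pred _) (ltn_ord _).
have up0 (y : Y) : (0 < y.2)%N = false -> up y = top (pv y.1) by rewrite /up => ->.
have topS v : v \in K -> top v \in S.
  by move=> vK; rewrite inE vK topE /= ltn_predL.
have not_x0 (y : Y) : y \in S -> y != root -> (0 < y.2)%N = false -> y.1 != x0.
  move=> yS yr y2; apply: contra yr => /eqP yx; case: y yS y2 yx => v i /= _ i0 ->.
  by apply/eqP; congr pair; apply/val_inj => /=; lia.
have upS y : y \in S -> y != root -> up y \in S.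
  move=> yS yr; case y2 : (0 < y.2)%N.
    have [E1 E2] := upE _ y2; move: yS; rewrite !inE E1 E2 => /andP[-> /=].
    by move=> h; apply: leq_ltn_trans h; exact: leq_pred.
  rewrite up0 //; apply: topS.
  have yK : y.1 \in K by move: yS; rewrite inE => /andP[].
  by have [t []] := par _ yK (not_x0 _ yS yr y2).
pose rank (y : Y) := (rk y.1 * M.+1 + y.2)%N.
have rank_up y : y \in S -> y != root -> (rank (up y) < rank y)%N.
  move=> yS yr; rewrite /rank; case y2 : (0 < y.2)%N.
    by have [-> ->] := upE _ y2; rewrite ltn_add2l ltn_predL.
  rewrite up0 //; have yK : y.1 \in K by move: yS; rewrite inE => /andP[].
  have [t [_ _ _ _ h]] := par _ yK (not_x0 _ yS yr y2).
  apply: (@leq_trans ((rk (pv y.1)).+1 * M.+1)%N).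
    by rewrite mulSn addnC ltn_add2r ltn_ord.
  by apply: leq_trans (leq_addr _ _); rewrite leq_mul2r h orbT.
have rS : root \in S by rewrite inE comp_root /= m0.
pose ue (y y' : Y) := [&& y \in S, y != root & y' == up y].
pose e (y y' : Y) := ue y y' || ue y' y.
have se : symmetric e by move=> y y'; rewrite /e orbC.
have eS y y' : e y y' -> y \in S.
  by case/orP => /and3P[h1 h2 /eqP h3] //; rewrite h3 upS.
have conn y : y \in S -> connect e y root.
  move En: (rank y) => n; elim/ltn_ind: n y En => n IHn y En yS.
  have [->|yr] := eqVneq y root; first exact: connect0.
  apply: connect_trans (connect1 (_ : e y (up y))) _; first by rewrite /e /ue yS yr eqxx.
  by apply: (IHn (rank (up y))) => //; [rewrite -En rank_up|exact: upS].
have tS : tree_on S e.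
  split=> //.
  - by move=> y; apply/negP => /orP[] /and3P[yS yr /eqP h];
      have := rank_up _ yS yr; rewrite -h ltnn.
  - move=> y y' yS y'S; apply: connect_trans (conn _ yS) _.
    by rewrite (sym_connect_sym se) conn.
  - pose A1 := [set (y, up y) | y in S :\ root].
    pose A2 := [set (up y, y) | y in S :\ root].
    have h : darts e \subset A1 :|: A2.
      apply/subsetP => -[y y']; rewrite in_darts in_setU => /orP[] /and3P[yS yr /eqP->].
        by apply/orP; left; apply/imsetP; exists y; rewrite // in_setD1 yr yS.
      by apply/orP; right; apply/imsetP; exists y'; rewrite // in_setD1 yr yS.
    have c1 : (#|A1| <= #|S :\ root|)%N := leq_imset_card _ _.
    have c2 : (#|A2| <= #|S :\ root|)%N := leq_imset_card _ _.
    have hd := leq_trans (subset_leq_card h) (leq_card_setU _ _).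
    rewrite (cardsD1 root S) rS add1n mulnS addnC leq_add2l mul2n -addnn.
    exact: leq_trans hd (leq_add c1 c2).
have [mono sym tr] := reach_is_law T.
exists Y, S, e, (fun y v r => [/\ v \in K, y = top v & r = 0]); split=> //.
- by move=> y v r [vK -> _]; exact: topS.
- move=> y u r y' u' r' p [uK -> ->] [u'K -> ->] pp lp.
  (* positions along the edge to the parent, seen from both of its ends *)
  suff key : reach T u (last (top u) p).1
        (mu * (size p + ((m (last (top u) p).1).-1 - (last (top u) p).2))%:R) /\
      ((last (top u) p).1 != x0 -> reach T u (pv (last (top u) p).1)
        (mu * (size p + (last (top u) p).2.+1)%:R)).
    by case: key => + _; rewrite lp topE subnn addn0 !addr0.
  clear lp; elim/last_ind: p pp => [_|p y1 IHp].
    rewrite topE /= subnn add0n mulr0; split; first exact: reach_refl.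
    move=> ux; have [t [tE tT tj _ _]] := par _ uK ux.
    apply: mono (reach_edge tT tj); rewrite add0n prednK //.
    by have := mw _ ux; rewrite /wv tE.
  rewrite rcons_path last_rcons size_rcons => /andP[/IHp].
  set y2 := last _ p => -[hA hB] {IHp} ey.
  case/orP: ey => /and3P[yS yr /eqP yE].
  + have y2K : y2.1 \in K by move: yS; rewrite inE => /andP[].
    case y20 : (0 < y2.2)%N.
      have [E1 E2] := upE _ y20; rewrite yE E1 E2; split.
        apply: mono hA; rewrite ler_wpM2l ?(ltW mu0) // ler_nat; clear -y20; lia.
      move=> /hB; apply: mono; rewrite ler_wpM2l ?(ltW mu0) // ler_nat; clear -y20; lia.
    have y2x := not_x0 _ yS yr y20.
    rewrite yE up0 // topE subnn addn0 [(top _).1]/=; split.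
      by apply: mono (hB y2x); rewrite ler_wpM2l ?(ltW mu0) // ler_nat; clear -y20; lia.
    have [t [tE tT tj pK _]] := par _ y2K y2x.
    move=> px; have [t' [t'E t'T t'j _ _]] := par _ pK px.
    apply: mono (tr _ _ _ _ _ (hB y2x) (reach_edge t'T t'j)).
    have := mw _ px; rewrite /wv t'E prednK // => h.
    apply: le_trans (_ : mu * (size p + y2.2.+1)%:R + mu * (m (pv y2.1))%:R <= _).
      by rewrite lerD2l.
    by rewrite -mulrDr -natrD ler_wpM2l ?(ltW mu0) // ler_nat; clear -y20; lia.
  + have y1K : y1.1 \in K by move: yS; rewrite inE => /andP[].
    case y10 : (0 < y1.2)%N.
      have [E1 E2] := upE _ y10; move: hA hB; rewrite yE E1 E2 => hA hB; split.
        apply: mono hA; rewrite ler_wpM2l ?(ltW mu0) // ler_nat; clear -y10; lia.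
      move=> /hB; apply: mono; rewrite ler_wpM2l ?(ltW mu0) // ler_nat; clear -y10; lia.
    have y1x := not_x0 _ yS yr y10.
    have [t [tE tT tj pK _]] := par _ y1K y1x.
    move: hA; rewrite yE up0 // topE subnn addn0 [(top _).1]/= => hA; split.
      have h := tr _ _ _ _ _ hA (reach_edge tT (etrans (joinsC _ _ _) tj)).
      apply: mono h; have := mw _ y1x; rewrite /wv tE => h.
      apply: le_trans (_ : mu * (size p)%:R + mu * (m y1.1)%:R <= _).
        by rewrite lerD2l.
      rewrite -mulrDr -natrD ler_wpM2l ?(ltW mu0) // ler_nat.
      have := m0 y1.1; clear -y10; lia.
    move=> _; apply: mono hA; rewrite ler_wpM2l ?(ltW mu0) // ler_nat; clear -y10; lia.
- by move=> v vK; exists (top v).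
- have cS : (#|S| = \sum_(v in K) m v)%N.
    rewrite -sum1_card (eq_bigl (fun y : Y => (y.1 \in K) && (y.2 < m y.1)%N)); last first.
      by move=> y; rewrite inE.
    rewrite -(pair_big_dep (mem K) (fun v (i : 'I_M.+1) => (i < m v)%N) (fun _ _ => 1%N)) /=.
    apply: eq_bigr => v _.
    have := @big_ord_widen _ 0%N addn (m v) M.+1 (fun=> 1%N) (leqW (mM v)).
    by rewrite sum1_card card_ord.
  rewrite cS natr_sum mulr_sumr.
  have h1 v : v \in K -> mu * (m v)%:R <= (if v == x0 then 0 else wv v) + mu.
    move=> vK; rewrite /m; case: ifP => _; first by rewrite mulr1 add0r.
    rewrite -natr1 mulrDr mulr1 lerD2r mulrC -ler_pdivlMr //.
    by rewrite truncn_le // divr_ge0 // ltW.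
  apply: le_trans (ler_sum _ h1) _; rewrite big_split /=; apply: lerD; last first.
    rewrite sumr_const -[leLHS]mulr_natr ler_wpM2l ?(ltW mu0) // ler_nat; exact: max_card.
  have -> : \sum_(v in K) (if v == x0 then 0 else wv v) = \sum_(v in K :\ x0) wv v.
    rewrite (bigD1 x0 comp_root) /= eqxx add0r; apply: eq_big => [v|v /andP[_ /negPf-> //]].
    by rewrite in_setD1 andbC.
  have wvE v : v \in K :\ x0 -> wv v =
      \sum_(t in T | (ends t).1 \in K) (if pe v == Some t then wt t else 0).
    rewrite !inE => /andP[vx cv]; have vK : v \in K by rewrite inE.
    have [t [tE tT tj pK _]] := par _ vK vx.
    have tK : (ends t).1 \in K by case/joins_endsP: tj => [[<- _]|[_ <-]].
    rewrite /wv tE (bigD1 t) ?tT //= eqxx big1 ?addr0 // => t' /andP[_ tt'].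
    by case: eqP => // -[E]; rewrite E eqxx in tt'.
  rewrite (eq_bigr _ wvE) (exchange_big_dep (fun t => (t \in T) && ((ends t).1 \in K))) //=.
  apply: ler_sum => t /andP[tT tK].
  have [/existsP[v /andP[vK /eqP pv']]|] := boolP [exists v in K :\ x0, pe v == Some t].
    (* A second vertex with parent edge [t] would be its other end, and the ranks would decrease in
       both directions. *)
    rewrite (bigD1 v) /= ?vK ?tT ?tK // pv' eqxx big1 ?addr0 // => v' /andP[/andP[v'K _] vv'].
    case: eqP => // pv''; move: vK v'K; rewrite !inE => /andP[vx cv] /andP[v'x cv'].
    have [|t1 [E1 _ j1 _ r1]] := par v _ vx; first by rewrite inE.
    have [|t2 [E2 _ j2 _ r2]] := par v' _ v'x; first by rewrite inE.
    move: E1 E2; rewrite pv' pv'' => -[E1] [E2]; rewrite -E1 in j1; rewrite -E2 in j2.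
    move: j1 j2 r1 r2 vv'; case/joins_endsP=> -[-> ->] /joins_endsP[] [-> ->];
      rewrite ?eqxx // => r1 r2 _.
      by have := ltn_trans r1 r2; rewrite ltnn.
    by have := ltn_trans r1 r2; rewrite ltnn.
  rewrite negb_exists => /forallP h; rewrite big1 ?wt_ge0 // => v /andP[vK _].
  by have := h v; rewrite vK /= => /negPf->.
Qed.

End InitTree.

Lemma nball_path_card (Y : finType) (e : rel Y) c p j :
  path e c p -> uniq (c :: p) -> (j <= size p)%N -> (j < #|nball e [set c] j|)%N.
Proof.
move=> pp up jp; have u' : uniq (c :: take j p).
  apply: subseq_uniq up; rewrite /= eqxx; exact: take_subseq.
have -> : j.+1 = size (c :: take j p) by rewrite /= size_takel.
rewrite -(card_uniqP u'); apply/subset_leq_card/subsetP => u.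
rewrite inE => /orP[/eqP->|ut].
  by apply/nballP; exists c, [::]; rewrite set11.
have pt := take_path j pp; have st : size (take j p) = j by rewrite size_takel.
move: pt st; case/path.splitPr: ut => p1 p2 pt st; apply/nballP; exists c, (rcons p1 u).
rewrite set11 last_rcons; split=> //.
  by move: pt; rewrite -cat_rcons cat_path => /andP[].
by rewrite -st size_cat size_rcons /=; clear; lia.
Qed.

(** * Clusters at one scale *)

Section Clusters.
Variables (R : realType) (G : mgraph R) (x0 : vert G) (K : {set vert G}).
Variables (k s : nat) (eps del mu : R).
Hypotheses (k0 : (0 < k)%N) (s16 : 16 <= del * s%:R) (del0 : 0 < del) (del1 : 4 * del <= 1).
Hypotheses (deps : 4 * del <= eps) (mu0 : 0 <= mu).
Let P : R := 2 * k%:R - 1.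
Hypothesis girthG : forall e c, reach (~: [set e]) (ends e).1 (ends e).2 c ->
  (1 + eps) * P * @wt R G e <= c.

Variables (A0 E' : {set edge G}) (L rbar : R) (rho : nat).
Hypothesis x0K : x0 \in K.
Hypotheses (L0 : 0 < L) (rbarL : rbar * s%:R <= L) (rhoL : mu * rho%:R * s%:R <= L).
Hypothesis A0E' : forall e, e \in E' -> e \notin A0.
Hypothesis E'K : forall e, e \in E' -> (ends e).1 \in K /\ (ends e).2 \in K.
Hypothesis E'w : forall e, e \in E' -> L <= (1 + del) * wt e /\ wt e <= L.

Lemma cluster_P1 : 1 <= P.
Proof.
have : 1 <= k%:R :> R by rewrite ler1n.
by rewrite /P; lra.
Qed.

Lemma cluster_s0 : 0 < s%:R :> R.
Proof.
rewrite ltr0n lt0n; apply/negP => /eqP s0; move: s16; rewrite s0 mulr0.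
by lra.
Qed.

(** [L] exceeds the weight by a factor of at most [1 + del <= 5 / 4], so the walk would be a detour
    of weight at most [P * wt e], against the girth. *)
Lemma cluster_far e x x' : e \in E' -> joins e x x' -> ~ reach A0 x x' (4 / 5 * P * L).
Proof.
move=> eE ej hr; have [mono sym _] := reach_is_law (~: [set e]).
have {}hr : reach (~: [set e]) x x' (4 / 5 * P * L).
  apply: reach_sub hr => f fA; rewrite !inE; apply: contraTneq fA => ->; exact: A0E'.
have {}hr : reach (~: [set e]) (ends e).1 (ends e).2 (4 / 5 * P * L).
  by case/joins_endsP: ej hr => -[-> ->] // /sym.
have := girthG hr; have [h1 h2] := E'w eE.
have P1 := cluster_P1; have w0 := wt_ge0 e.
have h3 : L <= 5 / 4 * wt e.
  apply: le_trans h1 _; rewrite ler_wpM2r //; by move: del1; lra.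
have h4 : 0 < wt e by move: L0; lra.
have h5 : 4 / 5 * P * L <= P * wt e.
  have -> : 4 / 5 * P * L = P * (4 / 5 * L) by ring.
  by rewrite ler_wpM2l //; lra.
have h6 : 0 < eps * (P * wt e).
  rewrite !mulr_gt0 //; [by move: deps del0; lra|by lra].
have -> : (1 + eps) * P * wt e = P * wt e + eps * (P * wt e) by ring.
by lra.
Qed.

Variables (Y : finType) (S : {set Y}) (e : rel Y) (anch : Y -> vert G -> R -> Prop).
Hypotheses (tS : tree_on S e) (aS : forall y v r, anch y v r -> y \in S).
Hypothesis dom : dominates (reach A0) mu e anch.
Hypothesis covK : forall v, v \in K -> exists y r, anch y v r /\ r <= rbar.

(** Contracting the clusters lengthens each edge by at most [8 * L / s <= del / 2 * L], little
    enough for the girth to exclude cycles of at most [2 * k] edges in the contracted multigraph, as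
    Moore's bound requires. The degree [d] is left open: it is chosen from [#|vert G|] in one use
    and from [#|C|] in the other. *)
Lemma cluster_select : exists (C : {set Y}) (x x' : Y -> vert G),
  [/\ forall c, c \in C ->
      [/\ exists r, anch c (x c) r /\ r <= rbar,
          exists y r, anch y (x' c) r /\ r <= rbar,
          reach (A0 :|: E') (x c) (x' c) L,
          ~ reach A0 (x c) (x' c) (4 / 5 * P * L) &
          (rho < #|nball e [set c] rho|)%N],
      {in C &, forall c c', c != c' -> [disjoint nball e [set c] rho & nball e [set c'] rho]},
      (#|C| <= #|vert G|)%N &
      forall d, (#|C| < d ^ k)%N -> (#|E'| <= d * #|C|)%N].
Proof.
have P1 := cluster_P1; have s0 := cluster_s0.
have sL : L / s%:R <= del / 16 * L.
  rewrite ler_pdivrMr //; have -> : del / 16 * L * s%:R = (del * s%:R) * L / 16 by field.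
  by have : 16 * L <= del * s%:R * L; [rewrite ler_wpM2r // ltW|lra].
have rb : rbar <= L / s%:R by rewrite ler_pdivlMr.
have rh : mu * rho%:R <= L / s%:R by rewrite ler_pdivlMr.
have [se _ _ _ _] := tS; have [mono0 sym0 tr0] := reach_is_law A0.
have [y0 _] := covK x0K.
have ha v : exists y, v \in K -> exists r, anch y v r /\ r <= rbar.
  by have [/covK[y [r h]]|] := boolP (v \in K); [exists y; exists r|exists y0].
have {ha} [a aP] := choice ha.
pose Vt := [set (ends f).1 | f in E'] :|: [set (ends f).2 | f in E'].
have VtK v : v \in Vt -> v \in K.
  by rewrite inE => /orP[] /imsetP[f fE ->]; have [] := E'K fE.
have [C CU [dC maxC]] := max_disjoint_family [set a v | v in Vt] (fun y => nball e [set y] rho).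
have hx c : exists p : vert G * vert G, c \in C -> exists f,
    [/\ f \in E', joins f p.1 p.2 & a p.1 = c].
  have [/(subsetP CU)/imsetP[v vV ->]|] := boolP (c \in C); last by exists (x0, x0).
  move: vV; rewrite inE => /orP[] /imsetP[f fE ->].
    by exists ((ends f).1, (ends f).2); exists f; split=> //; exact: joins_ends.
  by exists ((ends f).2, (ends f).1); exists f; split=> //=; rewrite joinsC joins_ends.
have {hx} [xx xxP] := choice hx.
pose x c := (xx c).1; pose x' c := (xx c).2.
have xK c : c \in C -> x c \in K /\ x' c \in K.
  move=> /xxP[f [fE fj _]]; have [h1 h2] := E'K fE.
  by rewrite /x /x'; case/joins_endsP: fj => -[-> ->].
have selfb y : y \in nball e [set y] rho by apply/nballP; exists y, [::]; rewrite set11.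
(* Two radii and two anchoring errors, each at most [L / s]. *)
have near v : exists c, v \in Vt -> c \in C /\ reach A0 v (x c) (4 * (L / s%:R)).
  have [vV|] := boolP (v \in Vt); last by exists y0.
  have [||c cC] := maxC (a v); first by apply/imsetP; exists v.
    by apply/set0Pn; exists (a v).
  rewrite -setI_eq0 => /set0Pn[u /setIP[/nballP[b [p [bE pp lp sp]]] /nballP[b' [p' [b'E pp' lp' sp']]]]].
  move: bE b'E; rewrite !inE => /eqP bE /eqP b'E; subst b b'.
  have [q pq [lq sq]] := path_rev se pp'.
  exists c => _; split=> //.
  have [r [hr rr]] := aP _ (VtK _ vV); have [xcK _] := xK _ cC.
  have [r' [hr' rr']] := aP _ xcK; have [f [_ _ axc]] := xxP _ cC.
  rewrite -/(x c) in axc; rewrite axc in hr'.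
  apply: mono0 (dom (p := p ++ q) hr hr' _ _).
  - have : mu * (size (p ++ q))%:R <= mu * (2 * rho)%:R.
      by rewrite ler_wpM2l // ler_nat size_cat sq; clear -sp sp'; lia.
    by rewrite natrM (mulrCA mu); move: rb rh rr rr'; lra.
  - by rewrite cat_path pp lp -lp'.
  - by rewrite last_cat lp -lp' lq.
have {near} [cl clP] := choice near.
have cN : (#|C| <= #|vert G|)%N.
  rewrite -(card_in_imset (f := x) (D := C)) ?max_card //.
  move=> c c' cC c'C E; have [f [_ _ ac]] := xxP _ cC; have [f' [_ _ ac']] := xxP _ c'C.
  by rewrite -ac -ac' -/(x c) -/(x c') E.
exists C, x, x'; split=> //.
- move=> c cC; have [xcK x'cK] := xK _ cC; have [f [fE fj ac]] := xxP _ cC.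
  have [r [hr rr]] := aP _ xcK; rewrite -/(x c) in ac; rewrite ac in hr.
  have [y [r' [hr' rr']]] := covK x'cK.
  have far : ~ reach A0 (x c) (x' c) (4 / 5 * P * L) by apply: cluster_far fE fj.
  split=> //.
  + by exists r.
  + by exists y, r'.
  + have [mono _ _] := reach_is_law (A0 :|: E').
    have fA : f \in A0 :|: E' by rewrite inE fE orbT.
    by apply: mono (reach_edge fA fj); have [] := E'w fE.
  (* The tree path towards [x' c] is longer than [rho], since the ends are far apart; its initial
     part fills the ball. *)
  + have [p [pp lp up _]] := tree_uniq_path tS (aS hr) (aS hr').
    apply: (nball_path_card pp up); rewrite leqNgt; apply/negP => sp; apply: far.
    apply: mono0 (dom hr hr' pp lp).
    have : mu * (size p)%:R <= mu * rho%:R by rewrite ler_wpM2l // ler_nat ltnW.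
    have : L <= P * L by rewrite ler_peMl // ltW.
    have : del / 16 * L <= 1 / 64 * L by rewrite ler_wpM2r ?(ltW L0) //; move: del1; lra.
    by move: rb rh sL L0; lra.
- move=> d dC'.
  pose M := @MGraph R (vert G) (edge G) (fun f => (x (cl (ends f).1), x (cl (ends f).2)))
    (@wt R G) (@wt_ge0 R G).
  have endV f : f \in E' -> (ends f).1 \in Vt /\ (ends f).2 \in Vt.
    by move=> fE; split; rewrite inE; apply/orP; [left|right]; apply/imsetP; exists f.
  have cC' : (#|[set x c | c in C]| <= #|C|)%N := leq_imset_card _ _.
  apply: leq_trans (_ : d * #|[set x c | c in C]| <= _)%N; last by rewrite leq_mul2l cC' orbT.
  apply: (@moore_bound R M E' k d k0); last 1 first.
  + exact: leq_ltn_trans cC' dC'.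
  + suff key (f : edge G) (p : seq (edge G * vert G)) : f \in E' ->
        @walk R M (E' :\ f) (x (cl (ends f).1)) p (x (cl (ends f).2)) ->
        (size p < 2 * k)%N -> False by move=> f fE p; exact: key.
    move=> fE wp sp; have [mono sym tr] := reach_is_law (~: [set f]).
    have subA : {subset A0 <= ~: [set f]}.
      by move=> h hA; rewrite !inE; apply: contraTneq hA => ->; exact: A0E'.
    have step h al be : h \in E' -> h != f -> @joins R M h al be ->
        reach (~: [set f]) al be (L + 8 * (L / s%:R)).
      move=> hE hf hj; have [h1 h2] := endV _ hE.
      have [_ n1] := clP _ h1; have [_ n2] := clP _ h2.
      have {}n1 := reach_sub subA n1; have {}n2 := reach_sub subA n2.
      have hm : reach (~: [set f]) (ends h).1 (ends h).2 L.
        have hS : h \in ~: [set f] by rewrite !inE.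
        have [_ hw] := E'w hE; exact: mono hw (reach_edge hS (joins_ends h)).
      have main : reach (~: [set f]) (x (cl (ends h).1)) (x (cl (ends h).2)) (L + 8 * (L / s%:R)).
        apply: mono (tr _ _ _ _ _ (tr _ _ _ _ _ (sym _ _ _ n1) hm) n2); lra.
      by case/orP: hj => /eqP[<- <-] //; exact: sym.
    have wreach al be : @walk R M (E' :\ f) al p be ->
        reach (~: [set f]) al be ((size p)%:R * (L + 8 * (L / s%:R))).
      elim: (p) al => [|[h z] q IHq] al /=.
        by move/eqP=> ->; rewrite mul0r; exact: reach_refl.
      case/and3P=> /setD1P[hf hE] hj /IHq IH.
      by apply: mono (tr _ _ _ _ _ (step _ _ _ hE hf hj) IH); rewrite mulrSr mulrDl mul1r; lra.
    have [h1 h2] := endV _ fE.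
    have [_ n1] := clP _ h1; have [_ n2] := clP _ h2.
    have {}n1 := reach_sub subA n1; have {}n2 := reach_sub subA n2.
    have := girthG (tr _ _ _ _ _ (tr _ _ _ _ _ n1 (wreach _ _ wp)) (sym _ _ _ n2)).
    have [hw1 hw2] := E'w fE.
    have szP : (size p)%:R <= P.
      have : (size p).+1%:R <= (2 * k)%:R :> R by rewrite ler_nat.
      by rewrite -natr1 natrM /P; lra.
    have Ls0 : 0 <= L / s%:R by rewrite divr_ge0 // ltW.
    have b1 : (size p)%:R * (L + 8 * (L / s%:R)) <= P * (L + 8 * (L / s%:R)).
      by rewrite ler_wpM2r //; move: L0; lra.
    have b2 : 8 * (L / s%:R) <= P * (8 * (L / s%:R)) by rewrite ler_peMl //; lra.
    have b3 : P * (16 * (L / s%:R)) <= P * (del * L).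
      by rewrite ler_wpM2l //; [lra|move: sL; lra].
    have w0 : 0 < wt f.
      rewrite lt0r wt_ge0 andbT; apply/eqP => w0; move: hw1 L0; rewrite w0; lra.
    have b4 : (1 + del) * (P * L) <= (1 + del) * (P * ((1 + del) * wt f)).
      rewrite ler_wpM2l //; first by move: del0; lra.
      by rewrite ler_wpM2l //; lra.
    (* One factor for the width of the scale, one for the detours to the cluster centres, since
       [16 <= del * s]. *)
    have b5 : (1 + del) * (1 + del) < 1 + eps.
      have : del * del <= del * (1 / 4) by rewrite ler_wpM2l ?(ltW del0) //; move: del1; lra.
      by rewrite mulrDl mul1r mulrDr mulr1; move: deps del0; lra.
    have b6 : (1 + del) * (1 + del) * (P * wt f) < (1 + eps) * (P * wt f).
      by rewrite ltr_pM2r // mulr_gt0 //; lra.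
    move=> b7; suff : (1 + eps) * (P * wt f) < (1 + eps) * (P * wt f) by rewrite ltxx.
    apply: le_lt_trans b6.
    have e1 : (1 + del) * (P * ((1 + del) * wt f)) = (1 + del) * (1 + del) * (P * wt f) by ring.
    have e2 : (1 + eps) * P * wt f = (1 + eps) * (P * wt f) by ring.
    have e3 : P * (L + 8 * (L / s%:R)) = P * L + P * (8 * (L / s%:R)) by ring.
    have e4 : P * (16 * (L / s%:R)) = P * (8 * (L / s%:R)) + P * (8 * (L / s%:R)) by ring.
    have e5 : (1 + del) * (P * L) = P * L + P * (del * L) by ring.
    by move: b1 b2 b3 b4 b7; rewrite e1 e2 e3 e4 e5; lra.
  + move=> f fE; have [h1 h2] := endV f fE.
    have [c1 _] := clP _ h1; have [c2 _] := clP _ h2.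
    by split; apply/imsetP; [exists (cl (@ends R G f).1)|exists (cl (@ends R G f).2)].
Qed.

End Clusters.

(** * Lightness of graphs of large weighted girth *)

Section Geometric.
Variable R : realType.

(** [phi] is a potential with values between 0 and 4 on positive reals; its growth over a doubling
    dominates the smaller of [q] and its inverse, so sums along doubling sequences telescope. *)
Lemma min_inv_step (q q' : R) : 0 < q -> 2 * q <= q' ->
  let phi x := if x <= 1 then 2 * x else 4 - 2 / x in
  Num.min q q^-1 <= phi q' - phi q.
Proof.
move=> q0 qq' /=; have q'0 : 0 < q' by lra.
have qi : q * q^-1 = 1 by rewrite mulfV // gt_eqF.
have qi0 : 0 < q^-1 by rewrite invr_gt0.
have q'i0 : 0 < q'^-1 by rewrite invr_gt0.
have h : 2 * q'^-1 <= q^-1.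
  by rewrite -(ler_pM2l q0) qi mulrA ler_pdivrMr // mul1r mulrC.
case: (leP q 1) => q1; case: (leP q' 1) => q'1.
- apply: (@le_trans _ _ q); first by rewrite ge_min lexx.
  by lra.
- apply: (@le_trans _ _ q); first by rewrite ge_min lexx.
  have q'i1 : q'^-1 <= 1 by rewrite invf_le1 // ltW.
  have [qs|qs] := leP q (2 / 3); first by lra.
  have : q^-1 + 3 * q <= 4.
    rewrite -(ler_pM2l q0) mulrDr qi.
    have : 0 <= (3 * q - 1) * (1 - q) by rewrite mulr_ge0 //; lra.
    lra.
  lra.
- lra.
- apply: (@le_trans _ _ q^-1); first by rewrite ge_min lexx orbT.
  lra.
Qed.

Lemma min_inv_sum (q : nat -> R) m : (forall l, 0 < q l) ->
  (forall l, 2 * q l <= q l.+1) -> \sum_(l < m) Num.min (q l) (q l)^-1 <= 4.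
Proof.
move=> q0 q2; pose phi (x : R) := if x <= 1 then 2 * x else 4 - 2 / x.
have phi4 x : 0 < x -> phi x <= 4.
  move=> x0; rewrite /phi; case: (leP x 1) => x1; first by lra.
  have xi : 0 < x^-1 by rewrite invr_gt0.
  by lra.
have phi0 x : 0 < x -> 0 <= phi x.
  move=> x0; rewrite /phi; case: (leP x 1) => x1; first by lra.
  have : x^-1 <= 1 by rewrite invf_le1 // ltW.
  lra.
apply: le_trans (phi4 (q m) (q0 m)).
suff : \sum_(l < m) Num.min (q l) (q l)^-1 <= phi (q m) - phi (q 0%N).
  by have := phi0 _ (q0 0%N); lra.
elim: m => [|m IHm]; first by rewrite big_ord0 subrr.
have h : Num.min (q m) (q m)^-1 <= phi (q m.+1) - phi (q m) := min_inv_step (q0 m) (q2 m).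
by rewrite big_ord_recr /=; move: IHm h; lra.
Qed.

Lemma root_ceil (n k : nat) : (0 < n)%N -> (0 < k)%N ->
  exists d : nat, (n < d ^ k)%N /\ d%:R <= 2 * n%:R `^ k%:R^-1 :> R.
Proof.
move=> n0 k0; set r : R := n%:R `^ k%:R^-1.
have x1 : 1 <= r.
  by rewrite -[leLHS](powRr0 (n%:R : R)) ler_powR ?ler1n.
have r0 : 0 <= r by exact: powR_ge0.
have E : n%:R = r ^+ k.
  by rewrite -powR_mulrn // -powRrM mulVf ?powRr1 // pnatr_eq0 -lt0n.
exists (Num.truncn r).+1; split.
  rewrite -(ltr_nat R) natrX E ltr_pXn2r ?nnegrE //; exact: truncnS_gt.
have : (Num.truncn r)%:R <= r by rewrite truncn_le.
by rewrite -natr1; lra.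
Qed.

End Geometric.

(** * Summation over the scales *)

Section Levels.
Variables (R : realType) (G : mgraph R) (T : {set edge G}) (x0 : vert G).
Variables (k s : nat) (eps del b : R).
Hypotheses (k0 : (0 < k)%N) (s16 : 16 <= del * s%:R) (del0 : 0 < del) (del1 : 4 * del <= 1).
Hypotheses (deps : 4 * del <= eps) (b0 : 0 < b).
Hypothesis girthG : forall e c, reach (~: [set e]) (ends e).1 (ends e).2 c ->
  (1 + eps) * (2 * k%:R - 1) * @wt R G e <= c.
Hypothesis spanT : forall e : edge G, connect (edge_rel T) (ends e).1 (ends e).2.

Let K := comp_of T x0.
Let n := #|vert G|.
Let A := (7 * s)%N.
(** The ratio [7 * s] comes from the anchoring errors: scale L starts with errors of at most [L / s]
    and adds at most [6 * L], and [L / s + 6 * L <= 7 * L] is the next scale divided by [s]. *)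
Definition level l : R := b * (A ^ l)%:R.
Definition level_edges l : {set edge G} :=
  [set e | [&& e \notin T, (ends e).1 \in K, level l <= (1 + del) * wt e & wt e <= level l]].
Definition level_graph l : {set edge G} := T :|: \bigcup_(j < l) level_edges j.
Let compw : R := \sum_(t in T | (ends t).1 \in K) wt t.
(** Rounding up at [n] vertices then costs [b / s] in total, and [rho l] units make up
    [level l / s]. *)
Let mu : R := b / (s * n)%:R.
Let rho l := (n * A ^ l)%N.

Lemma scale_ge64 : (64 <= s)%N.
Proof.
have h : 64 <= s%:R :> R.
  have : del * s%:R <= 1 / 4 * s%:R by rewrite ler_wpM2r //; move: del1; lra.
  by move: s16; lra.
by rewrite -(ler_nat R).
Qed.

Lemma scale_ge j : (j <= 64)%N -> (j <= s)%N.
Proof. by move=> h; exact: leq_trans h scale_ge64. Qed.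

Lemma card_vert_gt0 : (0 < n)%N.
Proof. by apply/card_gt0P; exists x0. Qed.

Lemma level_gt0 l : 0 < level l.
Proof.
rewrite mulr_gt0 // ltr0n expn_gt0 /A; apply/orP; left.
by rewrite muln_gt0 scale_ge.
Qed.

Lemma levelS l : level l.+1 = 7 * s%:R * level l.
Proof. by rewrite /level expnSr /A !natrM; ring. Qed.

Lemma mu_gt0 : 0 < mu.
Proof. by rewrite divr_gt0 // ltr0n muln_gt0 card_vert_gt0 andbT; exact: scale_ge. Qed.

Lemma mu_rho l : mu * (s * rho l)%:R = level l.
Proof.
rewrite /mu /level /rho mulnA (natrM _ (s * n)) mulrA divfK //.
by rewrite pnatr_eq0 muln_eq0 negb_or -!lt0n card_vert_gt0 andbT; exact: scale_ge.
Qed.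

Lemma level_edgesK l e : e \in level_edges l -> (ends e).1 \in K /\ (ends e).2 \in K.
Proof.
rewrite inE => /and4P[_ h _ _]; split=> //; move: h; rewrite !inE => h.
exact: connect_trans h (spanT e).
Qed.

Lemma level_edgesw l e : e \in level_edges l -> level l <= (1 + del) * wt e /\ wt e <= level l.
Proof. by rewrite inE => /and4P[]. Qed.

Lemma level_mono j l : (j <= l)%N -> level j <= level l.
Proof.
move=> jl; rewrite ler_wpM2l ?(ltW b0) // ler_nat leq_pexp2l // /A.
by rewrite muln_gt0 scale_ge.
Qed.

Lemma level_edges_graph l e : e \in level_edges l -> e \notin level_graph l.
Proof.
move=> eL; have [h1 h2] := level_edgesw eL.
rewrite inE negb_or; apply/andP; split; first by move: eL; rewrite inE => /and4P[].
apply/negP => /bigcupP[[j jl] _ /= ej]; have [_ h3] := level_edgesw ej.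
have h4 := level_mono (jl : (j.+1 <= l)%N); move: h4; rewrite levelS => h4.
have L0 := level_gt0 j.
have s1 : 64 <= s%:R :> R by rewrite (ler_nat R 64) scale_ge64.
have h5 : (1 + del) * wt e <= 2 * level j.
  apply: le_trans (_ : (1 + del) * level j <= _).
    by rewrite ler_wpM2l //; move: del0; lra.
  by rewrite ler_wpM2r ?(ltW L0) //; move: del1; lra.
have h6 : 64 * level j <= s%:R * level j by rewrite ler_wpM2r ?(ltW L0).
by move: h1 h4 h5 h6 L0; rewrite -mulrA; lra.
Qed.

Lemma level_graphS l : level_graph l.+1 = level_graph l :|: level_edges l.
Proof. by rewrite /level_graph big_ord_recr /= finset.setUA. Qed.

Lemma weight_level l (c : R) : #|level_edges l|%:R <= c ->
  weight (level_edges l) <= level l * c.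
Proof.
move=> h; apply: le_trans (_ : level l * #|level_edges l|%:R <= _); last first.
  by rewrite ler_wpM2l // ltW // level_gt0.
rewrite mulr_natr -sumr_const; apply: ler_sum => e /level_edgesw[] //.
Qed.

Let w1 : R := compw + b.

Lemma start_bound (S0 : nat) : mu * S0%:R <= compw + mu * n%:R ->
  s%:R * (mu * S0%:R) <= s%:R * w1.
Proof.
move=> h; rewrite ler_wpM2l //; apply: le_trans h _; rewrite lerD2l.
rewrite /mu natrM invfM mulrA mulfVK ?pnatr_eq0 -?lt0n ?card_vert_gt0 //.
rewrite ler_pdivrMr ?ltr0n ?scale_ge //.
by rewrite ler_peMr ?(ltW b0) // ler1n scale_ge.
Qed.

(** A cluster accounts for at most [d] edges of weight at most L and removes at least [rho / 63]
    points of the tree. As [L = mu * s * rho], the price [c] of a point is the same at every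
    scale. *)
Lemma levels_potential m d : (8 <= k)%N -> (n < d ^ k)%N ->
  \sum_(l < m) weight (level_edges l) <= 63 * d%:R * (s%:R * w1).
Proof.
move=> k8 nd; have mu0 := ltW mu_gt0.
have [Y [S0 [e0 [anch0 [tS0 aS0 dom0 cov0 size0]]]]] := init_tree T x0 mu_gt0.
pose c : R := 63 * d%:R * (s%:R * mu).
suff [S [e [anch [_ _ _ _ h]]]] : exists (S : {set Y}) (e : rel Y) (anch : Y -> vert G -> R -> Prop),
  [/\ tree_on S e, forall y v r, anch y v r -> y \in S, dominates (reach (level_graph m)) mu e anch,
      forall v, v \in K -> exists y r, anch y v r /\ r * s%:R <= level m &
      \sum_(l < m) weight (level_edges l) + c * #|S|%:R <= c * #|S0|%:R].
  have c0 : 0 <= c  by rewrite /c; repeat (apply: mulr_ge0 => //).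
  have h1 : c * #|S0|%:R <= 63 * d%:R * (s%:R * w1).
    have -> : c * #|S0|%:R = 63 * d%:R * (s%:R * (mu * #|S0|%:R)) by rewrite /c; ring.
    by rewrite ler_wpM2l ?mulr_ge0 //; exact: start_bound size0.
  have : 0 <= c * #|S|%:R by apply: mulr_ge0.
  by move: h h1; lra.
elim: m => [|m [S [e [anch [tS aS dom cov h]]]]].
  exists S0, e0, anch0; split=> //; last by rewrite big_ord0 add0r.
  - rewrite /level_graph big_ord0 finset.setU0; exact: dom0.
  - move=> v /cov0[y hy]; exists y, 0; split=> //; by rewrite mul0r ltW // level_gt0.
pose L := level m; have L0 : 0 < L := level_gt0 m.
have s0 : 0 < s%:R :> R by rewrite ltr0n scale_ge.
have x0K : x0 \in K := comp_root T x0.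
have rhoL : mu * (rho m)%:R * s%:R <= L.
  by rewrite /L -mu_rho natrM (mulrC s%:R) mulrA.
have rbL : L / s%:R * s%:R <= L by rewrite divfK // gt_eqF.
have cov' v : v \in K -> exists y r, anch y v r /\ r <= L / s%:R.
  by move=> /cov[y [r [hy hr]]]; exists y, r; split=> //; rewrite ler_pdivlMr.
have [C [x [x' [hC dC Cn EC]]]] :=
  cluster_select k0 s16 del0 del1 deps mu0 girthG x0K L0 rbL rhoL (@level_edges_graph m)
    (@level_edgesK m) (@level_edgesw m) tS aS dom cov'.
have muN : mu * (s * rho m)%:R = L by exact: mu_rho.
have s4 : 4 <= s%:R :> R by rewrite (ler_nat R 4) scale_ge.
have [|||||S' [e' [anch' [tS' aS' dom' card' cov1]]]] :=
  @prune_step R Y (vert G) (reach (level_graph m)) (reach (level_graph m.+1)) mu (L / s%:R)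
    (s * rho m) (rho m) (reach_is_law _) (reach_is_law _) _ mu0 _ _ _ S e anch C x x' tS aS dom _ dC.
- by move=> v v' r; apply: reach_sub => f hf; rewrite level_graphS; apply/setUP; left.
- by rewrite muN mulrA ler_pdivrMr // mulrC ler_wpM2l // ltW.
- by rewrite !muln_gt0 card_vert_gt0 expn_gt0 /A muln_gt0 !scale_ge.
- by rewrite leq_mul2r scale_ge ?orbT.
- move=> c0 /hC[h1 h2 h3 h4 h5]; split=> //; last exact: ltnW.
    by rewrite level_graphS muN.
  (* [8 <= k] enters here: [4 / 5 * (2 * 8 - 1) >= 8]. *)
  move=> h6; apply: h4; have [mono _ _] := reach_is_law (level_graph m).
  apply: mono h6; rewrite natrM mulrCA muN ler_wpM2r ?(ltW L0) //.
  have : 8 <= k%:R :> R by rewrite (ler_nat R 8).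
  by lra.
exists S', e', anch'; split=> //.
- move=> v /cov'[y [r [hy hr]]]; have [y' [r' [hy' hr']]] := cov1 _ _ _ hy.
  exists y', r'; split=> //; rewrite levelS.
  have h1 : r' <= L / s%:R + 6 * L by move: hr'; rewrite natrM mulrCA muN; move: hr; lra.
  apply: le_trans (_ : (L / s%:R + 6 * L) * s%:R <= _); first by rewrite ler_wpM2r // ltW.
  rewrite mulrDl divfK ?gt_eqF // -/L.
  have : L <= L * s%:R by rewrite ler_peMr ?(ltW L0) //; move: s4; lra.
  by lra.
- rewrite big_ord_recr /=.
  have h1 : weight (level_edges m) <= L * (d%:R * #|C|%:R).
    apply: weight_level; rewrite -natrM ler_nat; apply: EC.
    exact: leq_ltn_trans Cn nd.
  have h2 : (#|C| * rho m)%:R + 63 * #|S'|%:R <= 63 * #|S|%:R :> R.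
    by rewrite -!natrM -natrD ler_nat.
  have h3 : L * (d%:R * #|C|%:R) = d%:R * (s%:R * mu) * (#|C| * rho m)%:R.
    by rewrite -muN !natrM; ring.
  have h4 : d%:R * (s%:R * mu) * ((#|C| * rho m)%:R + 63 * #|S'|%:R) <=
      d%:R * (s%:R * mu) * (63 * #|S|%:R) by rewrite ler_wpM2l //; repeat (apply: mulr_ge0 => //).
  have h5 : d%:R * (s%:R * mu) * (63 * #|S|%:R) = c * #|S|%:R by rewrite /c; ring.
  have h6 : d%:R * (s%:R * mu) * ((#|C| * rho m)%:R + 63 * #|S'|%:R) =
    d%:R * (s%:R * mu) * (#|C| * rho m)%:R + c * #|S'|%:R by rewrite /c; ring.
  by move: h h1 h4; rewrite h3 h5 h6; lra.
Qed.

(** With the tree fixed there are at most [min (n, P / L)] clusters at scale L. The bounds grow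
    geometrically up to [L = P / n] and then decay like the power [-1 / k] of L; as this exponent is
    at least [1 / 7] in size, the sum does not depend on [k]. *)
Lemma levels_static m : (k <= 7)%N ->
  \sum_(l < m) weight (level_edges l) <= 8 * n%:R `^ k%:R^-1 * (s%:R * w1).
Proof.
move=> k7; have mu0 := ltW mu_gt0.
have [Y [S0 [e0 [anch0 [tS0 aS0 dom0 cov0 size0]]]]] := init_tree T x0 mu_gt0.
have s0 : 0 < s%:R :> R by rewrite ltr0n scale_ge.
have x0K : x0 \in K := comp_root T x0.
pose P : R := s%:R * (mu * #|S0|%:R).
have Pw : P <= s%:R * w1 := start_bound size0.
have S00 : (0 < #|S0|)%N.
  have [y hy] := cov0 _ x0K; apply/card_gt0P; exists y; exact: aS0 hy.
have P0 : 0 < P by apply: mulr_gt0 => //; apply: mulr_gt0; rewrite ?mu_gt0 // ltr0n.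
have n0 : 0 < n%:R :> R by rewrite ltr0n card_vert_gt0.
(* [t l] equals 1 where the two bounds [n] and [P / L] on the number of clusters agree. *)
pose t l : R := level l * n%:R / P.
have t0 l : 0 < t l by rewrite divr_gt0 // mulr_gt0 // level_gt0.
pose q l : R := t l `^ 7%:R^-1.
have q0 l : 0 < q l by rewrite powR_gt0.
(* [7 * s >= 2 ^ 7], so seventh roots at least double. *)
have q2 l : 2 * q l <= q l.+1.
  have E : t l.+1 = (7 * s%:R) * t l by rewrite /t levelS; ring.
  rewrite /q E powRM ?(ltW (t0 l)) ?mulr_ge0 // ler_wpM2r ?powR_ge0 //.
  have -> : 2 = (2 ^+ 7) `^ 7%:R^-1 :> R.
    by rewrite -powR_mulrn // -powRrM mulfV ?powRr1.
  rewrite ge0_ler_powR ?invr_ge0 ?nnegrE ?exprn_ge0 ?mulr_ge0 //.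
  have : 64 <= s%:R :> R by rewrite (ler_nat R 64) scale_ge64.
  by rewrite -natrX (_ : (2 ^ 7)%N = 128%N) //; lra.
have nk0 : 0 <= n%:R `^ k%:R^-1 :> R by exact: powR_ge0.
suff hl (l : 'I_m) : weight (level_edges l) <= 2 * P * n%:R `^ k%:R^-1 * Num.min (q l) (q l)^-1.
  apply: le_trans (ler_sum _ (fun l _ => hl l)) _; rewrite -mulr_sumr.
  apply: le_trans (_ : 2 * P * n%:R `^ k%:R^-1 * 4 <= _).
    rewrite ler_wpM2l ?min_inv_sum //; apply: mulr_ge0 => //.
    by apply: mulr_ge0 => //; exact: ltW.
  have : P * (n%:R `^ k%:R^-1 * 8) <= s%:R * w1 * (n%:R `^ k%:R^-1 * 8).
    by rewrite ler_wpM2r // mulr_ge0.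
  by lra.
have rhoL : mu * (rho l)%:R * s%:R <= level l.
  by rewrite -mu_rho natrM (mulrC s%:R) mulrA.
have r0L : 0 * s%:R <= level l by rewrite mul0r ltW // level_gt0.
have nT e : e \in level_edges l -> e \notin T by rewrite inE => /and4P[].
have cov' v : v \in K -> exists y r, anch0 y v r /\ r <= 0.
  by move=> /cov0[y hy]; exists y, 0.
have [C [x [x' [hC dC Cn EC]]]] :=
  cluster_select k0 s16 del0 del1 deps mu0 girthG x0K (level_gt0 l) r0L rhoL nT
    (@level_edgesK l) (@level_edgesw l) tS0 aS0 dom0 cov'.
have Crho : (#|C| * rho l <= #|S0|)%N.
  apply: leq_trans (_ : #|\bigcup_(c in C) nball e0 [set c] (rho l)| <= _)%N.
    by apply: card_bigcup_disjoint => // c /hC[_ _ _ _ /ltnW].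
  apply/subset_leq_card/bigcupsP => c /hC[[r [/aS0 cS _]] _ _ _ _].
  apply/subsetP => y /nballP[c' [p [/set1P-> pp <- _]]].
  exact: (tree_path_sub tS0 cS pp) (mem_last _ _).
have [C0|C0] := posnP #|C|.
  have := EC 1%N; rewrite C0 exp1n muln0 leqn0 cards_eq0 => /(_ isT)/eqP ->.
  rewrite /weight big_set0; apply: mulr_ge0; last by rewrite le_min (ltW (q0 l)) invr_ge0 ltW.
  by apply: mulr_ge0 => //; apply: mulr_ge0 => //; exact: ltW.
have [d [Cd dC']] := root_ceil R C0 k0.
have h1 : weight (level_edges l) <= level l * (2 * #|C|%:R `^ k%:R^-1 * #|C|%:R).
  apply: weight_level; apply: le_trans (_ : (d * #|C|)%:R <= _); first by rewrite ler_nat EC.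
  by rewrite natrM ler_wpM2r.
have LC : level l * #|C|%:R <= P.
  rewrite -mu_rho /P natrM; have : #|C|%:R * (rho l)%:R <= #|S0|%:R :> R by rewrite -natrM ler_nat.
  move=> h; have : s%:R * mu * (#|C|%:R * (rho l)%:R) <= s%:R * mu * #|S0|%:R.
    by rewrite ler_wpM2l // mulr_ge0.
  by lra.
have Cn' : #|C|%:R <= n%:R :> R by rewrite ler_nat.
have ki0 : 0 <= k%:R^-1 :> R by rewrite invr_ge0.
have Ck : #|C|%:R `^ k%:R^-1 <= n%:R `^ k%:R^-1 :> R.
  by rewrite ge0_ler_powR ?nnegrE.
apply: le_trans h1 _; set m' := Num.min _ _.
have -> : level l * (2 * #|C|%:R `^ k%:R^-1 * #|C|%:R) =
  2 * ((level l * #|C|%:R) * #|C|%:R `^ k%:R^-1) by ring.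
have -> : 2 * P * n%:R `^ k%:R^-1 * m' = 2 * (P * (n%:R `^ k%:R^-1 * m')) by ring.
rewrite ler_wpM2l //.
have tP : level l * n%:R = P * t l by rewrite /t mulrCA divff ?mulr1 // gt_eqF.
have X0 : 0 <= level l * #|C|%:R by rewrite mulr_ge0 // ltW // level_gt0.
case: (leP (t l) 1) => t1.
- have q1 : q l <= 1.
    rewrite [leRHS](_ : 1 = 1 `^ 7%:R^-1); last by rewrite powR1.
    by rewrite ge0_ler_powR ?invr_ge0 ?nnegrE // ltW.
  have tq : t l <= q l.
    rewrite -{1}(powRr1 (ltW (t0 l))) /q; apply: ger_powR; first by rewrite t0.
    by rewrite invf_le1 // ler1n.
  have -> : m' = q l.
    by apply: min_l; apply: (le_trans q1); rewrite invf_ge1.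
  have -> : P * (n%:R `^ k%:R^-1 * q l) = (P * q l) * n%:R `^ k%:R^-1 by ring.
  apply: ler_pM => //.
  apply: le_trans (_ : level l * n%:R <= _).
    by rewrite ler_wpM2l // ltW // level_gt0.
  by rewrite tP ler_wpM2l // ltW.
- have -> : m' = (q l)^-1.
    have q1 : 1 <= q l.
      rewrite [leLHS](_ : 1 = 1 `^ 7%:R^-1); last by rewrite powR1.
      by rewrite ge0_ler_powR ?invr_ge0 ?nnegrE // ltW.
    have qi : (q l)^-1 <= 1 by rewrite invf_le1.
    by apply: min_r; exact: le_trans qi q1.
  apply: ler_pM => //.
  rewrite ler_pdivlMr //.
  have qt : q l <= t l `^ k%:R^-1.
    rewrite /q; apply: ler_powR; first exact: ltW.
    by rewrite lef_pV2 ?posrE ?ltr0n // ler_nat.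
  apply: le_trans (_ : #|C|%:R `^ k%:R^-1 * t l `^ k%:R^-1 <= _).
    by rewrite ler_wpM2l // powR_ge0.
  rewrite -powRM // ?(ltW (t0 l)) // ge0_ler_powR ?nnegrE //.
    by rewrite mulr_ge0 // ltW.
  rewrite /t mulrA ler_pdivrMr // mulrCA mulrA (mulrC n%:R) ler_wpM2r //.
Qed.

End Levels.

(** * All edges outside a spanning tree *)

Section Chords.
Variables (R : realType) (G : mgraph R) (T : {set edge G}) (x0 : vert G).
Variables (k s : nat) (eps del : R).
Hypotheses (k0 : (0 < k)%N) (s16 : 16 <= del * s%:R) (del0 : 0 < del) (del1 : 4 * del <= 1).
Hypothesis deps : 4 * del <= eps.
Hypothesis girthG : forall e c, reach (~: [set e]) (ends e).1 (ends e).2 c ->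
  (1 + eps) * (2 * k%:R - 1) * @wt R G e <= c.
Hypothesis spanT : forall e : edge G, connect (edge_rel T) (ends e).1 (ends e).2.

Let compw : R := \sum_(t in T | (ends t).1 \in comp_of T x0) wt t.
Let n := #|vert G|.

Lemma levels_bound (b : R) m : 0 < b ->
  \sum_(l < m) weight (level_edges T x0 s del b l) <=
  126 * n%:R `^ k%:R^-1 * (s%:R * (compw + b)).
Proof.
move=> b0; have cw0 : 0 <= compw by apply: sumr_ge0 => t _; exact: wt_ge0.
have n0 : (0 < n)%N := card_vert_gt0 x0.
have nk0 : 0 <= n%:R `^ k%:R^-1 :> R by exact: powR_ge0.
have P0 : 0 <= s%:R * (compw + b) by apply: mulr_ge0 => //; apply: addr_ge0 => //; exact: ltW.
have [k8|k7] := leqP 8 k.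
  have [d [nd dn]] := root_ceil R n0 k0.
  apply: le_trans (levels_potential x0 k0 s16 del0 del1 deps b0 girthG spanT m k8 nd) _.
  rewrite ler_wpM2r //; lra.
apply: le_trans (levels_static x0 k0 s16 del0 del1 deps b0 girthG spanT m k7) _.
by rewrite ler_wpM2r //; lra.
Qed.

(** The tree path between the ends of a chord is a detour, which girth makes at least as heavy as
    the chord. It bounds the smallest scale by the tree weight. *)
Lemma comp_weight_ge e : e \notin T -> (ends e).1 \in comp_of T x0 -> wt e <= compw.
Proof.
move=> eT eK; have /edge_connP[p /walk_simple[q [wq _ uq _ _]]] := spanT e.
have qT : {subset unzip1 q <= T} by move=> t; exact: walk_edges wq.
have h : (1 + eps) * (2 * k%:R - 1) * wt e <= walk_weight q.
  apply: girthG; exists q => //; apply: walk_sub (wq) => t tT.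
  by rewrite !inE; apply: contraNneq eT => <-.
have h1 : wt e <= (1 + eps) * (2 * k%:R - 1) * wt e.
  have kk : 1 <= k%:R :> R by rewrite ler1n.
  rewrite ler_peMl ?wt_ge0 //; apply: le_trans (_ : 1 * 1 <= _); first by rewrite mulr1.
  by apply: ler_pM => //; move: deps del0; lra.
apply: le_trans h1 (le_trans h _).
have E : walk_weight q = \sum_(t in [set t in unzip1 q]) wt t.
  rewrite /walk_weight -(big_map fst xpredT (@wt R G)) (perm_big (enum [set t in unzip1 q])).
    by rewrite big_enum.
  by apply: uniq_perm; rewrite ?enum_uniq // => t; rewrite mem_enum inE.
rewrite E /compw.
apply: le_trans (_ : \sum_(t in T | ((ends t).1 \in comp_of T x0) && (t \in [set t in unzip1 q])) wt t <= _).
  rewrite le_eqVlt; apply/orP; left; apply/eqP; apply: eq_bigl => t; rewrite !inE.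
  case tq: (t \in unzip1 q); rewrite ?andbF // andbT (qT t tq) /=; symmetry.
  have tm := walk_step_mem wq tq (joins_ends t).
  have [q' wq' [q0 Eq l0]] := walk_suffix wq tm.
  move: wq; rewrite Eq => /walk_catE[z w1 w2].
  move: eK; rewrite inE => eK; apply: connect_trans eK _; apply/edge_connP; exists q0.
  by rewrite l0 (walk_last w1).
rewrite big_mkcond [leRHS]big_mkcond; apply: ler_sum => t _.
by case: (t \in T) => //=; case: (_ \in comp_of T x0) => //=; case: ifP => // _; exact: wt_ge0.
Qed.

(** Windows of ratio [1 + del] spaced by [7 * s] miss most weights, so [mm] shifted families are
    used, enough to bridge one spacing. They start from the least positive weight [beta], so every
    base is at most [(1 + del) ^+ mm] times the tree weight; chords of weight zero contribute
    nothing. *)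
Lemma chords_bound mm : (7 * s)%:R <= (1 + del) ^+ mm ->
  \sum_(e | (e \notin T) && ((ends e).1 \in comp_of T x0)) wt e <=
  mm%:R * (126 * s%:R * (1 + (1 + del) ^+ mm)) * n%:R `^ k%:R^-1 * compw.
Proof.
move=> hmm; pose X := [set e | [&& e \notin T, (ends e).1 \in comp_of T x0 & 0 < wt e]].
have cw0 : 0 <= compw by apply: sumr_ge0 => t _; exact: wt_ge0.
have nk0 : 0 <= n%:R `^ k%:R^-1 :> R by exact: powR_ge0.
have D1 : 1 <= 1 + del by move: del0; lra.
have D0 i : 0 <= (1 + del) ^+ i by apply: exprn_ge0; apply: le_trans D1.
have -> : \sum_(e | (e \notin T) && ((ends e).1 \in comp_of T x0)) wt e = weight X.
  rewrite /weight big_mkcond [RHS]big_mkcond; apply: eq_bigr => e _; rewrite [e \in X]in_set.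
  case: (e \notin T) => //=; case: (_ \in comp_of T x0) => //=.
  by have := wt_ge0 e; rewrite le_eqVlt => /predU1P[<-|->]; rewrite ?ltxx.
have RHS0 : 0 <= mm%:R * (126 * s%:R * (1 + (1 + del) ^+ mm)) * n%:R `^ k%:R^-1 * compw.
  by repeat (apply: mulr_ge0 => //); apply: addr_ge0.
have [->|[e0 e0X]] := set_0Vmem X; first by rewrite /weight big_set0.
have [eb ebX ebm] := fin_min (P := fun e => e \in X) (fun e => @wt R G e) e0X.
pose beta := wt eb.
have [ebT ebK b0] : [/\ eb \notin T, (ends eb).1 \in comp_of T x0 & 0 < beta].
  by move: ebX; rewrite inE => /and3P[].
have bw : beta <= compw := comp_weight_ge ebT ebK.
have scale_ge64 : (64 <= s)%N := scale_ge64 s16 del1.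
have A1 : (1 < 7 * s)%N by clear -scale_ge64; lia.
have [m hm] : exists m : nat, weight X < beta * (7 * s)%:R ^+ m.+1.
  exists (Num.truncn (weight X / beta)); rewrite mulrC -ltr_pdivrMr //.
  apply: lt_le_trans (truncnS_gt _) _; rewrite -natrX ler_nat ltnW //.
  exact: ltn_expl.
have mm0 : (0 < mm)%N.
  by rewrite lt0n; apply: contraTneq hmm => ->; rewrite expr0 -ltNge ltr1n.
pose bb j := beta * (1 + del) ^+ j.+1.
have cover e : e \in X -> exists j : 'I_mm, exists l : 'I_m.+1, e \in level_edges T x0 s del (bb j) l.
  move=> eX; move: (eX); rewrite inE => /and3P[eT eK e_gt].
  have wb : beta <= wt e := ebm _ eX.
  have ex : exists l, wt e < beta * (7 * s)%:R ^+ l.+1.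
    by exists m; apply: le_lt_trans hm; rewrite (weightD1 eX) lerDl weight_ge0.
  have [l hl lmin] := ex_minnP ex.
  have lm : (l < m.+1)%N.
    by apply: lmin; apply: le_lt_trans hm; rewrite (weightD1 eX) lerDl weight_ge0.
  have hl0 : beta * (7 * s)%:R ^+ l <= wt e.
    case: l hl lmin {lm} => [|l] hl lmin; first by rewrite expr0 mulr1.
    by rewrite leNgt; apply/negP => /lmin; rewrite ltnn.
  have hj0 : wt e <= bb mm.-1 * (7 * s)%:R ^+ l.
    apply: le_trans (ltW hl) _; rewrite /bb prednK // exprS mulrA.
    by rewrite ler_wpM2r // ler_wpM2l // ltW.
  have ex2 : exists j, wt e <= bb j * (7 * s)%:R ^+ l by exists mm.-1.
  have [j hj jmin] := ex_minnP ex2.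
  have jm : (j < mm)%N by rewrite -(prednK mm0) ltnS; exact: jmin.
  exists (Ordinal jm), (Ordinal lm); rewrite inE /level /= eT eK natrX hj andbT /=.
  case: j hj jmin {jm} => [|j] hj jmin.
    by rewrite /bb expr1 (mulrC beta) -mulrA ler_wpM2l // (le_trans _ D1).
  have : ~~ (wt e <= bb j * (7 * s)%:R ^+ l) by apply/negP => /jmin; rewrite ltnn.
  rewrite -ltNge => /ltW h; rewrite {1}/bb exprS.
  have -> : beta * ((1 + del) * (1 + del) ^+ j.+1) * (7 * s)%:R ^+ l =
    (1 + del) * (bb j * (7 * s)%:R ^+ l) by rewrite /bb; ring.
  by rewrite ler_wpM2l // (le_trans _ D1).
apply: le_trans (_ : \sum_(j < mm) \sum_(l < m.+1) weight (level_edges T x0 s del (bb j) l) <= _).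
  rewrite /weight; under [leRHS]eq_bigr => j _ do
    (under eq_bigr => l _ do rewrite big_mkcond; rewrite exchange_big).
  rewrite exchange_big /= big_mkcond; apply: ler_sum => e _; case: ifP => [/cover[j [l eL]]|_].
    rewrite (bigD1 j) //= (bigD1 l) //= eL -addrA lerDl; apply: addr_ge0.
      by apply: sumr_ge0 => l' _; case: ifP => _ //; exact: wt_ge0.
    by apply: sumr_ge0 => j' _; apply: sumr_ge0 => l' _; case: ifP => _ //; exact: wt_ge0.
  by apply: sumr_ge0 => j' _; apply: sumr_ge0 => l' _; case: ifP => _ //; exact: wt_ge0.
apply: le_trans (_ : \sum_(j < mm) 126 * n%:R `^ k%:R^-1 * (s%:R * (compw + bb j)) <= _).
  apply: ler_sum => j _; apply: levels_bound.
  by rewrite mulr_gt0 // exprn_gt0 // (lt_le_trans _ D1).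
apply: le_trans (_ : \sum_(j < mm) 126 * n%:R `^ k%:R^-1 * (s%:R * (compw + (1 + del) ^+ mm * compw)) <= _).
  apply: ler_sum => j _; rewrite ler_wpM2l ?mulr_ge0 // ler_wpM2l //.
  rewrite lerD2l mulrC; apply: ler_pM => //; first exact: ltW.
  by apply: ler_weXn2l.
rewrite sumr_const card_ord -mulr_natl le_eqVlt; apply/orP; left; apply/eqP; ring.
Qed.

End Chords.

(** * The growth of lambda *)

Section GirthWeight.
Variable R : realType.

Lemma sum_chords (G : mgraph R) (T : {set edge G}) (c : R) : 0 <= c ->
  (forall x0, \sum_(e | (e \notin T) && ((ends e).1 \in comp_of T x0)) wt e <=
    c * \sum_(t in T | (ends t).1 \in comp_of T x0) wt t) ->
  weight (~: T) <= c * weight T.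
Proof.
move=> c0 h; pose r v := fingraph.root (edge_rel T) v.
have E (P : pred (edge G)) x0 : \sum_(e | P e && (r (ends e).1 == x0)) wt e =
    if r x0 == x0 then \sum_(e | P e && ((ends e).1 \in comp_of T x0)) wt e else 0.
  case: eqP => [rx|rx].
    apply: eq_bigl => e; rewrite inE edge_connC -(root_connect (edge_connC _)).
    by rewrite -/(r x0) rx.
  apply: big_pred0 => e; apply/negP => /andP[_ /eqP re]; apply: rx.
  by rewrite -re /r root_root //; exact: edge_connC.
rewrite /weight (partition_big (fun e => r (ends e).1) xpredT) //=.
rewrite [in leRHS](partition_big (fun e => r (ends e).1) xpredT) //= mulr_sumr.
apply: ler_sum => x0 _; rewrite E (E (mem T)); case: eqP => _; last by rewrite mulr0.
apply: le_trans (h x0); rewrite le_eqVlt; apply/orP; left; apply/eqP.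
by apply: eq_bigl => e; rewrite inE.
Qed.

Lemma girth_weight (eps : R) : 0 < eps -> exists2 C : R, 0 <= C &
  forall (k : nat) (G : mgraph R) (T : {set edge G}), (0 < k)%N -> (0 < #|vert G|)%N ->
  (forall e c, reach (~: [set e]) (ends e).1 (ends e).2 c ->
     (1 + eps) * (2 * k%:R - 1) * @wt R G e <= c) ->
  (forall e : edge G, connect (edge_rel T) (ends e).1 (ends e).2) ->
  weight [set: edge G]%SET <= C * #|vert G|%:R `^ k%:R^-1 * weight T.
Proof.
(* [del], [s] and [mm] are chosen from [eps] alone, so the constant is uniform in [k] and in the
   graph. *)
move=> eps0; pose del : R := Num.min eps 1 / 4.
have del0 : 0 < del by rewrite divr_gt0 // lt_min eps0 ltr01.
have dm : 4 * del = Num.min eps 1 by rewrite mulrC divfK.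
have del1 : 4 * del <= 1 by rewrite dm ge_min lexx orbT.
have deps : 4 * del <= eps by rewrite dm ge_min lexx.
have ceil (x : R) : exists m : nat, x <= del * m%:R.
  exists (Num.truncn (x / del)).+1; rewrite mulrC -ler_pdivrMr //.
  exact/ltW/truncnS_gt.
have [s hs] := ceil 16.
have [mm hm] : exists mm : nat, (7 * s)%:R <= (1 + del) ^+ mm.
  have [mm hm] := ceil (7 * s)%:R; exists mm; apply: le_trans hm _.
  elim: mm => [|mm IHm]; first by rewrite mulr0 expr0.
  have : 1 <= (1 + del) ^+ mm by apply: exprn_ege1; rewrite lerDl ltW.
  rewrite -natr1 exprS => h1.
  have : del * 1 <= del * (1 + del) ^+ mm by rewrite ler_wpM2l // ltW.
  by move: IHm; lra.
pose c : R := mm%:R * (126 * s%:R * (1 + (1 + del) ^+ mm)).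
have c0 : 0 <= c.
  repeat (apply: mulr_ge0 => //); apply: addr_ge0 => //; apply: exprn_ge0.
  by apply: addr_ge0 => //; exact: ltW.
exists (1 + c); first exact: addr_ge0.
move=> k G T k0 n0 girthG spanT; set nk := #|vert G|%:R `^ k%:R^-1.
have nk1 : 1 <= nk.
  by rewrite -[leLHS](powRr0 (#|vert G|%:R : R)) ler_powR ?ler1n ?invr_ge0.
have h : weight (~: T) <= c * nk * weight T.
  apply: sum_chords; first by apply: mulr_ge0 => //; apply: le_trans nk1.
  by move=> x0; exact: (chords_bound x0 k0 hs del0 del1 deps girthG spanT hm).
have -> : weight [set: edge G]%SET = weight T + weight (~: T).
  by rewrite /weight (big_setID T) /= finset.setTI finset.setTD.
have : weight T * 1 <= weight T * nk by rewrite ler_wpM2l // weight_ge0.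
by move: h; lra.
Qed.

(* With stretch t a cycle closed by a rejected edge has normalized weight
   above t + 1, and (1 + eps)(2k - 1) + 1 = (1 + eps) 2k - eps. *)
Lemma girth_reach (eps : R) k (G : mgraph R) : 0 < eps -> (0 < k)%N ->
  (((1 + eps) * (2 * k%:R) - eps)%:E < weighted_girth G)%E ->
  forall e c, reach (~: [set e]) (ends e).1 (ends e).2 c ->
     (1 + eps) * (2 * k%:R - 1) * @wt R G e <= c.
Proof.
move=> eps0 k0 hg e c [p wp wc]; apply: le_trans wc.
have kk : 1 <= k%:R :> R by rewrite ler1n.
have g1 : 1 <= (1 + eps) * (2 * k%:R) - eps.
  have : (1 + eps) * 2 <= (1 + eps) * (2 * k%:R) by rewrite ler_wpM2l //; lra.
  lra.
have ej : joins e (ends e).2 (ends e).1 by rewrite joinsC joins_ends.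
have := girth_walk g1 hg ej wp.
by lra.
Qed.

Lemma lightness_bound (eps : R) : 0 < eps -> exists2 C : R, 0 < C &
  forall (k : nat) (G : mgraph R), (0 < k)%N -> (0 < #|vert G|)%N ->
  (((1 + eps) * (2 * k%:R) - eps)%:E < weighted_girth G)%E ->
  (lightness [set: edge G]%SET <= (C * #|vert G|%:R `^ k%:R^-1)%:E)%E.
Proof.
move=> eps0; have [C C0 hC] := girth_weight eps0.
exists (1 + C) => [|k G k0 n0 hg]; first by lra.
have [T [[_ cT _] _ Tw]] := mst_exists [set: edge G]%SET.
have nk1 : 1 <= #|vert G|%:R `^ k%:R^-1 :> R.
  by rewrite -[leLHS](powRr0 (#|vert G|%:R : R)) ler_powR ?ler1n ?invr_ge0.
rewrite /lightness Tw; apply: weight_ratio_le; rewrite ?weight_ge0 //.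
  apply: le_trans (_ : 1 * 1 <= _); first by rewrite mulr1.
  by apply: ler_pM => //; rewrite lerDl.
apply: le_trans (hC k G T k0 n0 (girth_reach eps0 k0 hg) _) _.
  move=> e; move/eqP/components_eqP: cT => ->.
  by apply: edge_conn1 (joins_ends e); rewrite inE.
rewrite -!mulrA ler_wpM2r //; last by lra.
by apply: mulr_ge0; rewrite ?weight_ge0 // (le_trans _ nk1).
Qed.

Lemma lambda_bound (eps : R) : 0 < eps -> exists2 C : R, 0 < C &
  forall k n : nat, (0 < k)%N -> (0 < n)%N ->
  (lambda n ((1 + eps) * (2 * k%:R) - eps)%R <= (C * n%:R `^ k%:R^-1)%:E)%E.
Proof.
move=> eps0; have [C C0 hC] := lightness_bound eps0; exists C => // k n k0 n0.
by apply: ge_ereal_sup => _ [G [nG hg ->]]; rewrite -nG; apply: hC; rewrite ?nG.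
Qed.

End GirthWeight.

(** * Lower bound *)

Section ComponentCount.
Variables (R : realType) (G : mgraph R).
Implicit Types (S F Z : {set edge G}).

Definition block S (x : vert G) : {set vert G} := [set y | connect (edge_rel S) x y].

Lemma componentsE S : components S = [set block S x | x in [set: vert G]].
Proof.
by rewrite /components /equivalence_partition; apply: eq_imset => x; apply/setP => y; rewrite !inE.
Qed.

Lemma block_mem S x : x \in block S x.
Proof. by rewrite inE connect0. Qed.

Lemma block_eq S x y : (block S x == block S y) = connect (edge_rel S) x y.
Proof.
apply/eqP/idP => [E|xy]; first by have := block_mem S y; rewrite -E inE.
by apply/setP => z; rewrite !inE (same_connect (edge_connC S) xy).
Qed.

Lemma block_components S x : block S x \in components S.
Proof. by rewrite componentsE imset_f. Qed.

Lemma componentsP S X : reflect (exists x, X = block S x) (X \in components S).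
Proof.
rewrite componentsE; apply: (iffP imsetP) => [[x _ ->]|[x ->]]; first by exists x.
by exists x.
Qed.

Lemma card_components_add Z f : ~~ connect (edge_rel Z) (ends f).1 (ends f).2 ->
  (#|components (f |: Z)| < #|components Z|)%N.
Proof.
move=> nf; set Z' := f |: Z.
pose phi (X : {set vert G}) := if [pick x in X] is Some x then block Z' x else finset.set0.
have phiE x : phi (block Z x) = block Z' x.
  rewrite /phi; case: pickP => [y|/(_ x)]; last by rewrite block_mem.
  rewrite inE => xy; apply/eqP; rewrite block_eq edge_connC.
  by apply: edge_conn_sub xy => e eZ; rewrite !inE eZ orbT.
have E : components Z' = phi @: components Z.
  rewrite !componentsE -imset_comp; apply: eq_imset => x /=; by rewrite phiE.
rewrite E ltn_neqAle leq_imset_card andbT; apply/imset_injP => inj.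
move: nf; rewrite -block_eq => /eqP; apply; apply: inj; rewrite ?block_components //.
rewrite !phiE; apply/eqP; rewrite block_eq.
by apply: edge_conn1 (joins_ends f); rewrite !inE eqxx.
Qed.

(** Every edge of [F] is a bridge of [Z :|: F], so adding them one by one merges two components each
    time. *)
Lemma card_components_free Z F :
  (forall f, f \in F -> ~~ connect (edge_rel (Z :|: F :\ f)) (ends f).1 (ends f).2) ->
  (#|F| + #|components (Z :|: F)| <= #|components Z|)%N.
Proof.
have [n] := ubnP #|F|; elim: n F => // n IHn F Fn hF.
have [->|[f fF]] := set_0Vmem F; first by rewrite cards0 finset.setU0.
have h : (#|F :\ f| + #|components (Z :|: F :\ f)| <= #|components Z|)%N.
  apply: IHn => [|g /finset.setD1P[gf gF]].
    by move: Fn; rewrite (cardsD1 f) fF.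
  apply: contra (hF _ gF); apply: edge_conn_sub => e; rewrite !inE.
  by case/orP=> [->//|/and3P[-> _ ->]]; rewrite orbT.
apply: leq_trans h; rewrite [#|F|](cardsD1 f) fF add1n addSnnS leq_add2l.
rewrite -[F in components (_ :|: F)](finset.setD1K fF) finset.setUCA.
exact: card_components_add (hF _ fF).
Qed.

Lemma card_components_le S : (#|components S| <= #|vert G|)%N.
Proof. by rewrite componentsE -[#|vert G|]cardsT leq_imset_card. Qed.

Lemma card_acyclic F : (forall x p, ~~ is_cycle F x p) -> (#|F| <= #|vert G|)%N.
Proof.
move=> aF; apply: leq_trans (card_components_le finset.set0).
apply: leq_trans (leq_addr _ _) (card_components_free _) => f fF.
by rewrite finset.set0U; exact: acyclic_bridge.
Qed.

End ComponentCount.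

Section CompetitiveMin.
Variables (R : realType) (G : mgraph R).

Lemma preserver_min (f : nat) : exists Q : {set edge G},
  [/\ eft_connectivity_preserver f Q,
      (forall Q' : {set edge G}, eft_connectivity_preserver f Q' -> weight Q <= weight Q') &
      forall H : {set edge G}, competitive_lightness f H =
        weight_ratio (weight H)%:E (weight Q)%:E].
Proof.
have h0 : eft_connectivity_preserver f [set: edge G]%SET by [].
have [Q hQ minQ] := fin_min (fun Q : {set edge G} => weight Q) h0.
exists Q; split=> // H; rewrite /competitive_lightness.
by rewrite (ereal_inf_min hQ minQ).
Qed.

End CompetitiveMin.

(** For [b = 0] either the right side is infinite, or [a = 0] forces [a' = 0]; then the right side
    is 1 and the left at most [c <= 1]. *)
Lemma weight_ratio_scale (R : realType) (a b a' b' c M : R) :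
  0 <= a -> 0 <= b -> 0 <= a' -> 0 <= b' -> 0 < c -> c <= 1 -> 0 < M ->
  b <= M * b' -> c * M * a' <= a ->
  (c%:E * weight_ratio a'%:E b'%:E <= weight_ratio a%:E b%:E)%E.
Proof.
move=> a0 b0 a'0 b'0 c0 c1 M0 bb aa.
have cM : 0 < c * M by rewrite mulr_gt0.
rewrite !weight_ratioE; have [bz|bz] := eqVneq b 0.
  have [az|az] := eqVneq a 0; last first.
    by rewrite [(a%:E * _)%E]gt0_muley ?leey // lte_fin lt0r az.
  have -> : a' = 0.
    apply/eqP; rewrite eq_le a'0 andbT -(ler_pM2l cM) mulr0; apply: le_trans aa _.
    by rewrite az.
  rewrite eqxx mul0r; case: eqP => _; rewrite -EFinM lee_fin ?mulr1 ?mulr0 //.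
have b_gt : 0 < b by rewrite lt0r bz.
have b'_gt : 0 < b'.
  by rewrite -(pmulr_rgt0 _ M0); apply: lt_le_trans bb.
rewrite gt_eqF // -EFinM lee_fin mulrA ler_pdivrMr // mulrAC ler_pdivlMr //.
apply: le_trans (_ : c * a' * (M * b') <= _); first by rewrite ler_wpM2l // mulr_ge0 // ltW.
rewrite mulrA; apply: ler_wpM2r => //; by apply: le_trans aa; rewrite mulrAC.
Qed.

(** * Parallel copies of a graph *)

Section Copies.
Variables (R : realType) (Gam : mgraph R) (m' N : nat).

(** Copies of an edge share their ends; the [m'] isolated vertices only adjust the number of
    vertices. *)
Definition copies : mgraph R := @MGraph R (vert Gam + 'I_m')%type
  (edge Gam * 'I_N)%type (fun x => (inl (ends x.1).1, inl (ends x.1).2))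
  (fun x => wt x.1) (fun x => wt_ge0 x.1).

Lemma copies_card : #|vert copies| = (#|vert Gam| + m')%N.
Proof. by rewrite card_sum card_ord. Qed.

Definition all_copies (T : {set edge Gam}) : {set edge copies} := [set x | x.1 \in T].

Lemma weight_copies (H : {set edge copies}) :
  weight H = \sum_(e : edge Gam) #|[set i | ((e, i) : edge copies) \in H]|%:R * wt e.
Proof.
rewrite /weight big_mkcond /=.
rewrite (eq_bigr (fun x : edge Gam * 'I_N => if ((x.1, x.2) : edge copies) \in H then wt x.1 else 0)); last by case.
rewrite -(pair_bigA _ (fun e i => if ((e, i) : edge copies) \in H then wt e else 0)) /=.
apply: eq_bigr => e _; rewrite -big_mkcond /= mulr_natl -sumr_const.
by apply: eq_bigl => i; rewrite inE.
Qed.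

Lemma weight_all_copies (T : {set edge Gam}) : weight (all_copies T) = N%:R * weight T.
Proof.
rewrite weight_copies /weight mulr_sumr [RHS]big_mkcond; apply: eq_bigr => e _.
case: ifP => eT.
  by rewrite (_ : [set i | _] = setT) ?cardsT ?card_ord //; apply/setP => i; rewrite !inE.
by rewrite (_ : [set i | _] = finset.set0) ?cards0 ?mul0r //; apply/setP => i; rewrite !inE.
Qed.

Lemma copies_connect (F : {set edge copies}) (T : {set edge Gam}) a b :
  (#|F| < N)%N -> connect (edge_rel T) a b ->
  connect (edge_rel (all_copies T :\: F)) (inl a) (inl b).
Proof.
move=> FN /edge_connP[p]; elim: p a => [|[e v] p IHp] a /=.
  by move/eqP->; exact: connect0.
case/and3P=> eT ej /IHp; apply: connect_trans.
have [i hi] : exists i : 'I_N, ((e, i) : edge copies) \notin F.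
  apply/existsP; apply: contraLR FN; rewrite negb_exists -leqNgt => /forallP h.
  have inj : injective (fun i : 'I_N => ((e, i) : edge copies)) by move=> i j [].
  rewrite -[leqLHS]card_ord -(card_imset _ inj); apply: subset_leq_card.
  by apply/subsetP => x /imsetP[i _ ->]; have := h i; rewrite negbK.
apply: (@edge_conn1 R copies _ (e, i)); first by rewrite in_setD hi inE.
by case/orP: ej => /eqP E; rewrite /joins /= E eqxx ?orbT.
Qed.

Lemma copies_preserver (f : nat) (T : {set edge Gam}) : (f < N)%N ->
  (forall e : edge Gam, connect (edge_rel T) (ends e).1 (ends e).2) ->
  eft_connectivity_preserver f (all_copies T).
Proof.
move=> fN hT F Ff; apply/eqP/components_eqP => x y; apply/idP/idP.
  by apply: edge_conn_sub => e; rewrite !in_setD => /andP[->] _; rewrite inE.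
apply: edge_conn_repl => -[e i] _; apply: copies_connect; last exact: hT.
exact: leq_ltn_trans fN.
Qed.

Lemma copies_walk (H : {set edge copies}) x p y : walk H x p y -> forall a b,
  x = inl a -> y = inl b -> exists q, [/\ @walk R Gam [set x.1 | x in H] a q b &
    walk_weight q = walk_weight p].
Proof.
elim: p x => [|[e v] p IHp] x /=.
  by move=> /eqP <- a b -> [->]; exists [::]; rewrite /= eqxx !walk_weight_nil.
case/and3P=> eH ej wp a b xa yb.
have [c vc] : exists c, v = inl c.
  by case/orP: ej => /eqP[E1 E2]; eexists; rewrite -?E1 -?E2; reflexivity.
have [q [wq ww]] := IHp _ wp _ _ vc yb.
exists ((e.1, c) :: q); split; last by rewrite !walk_weight_cons ww.
rewrite /= wq andbT; apply/andP; split; first by apply: imset_f.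
move: ej; rewrite xa vc /joins /= => /orP[] /eqP[<- <-]; rewrite -surjective_pairing eqxx ?orbT //.
Qed.

End Copies.

Section LowerBound.
Variable R : realType.

(** Were at most [f] copies kept, they could all fail: another copy still gives distance [wt e] in
    the graph, whereas a walk left in [H] projects to a detour around [e], heavier than
    [(g - 1) * wt e]. *)
Lemma spanner_copies (Gam : mgraph R) (m' f : nat) (t g : R)
    (H : {set edge (copies Gam m' (2 * f).+1)}) :
  0 <= t -> t + 1 < g -> (g%:E < weighted_girth Gam)%E -> eft_spanner f t H ->
  forall e : edge Gam, 0 < wt e ->
  (f < #|[set i | ((e, i) : edge (copies Gam m' (2 * f).+1)) \in H]|)%N.
Proof.
move=> t0 tg hg spH e we; rewrite ltnNge; apply/negP => le_f.
set C := copies _ _ _ in H spH le_f; set I0 := [set i | _] in le_f.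
pose F : {set edge C} := [set ((e, i) : edge C) | i in I0].
have Ff : (#|F| <= f)%N by apply: leq_trans (leq_imset_card _ _) le_f.
have [i0 hi0] : exists i0, i0 \notin I0.
  apply/existsP; apply: contraLR le_f; rewrite negb_exists -ltnNge => /forallP h.
  rewrite (_ : I0 = setT) ?cardsT ?card_ord; first by clear; lia.
  by apply/setP => i; rewrite in_setT; have := h i; rewrite negbK.
have e0F : ((e, i0) : edge C) \notin F.
  by apply/imsetP => -[i iI [E]]; move: hi0; rewrite E iI.
pose a := (ends e).1; pose b := (ends e).2.
have /= := spH F Ff (inl a) (inl b).
apply/negP; rewrite -ltNge.
have dG : (dist ([set: edge C]%SET :\: F) (inl a) (inl b) <= (wt e)%:E)%E.
  apply: ereal_inf_lbound; exists [:: ((e, i0) : edge C, inl b : vert C)].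
    by rewrite /= in_setD e0F inE /joins /= !eqxx.
  by rewrite walk_weight_cons walk_weight_nil addr0.
have dH : (((g - 1) * wt e)%:E <= dist (H :\: F) (inl a) (inl b))%E.
  apply: le_ereal_inf_tmp => _ [p /= wp <-]; rewrite lee_fin.
  have [q [wq <-]] := copies_walk wp (erefl (inl a)) (erefl (inl b)).
  have wq' : walk (~: [set e]) a q b.
    apply: walk_sub wq => x /imsetP[[x1 i] xH ->]; rewrite in_setC in_set1 /=.
    apply: contraTneq xH => ->; rewrite in_setD negb_and negbK.
    have [iI|] := boolP (i \in I0); first by apply/orP; left; apply: imset_f.
    by rewrite inE => ->; rewrite orbT.
  have ej : joins e b a by rewrite joinsC joins_ends.
  have g1 : 1 <= g by move: t0 tg; lra.
  by have := girth_walk g1 hg ej wq'; lra.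
apply: lt_le_trans dH; apply: le_lt_trans (_ : (t * wt e)%:E < _)%E.
  by rewrite EFinM lee_wpmul2l // lee_fin.
by rewrite lte_fin ltr_pM2r //; lra.
Qed.

(** [f.+1] of the [2 * f + 1] copies are more than half of them, hence the constant. *)
Lemma lower_bound_graph (Gam : mgraph R) (m' f : nat) (t g : R) :
  0 <= t -> t + 1 < g -> (g%:E < weighted_girth Gam)%E ->
  forall H : {set edge (copies Gam m' (2 * f).+1)}, eft_spanner f t H ->
  ((2^-1)%:E * lightness [set: edge Gam]%SET <= competitive_lightness (2 * f)%N H)%E.
Proof.
move=> t0 tg hg H spH.
have [Q [hQ minQ ->]] := preserver_min (copies Gam m' (2 * f).+1) (2 * f).
have [T [[_ cT _] _ Tw]] := mst_exists [set: edge Gam]%SET.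
rewrite /lightness Tw; apply: (@weight_ratio_scale _ _ _ _ _ _ (2 * f).+1%:R);
  rewrite ?weight_ge0 ?invr_gt0 ?ltr0n //.
- by rewrite invf_le1 ?ltr0n // ler1n.
- rewrite -(@weight_all_copies R Gam m' (2 * f).+1); apply: minQ.
  apply: copies_preserver => // e; move/eqP/components_eqP: cT => ->.
  by apply: edge_conn1 (joins_ends e); rewrite inE.
rewrite weight_copies /weight mulr_sumr big_mkcond; apply: ler_sum => e _.
rewrite inE; have := wt_ge0 e; rewrite le_eqVlt => /predU1P[<-|we].
  by rewrite !mulr0.
apply: ler_wpM2r; first exact: ltW.
have := spanner_copies t0 tg hg spH we; rewrite -(ler_nat R) -natr1 => h.
by rewrite mulrC ler_pdivrMr ?ltr0n // -natr1 natrM; lra.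
Qed.

Definition edgeless (m : nat) : mgraph R :=
  @MGraph R 'I_m void (fun e => match e with end) (fun=> 0) (fun=> lexx 0).

Lemma edgeless_girth m : weighted_girth (edgeless m) = +oo%E.
Proof.
rewrite /weighted_girth (_ : [set _ | _ in _]%classic = classical_sets.set0) ?ereal_inf0 //.
by apply/seteqP; split=> // _ [[|[[] _] p] [x] //].
Qed.

Lemma lightness_empty (G : mgraph R) : weight [set: edge G]%SET = 0 ->
  lightness [set: edge G]%SET = 1%E.
Proof.
move=> w0; have [T [[sT _ _] _ Tw]] := mst_exists [set: edge G]%SET.
have wT : weight T = 0.
  by apply/eqP; rewrite eq_le weight_ge0 andbT -w0 weight_sub.
by rewrite /lightness Tw w0 wT /weight_ratio eqxx.
Qed.

Lemma lambda_ge1 m (t : R) : (1 <= lambda m t)%E.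
Proof.
apply: ereal_sup_ubound; exists (edgeless m); split.
- by rewrite card_ord.
- by rewrite edgeless_girth ltey.
- by rewrite lightness_empty // /weight big_pred0 // => -[].
Qed.

(** The supremum need not be attained, but it is at least 1, and finite by the growth bound, so some
    graph reaches half of it. *)
Lemma lambda_half_attained m k (eps : R) : (0 < k)%N -> 0 < eps ->
  exists Gam : mgraph R, [/\ #|vert Gam| = m,
    (((1 + eps) * (2 * k%:R))%:E < weighted_girth Gam)%E &
    ((2^-1)%:E * lambda m ((1 + eps) * (2 * k%:R))%R <= lightness [set: edge Gam]%SET)%E].
Proof.
move=> k0 eps0; set t := (1 + eps) * (2 * k%:R).
have [B hB] : exists B : R, (lambda m t <= B%:E)%E.
  have [m0|m0] := posnP m.
    exists 1; apply: ge_ereal_sup => _ [G [nG _ ->]].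
    rewrite lightness_empty // /weight big_pred0 // => e.
    have : (0 < #|vert G|)%N by apply/card_gt0P; exists (ends e).1.
    by rewrite nG m0.
  have [C _ hC] := lambda_bound eps0; exists (C * m%:R `^ k%:R^-1).
  apply: le_trans (hC k m k0 m0); apply: le_ereal_sup => _ [G [nG hg ->]].
  exists G; split=> //; apply: le_lt_trans hg; rewrite lee_fin /t; lra.
have l1 : (1 <= lambda m t)%E := lambda_ge1 m t.
have [l El] : exists l : R, lambda m t = l%:E.
  by move: l1 hB; case: (lambda m t) => [l _ _|//|//]; exists l.
move: l1; rewrite El lee_fin => l1; rewrite -EFinM.
have : exists2 x, [set l | exists G : mgraph R, [/\ #|vert G| = m, (t%:E < weighted_girth G)%E
      & l = lightness [set: edge G]%SET]]%classic x & ((2^-1 * l)%:E < x)%E.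
  apply: ereal_sup_gt; rewrite -/(lambda m t) El lte_fin; lra.
by case=> _ [G [nG hg ->]] /ltW h; exists G.
Qed.

Lemma lower_bound f k n (eps : R) : (0 < f)%N -> (0 < k)%N -> 0 < eps ->
  exists G : mgraph R, #|vert G| = n /\
  forall H : {set edge G}, eft_spanner f ((1 + eps) * (2 * k%:R - 1)) H ->
  ((4^-1)%:E * lambda (Num.truncn (n%:R / Num.sqrt (2 * f%:R) : R)) ((1 + eps) * (2 * k%:R))%R
    <= competitive_lightness (2 * f)%N H)%E.
Proof.
move=> f0 k0 eps0; set m := Num.truncn _.
have mn : (m <= n)%N.
  rewrite -(ler_nat R); apply: le_trans (_ : n%:R / Num.sqrt (2 * f%:R) <= _).
    by rewrite truncn_le divr_ge0 // sqrtr_ge0.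
  have s1 : 1 <= Num.sqrt (2 * f%:R) :> R.
    rewrite -[leLHS]sqrtr1 ler_sqrt ?mulr_ge0 //.
    have : 1 <= f%:R :> R by rewrite ler1n.
    by lra.
  by rewrite ler_pdivrMr ?(lt_le_trans _ s1) // ler_peMr.
have [Gam [nG hg hl]] := lambda_half_attained m k0 eps0.
exists (copies Gam (n - m)%N (2 * f).+1); split=> [|H spH].
  by rewrite copies_card nG subnKC.
have kk : 1 <= k%:R :> R by rewrite ler1n.
have t0 : 0 <= (1 + eps) * (2 * k%:R - 1) by apply: mulr_ge0; lra.
have tg : (1 + eps) * (2 * k%:R - 1) + 1 < (1 + eps) * (2 * k%:R) by lra.
apply: le_trans (lower_bound_graph t0 tg hg spH).
(* One half is lost to the supremum, the other to the copies. *)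
rewrite (_ : 4^-1 = 2^-1 * 2^-1); last by lra.
by rewrite EFinM -muleA lee_wpmul2l // lee_fin invr_ge0.
Qed.

End LowerBound.

(** * Bipartite subgraphs and the girth conjecture *)

Section MaxCut.

(* Averaging over all two-colourings: flipping the colour of one end of an
   edge matches the colourings that cut it with those that do not. *)
Lemma max_cut (V : finType) (E : {set V * V}) : (forall p, p \in E -> p.1 != p.2) ->
  exists chi : {ffun V -> bool}, (#|E| <= 2 * #|[set p in E | chi p.1 != chi p.2]|)%N.
Proof.
move=> irr; apply/existsP; apply: contraT; rewrite negb_exists => /forallP h.
pose cut (p : V * V) : {set {ffun V -> bool}} := [set chi : {ffun V -> bool} | chi p.1 != chi p.2].
have half p : p \in E -> (#|{ffun V -> bool}| <= 2 * #|cut p|)%N.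
  move=> /irr ne; pose flip (chi : {ffun V -> bool}) : {ffun V -> bool} :=
    [ffun v => if v == p.1 then ~~ chi v else chi v].
  have flipK : involutive flip.
    by move=> chi; apply/ffunP => v; rewrite !ffunE; case: eqP => // _; rewrite negbK.
  have sub : (#|~: cut p| <= #|cut p|)%N.
    rewrite -(card_imset _ (inv_inj flipK)); apply/subset_leq_card/subsetP => _ /imsetP[chi + ->].
    rewrite in_setC inE negbK => /eqP E'; rewrite inE !ffunE eqxx eq_sym (eq_sym p.2).
    by rewrite (negPf ne) E'; case: (chi p.2).
  have := cardsID (cut p) [set: {ffun V -> bool}]; rewrite finset.setTI finset.setTD cardsT => <-.
  by rewrite mul2n -addnn leq_add2l.
have : (\sum_(p in E) #|{ffun V -> bool}| <= \sum_(p in E) 2 * #|cut p|)%N by exact: leq_sum.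
rewrite sum_nat_const -big_distrr /=.
have -> : (\sum_(p in E) #|cut p| =
    \sum_(chi : {ffun V -> bool}) #|[set p in E | chi p.1 != chi p.2]|)%N.
  rewrite [RHS](eq_bigl (fun chi => chi \in [set: {ffun V -> bool}])) => [|chi]; last by rewrite inE.
  rewrite -double_count; apply: eq_bigr => p _; congr #|pred_of_set _|.
  by apply/setP => chi; rewrite !inE.
rewrite big_distrr /= => le.
have : (\sum_(chi : {ffun V -> bool}) (2 * #|[set p in E | chi p.1 != chi p.2]|).+1 <=
        \sum_(chi : {ffun V -> bool}) #|E|)%N.
  by apply: leq_sum => chi _; have := h chi; rewrite -ltnNge.
have E1 : (\sum_(chi : {ffun V -> bool}) (2 * #|[set p in E | chi p.1 != chi p.2]|).+1 =
  \sum_(chi : {ffun V -> bool}) (2 * #|[set p in E | chi p.1 != chi p.2]|) + #|{ffun V -> bool}|)%N.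
  by under eq_bigr do rewrite -addn1; rewrite big_split /= sum1_card.
have c0 : (0 < #|{ffun V -> bool}|)%N by apply/card_gt0P; exists [ffun=> true].
rewrite sum_nat_const E1 mulnC => le2; move: (leq_trans le2 le).
by rewrite -[leqRHS]addn0 leq_add2l leqn0; case: #|_| c0.
Qed.

End MaxCut.

Section BipartiteGraph.
Variables (R : realType) (m k : nat) (a : rel 'I_m) (chi : {ffun 'I_m -> bool}).
Hypothesis sym : symmetric a.
Hypothesis girth : forall c : seq 'I_m, cycle a c -> uniq c -> (2 < size c)%N -> (2 * k < size c)%N.

(** Keeping only edges between the two colours makes all cycles even, so girth above [2 * k] becomes
    at least [2 * k + 2], which leaves room for every [eps < 1 / k]. *)
Definition cut_edge (p : 'I_m * 'I_m) := [&& (p.1 < p.2)%N, a p.1 p.2 & chi p.1 != chi p.2].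

Definition cut_graph : mgraph R := @MGraph R 'I_m {p : 'I_m * 'I_m | cut_edge p}
  val (fun=> 1) (fun=> ler01).

Lemma cut_joins (e : edge cut_graph) x y : joins e x y ->
  [/\ a x y, chi x != chi y & x != y].
Proof.
case: e => -[u v] /= ce; have /and3P[/= lt ae ne] := ce.
have uv : u != v by apply: contraTneq lt => ->; rewrite ltnn.
by rewrite /joins /= => /orP[] /eqP[<- <-]; split; rewrite // 1?sym // eq_sym.
Qed.

Lemma cut_joins_inj (e e' : edge cut_graph) x y : joins e x y -> joins e' x y -> e = e'.
Proof.
move=> h h'; apply: val_inj; case: e h => -[u v] ce /=; have /and3P[/= luv _ _] := ce.
case: e' h' => -[u' v'] ce' /=; have /and3P[/= luv' _ _] := ce'; rewrite /joins /=.
by do 2! case/orP=> /eqP[? ?]; subst=> //; move: (ltn_trans luv luv'); rewrite ltnn.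
Qed.

Lemma cut_walk x p y : @walk R cut_graph [set: edge cut_graph]%SET x p y ->
  path a x (unzip2 p) /\ chi y = chi x (+) odd (size p).
Proof.
elim: p x => [|[e v] p IHp] x /=; first by move/eqP->; rewrite addbF.
case/and3P=> _ /cut_joins[-> ne _] /IHp[-> ->]; split=> //.
by move: ne; case: (chi x); case: (chi v); case: (odd _).
Qed.

Lemma cut_cycle x p : @is_cycle R cut_graph [set: edge cut_graph]%SET x p ->
  ((2 * k).+2 <= size p)%N.
Proof.
case/and4P=> s0 wp u1 u2; have [pp cp] := cut_walk wp.
have ev : ~~ odd (size p) by move: cp; case: (chi x); case: (odd _).
(* Odd sizes are excluded, and a cycle of size 2 would repeat the only edge between its two
   vertices. *)
have sz2 : (2 < size p)%N.
  case: p s0 wp u1 {u2 pp cp} ev => // -[e v] [//|[e' v'] [|//]] _ /=.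
  case/and3P=> _ h1 /and3P[_ h2 /eqP h3]; rewrite inE andbT => ne _.
  by move: h2 ne; rewrite h3 joinsC => /(cut_joins_inj h1)->; rewrite eqxx.
have lx := walk_last wp; move: u2 pp lx sz2; rewrite -[size p](size_map snd) -/unzip2 => u2.
case/lastP E: (unzip2 p) u2 => [//|c z]; rewrite last_rcons => u2 pp zx; subst z.
move: u2; rewrite size_rcons rcons_uniq => /andP[xc uc] sz2.
have := girth (c := x :: c) pp; rewrite /= xc uc => /(_ isT sz2) h.
move: ev; rewrite -(size_map snd) -/(unzip2 p) E size_rcons; move: h; rewrite leq_eqVlt => /predU1P[<-|//].
by rewrite /= mul2n odd_double.
Qed.

Lemma cut_girth (t : R) : 1 <= t -> t < (2 * k).+2%:R -> (t%:E < weighted_girth cut_graph)%E.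
Proof.
move=> t1 tk; apply: girth_gt => x p cp.
have t0 : 0 <= t by apply: le_trans t1.
have max0 : 0 <= \big[Num.max/0]_(s <- p) @wt R cut_graph s.1.
  by elim/big_ind: _ => // u v u0 v0; rewrite le_max u0.
rewrite /normalized_weight weight_ratio_gtE // ?walk_weight_ge0 //.
have -> : walk_weight p = (size p)%:R.
  by rewrite /walk_weight /= big_const_seq count_predT iter_addr addr0.
apply: le_lt_trans (_ : _ <= t * 1) _; last first.
  by rewrite mulr1; apply: lt_le_trans tk _; rewrite ler_nat; exact: cut_cycle cp.
rewrite ler_wpM2l //; elim/big_ind: _ => // u v u0 v0; by rewrite ge_max u0.
Qed.

(** With unit weights a spanning forest weighs at most [m]. The last hypothesis settles the value 1
    of 0 / 0. *)
Lemma cut_lightness (c : R) : 0 <= c ->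
  c * m%:R <= #|[set p : 'I_m * 'I_m | cut_edge p]|%:R -> c <= 1 \/ (0 < #|[set p : 'I_m * 'I_m | cut_edge p]|)%N ->
  (c%:E <= lightness [set: edge cut_graph]%SET)%E.
Proof.
have wE (S : {set edge cut_graph}) : weight S = #|S|%:R.
  by rewrite /weight sumr_const.
have cE : #|[set: edge cut_graph]%SET| = #|[set p : 'I_m * 'I_m | cut_edge p]|.
  by rewrite cardsT card_sig; apply: eq_card => p; rewrite inE.
move=> c0; rewrite -cE => hc h1.
have [T [[sT cT aT] _ Tw]] := mst_exists [set: edge cut_graph]%SET.
have Tm : weight T <= m%:R.
  by rewrite wE ler_nat; apply: leq_trans (card_acyclic aT) _; rewrite card_ord.
rewrite /lightness Tw weight_ratioE; case: eqP => [T0|/eqP T0].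
  case: eqP => [w0|/eqP w0]; last by rewrite gt0_muley ?leey // lte_fin lt0r w0 weight_ge0.
  by case: h1; rewrite ?lee_fin //; move/eqP: w0; rewrite wE pnatr_eq0 => /eqP ->.
rewrite lee_fin ler_pdivlMr ?lt0r ?T0 ?weight_ge0 // [leRHS]wE; apply: le_trans hc.
by rewrite ler_wpM2l.
Qed.

End BipartiteGraph.

Section Erdos.
Variable R : realType.

(** The conjecture on two vertices: at most one edge, against [2 ^ (1 + 1/k) >= 2]. It serves the
    case where rounding leaves at most one vertex. *)
Lemma erdos_half (gamma : nat -> R) k : (0 < k)%N -> erdos_girth_conjecture gamma ->
  gamma k <= 2^-1.
Proof.
move=> k0 [_ /(_ k 2 k0 isT) [a [sy irr _]]].
set E := [set p : 'I_2 * 'I_2 | _] => h.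
have E1 : (#|E| <= 1)%N.
  apply: leq_trans (_ : #|[set (ord0 : 'I_2, ord_max : 'I_2)]| <= _)%N; last by rewrite cards1.
  apply/subset_leq_card/subsetP => -[u v]; rewrite [_ \in E]inE /= => /andP[uv _].
  case: u v uv => [[|[|u]] hu] [[|[|v]] hv] //= _.
  by apply/set1P; congr pair; exact: val_inj.
have g0 : 0 <= gamma k \/ gamma k <= 0 by apply/orP; exact: le_total.
case: g0 => g0; last by apply: le_trans g0 _; rewrite invr_ge0.
have h2 : 2 <= 2%:R `^ (1 + k%:R^-1) :> R.
  by rewrite -[leLHS]powRr1 // ler_powR ?ler1n // lerDl invr_ge0.
rewrite -[leRHS]mul1r ler_pdivlMr //.
apply: le_trans (_ : gamma k * 2%:R `^ (1 + k%:R^-1) <= _); first by rewrite ler_wpM2l.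
by apply: le_trans h _; rewrite (ler_nat _ _ 1).
Qed.

Lemma erdos_lambda (gamma : nat -> R) k m (t : R) : (0 < k)%N -> (1 < m)%N ->
  erdos_girth_conjecture gamma -> 1 <= t -> t < (2 * k).+2%:R ->
  ((gamma k / 2 * m%:R `^ k%:R^-1)%:E <= lambda m t)%E.
Proof.
move=> k0 m1 [gpos /(_ k m k0 m1) [a [sy irr girth h]]] t1 tk.
have g0 := gpos k k0.
set E := [set p : 'I_m * 'I_m | _] in h.
have [chi hchi] : exists chi : {ffun 'I_m -> bool}, (#|E| <= 2 * #|[set p in E | chi p.1 != chi p.2]|)%N.
  apply: max_cut => p; rewrite inE => /andP[lt _].
  by apply: contraTneq lt => ->; rewrite ltnn.
have ce : [set p in E | chi p.1 != chi p.2] = [set p | cut_edge a chi p].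
  by apply/setP => p; rewrite !inE /cut_edge -andbA.
have m0 : 0 < m%:R :> R by rewrite ltr0n ltnW.
have key : gamma k * m%:R `^ (1 + k%:R^-1) <= 2 * #|[set p | cut_edge a chi p]|%:R.
  by apply: le_trans h _; rewrite -natrM ler_nat -ce.
have E1 : gamma k / 2 * m%:R `^ k%:R^-1 * m%:R <= #|[set p | cut_edge a chi p]|%:R.
  move: key; rewrite powRD; last by apply/implyP; rewrite gt_eqF.
  rewrite powRr1; last exact: ltW.
  rewrite (_ : gamma k / 2 * _ * _ = gamma k * (m%:R * m%:R `^ k%:R^-1) / 2); last by ring.
  by rewrite ler_pdivrMr // (mulrC _ 2).
apply: le_trans (ereal_sup_ubound _); last first.
  exists (cut_graph R a chi); split; last by reflexivity.
    by rewrite card_ord.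
  exact: (cut_girth _ sy girth).
apply: cut_lightness => //.
  by apply: mulr_ge0; rewrite ?powR_ge0 // divr_ge0 // ltW.
right; rewrite -(ltr_nat R); apply: lt_le_trans E1.
by rewrite !mulr_gt0 ?invr_gt0 ?powR_gt0.
Qed.

(** [32 = 4 * 2 * 2 * 2]: the constant of the lower bound, the passage to a cut, the factor
    [2 ^ (1 / (2 * k)) <= 2], and the rounding of the number of vertices. *)
Lemma erdos_lower_bound (gamma : nat -> R) (f k n : nat) (eps : R) :
  (0 < f)%N -> (0 < k)%N -> (0 < n)%N -> 0 < eps -> erdos_girth_conjecture gamma ->
  eps < k%:R^-1 ->
  ((f%:R `^ (- (2 * k%:R)^-1) * (32^-1 * gamma k * n%:R `^ k%:R^-1))%:E <=
     (4^-1)%:E * lambda (Num.truncn (n%:R / Num.sqrt (2 * f%:R) : R))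
                        ((1 + eps) * (2 * k%:R))%R)%E.
Proof.
move=> f0 k0 n0 eps0 hg epsk; set x := n%:R / _; set m := Num.truncn x.
have kk : 1 <= k%:R :> R by rewrite ler1n.
have ki : k%:R^-1 <= 1 :> R by rewrite invf_le1 // (lt_le_trans _ kk).
have ki0 : 0 <= k%:R^-1 :> R by rewrite invr_ge0.
have f0' : 0 < f%:R :> R by rewrite ltr0n.
have g0 : 0 < gamma k by case: hg => h _; exact: h.
have x0 : 0 < x by rewrite divr_gt0 ?ltr0n // sqrtr_gt0 mulr_gt0.
have E1 : f%:R `^ (- (2 * k%:R)^-1) * n%:R `^ k%:R^-1 <= 2 * x `^ k%:R^-1 :> R.
  have nx : n%:R = x * Num.sqrt (2 * f%:R) :> R by rewrite divfK // gt_eqF // sqrtr_gt0 mulr_gt0.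
  rewrite nx (powRM _ (ltW x0)) ?sqrtr_ge0 // powRN.
  have -> : Num.sqrt (2 * f%:R) `^ k%:R^-1 = (2 * f%:R) `^ (2 * k%:R)^-1 :> R.
    by rewrite -powR12_sqrt ?mulr_ge0 // -powRrM invfM.
  rewrite (powRM _ _ (ltW f0')) // mulrCA [leRHS]mulrC; apply: ler_wpM2l; first exact: powR_ge0.
  rewrite (mulrC (2 `^ _)) mulKf ?gt_eqF ?powR_gt0 //.
  rewrite -[leRHS]powRr1 // ler_powR ?ler1n // invf_le1; lra.
have M1 : 1 <= Num.max 1 m%:R :> R by rewrite le_max lexx.
have x4 : x <= 2 * Num.max 1 m%:R.
  have : x < m.+1%:R := truncnS_gt _.
  have : m%:R <= Num.max 1 m%:R :> R by rewrite le_max lexx orbT.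
  by rewrite -natr1; move: M1; lra.
have E2 : x `^ k%:R^-1 <= 2 * Num.max 1 m%:R `^ k%:R^-1.
  have M0 : 0 <= Num.max 1 m%:R :> R by apply: le_trans M1.
  apply: le_trans (_ : (2 * Num.max 1 m%:R) `^ k%:R^-1 <= _).
    by rewrite ge0_ler_powR ?nnegrE ?mulr_ge0 // ltW.
  rewrite powRM // ler_wpM2r ?powR_ge0 //.
  by rewrite -[leRHS]powRr1 // ler_powR ?ler1n.
have E3 : ((gamma k / 2 * Num.max 1 m%:R `^ k%:R^-1)%:E <= lambda m ((1 + eps) * (2 * k%:R))%R)%E.
  have [m1|m1] := leqP m 1.
    have -> : Num.max 1 m%:R = 1 :> R by apply: max_l; rewrite (ler_nat _ _ 1).
    rewrite powR1 mulr1; apply: le_trans (lambda_ge1 _ _); rewrite lee_fin.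
    have := erdos_half k0 hg; rewrite ler_pdivrMr // => h; apply: le_trans h _.
    by rewrite mul1r (le_trans (_ : _ <= 1)) ?invf_le1 ?ler1n ?ltr0n.
  have -> : Num.max 1 m%:R = m%:R :> R by apply: max_r; rewrite (ler_nat _ 1) ltnW.
  apply: erdos_lambda => //.
    apply: le_trans (_ : 1 * 1 <= _); first by rewrite mulr1.
    by apply: ler_pM => //; lra.
  have ek : eps * k%:R < 1 by rewrite -ltr_pdivlMr ?div1r // (lt_le_trans _ kk).
  by rewrite -!natr1 natrM; lra.
apply: le_trans (lee_wpmul2l _ E3); last by rewrite lee_fin invr_ge0.
rewrite -EFinM lee_fin.
apply: le_trans (_ : 32^-1 * gamma k * (2 * (2 * Num.max 1 m%:R `^ k%:R^-1)) <= _); last by lra.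
rewrite mulrCA ler_wpM2l //; first by rewrite mulr_ge0 // ltW.
by apply: le_trans E1 _; rewrite ler_wpM2l.
Qed.

End Erdos.

(** * Steiner forests *)

Section Cuts.
Variables (R : realType) (G : mgraph R).
Implicit Types (S F Z Q P W : {set edge G}) (X : {set vert G}).

Definition crosses X (e : edge G) := ((ends e).1 \in X) != ((ends e).2 \in X).

Lemma joins_crosses X e x y : joins e x y -> crosses X e = ((x \in X) != (y \in X)).
Proof. by rewrite /crosses; case/joins_endsP=> -[-> ->] //; rewrite eq_sym. Qed.

Lemma uncrossed_walk W X x p y : (forall e, e \in unzip1 p -> ~~ crosses X e) ->
  walk W x p y -> (y \in X) = (x \in X).
Proof.
elim: p x => [|[e v] p IHp] x h /=; first by move/eqP->.
case/and3P=> _ ej /IHp ->; last by move=> f fp; apply: h; rewrite inE fp orbT.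
by have := h e (mem_head _ _); rewrite (joins_crosses _ ej) negbK => /eqP.
Qed.

Lemma uncrossed_conn W X x y : (forall e, e \in W -> ~~ crosses X e) ->
  connect (edge_rel W) x y -> (y \in X) = (x \in X).
Proof.
move=> h /edge_connP[p wp]; apply: uncrossed_walk (wp) => e ep; apply: h.
exact: walk_edges wp ep.
Qed.

(* A walk crossing the cut X must come back, so it does not need the only edge
   of the cut. *)
Lemma single_cut_edge W X e x y : (forall g, g \in W -> crosses X g -> g = e) ->
  crosses X e -> (x \in X) = (y \in X) -> connect (edge_rel W) x y ->
  connect (edge_rel (W :\ e)) x y.
Proof.
move=> h ce xy /edge_connP[p /walk_simple[q [wq _ uq _ _]]].
have [eq|eq] := boolP (e \in unzip1 q); last first.
  by apply/edge_connP; exists q; exact: walk_avoid.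
have [a [b [p1 [p2 [ej w1 w2 _]]]]] := walk_split_edge wq uq eq.
have un g : g \in W :\ e -> ~~ crosses X g.
  by case/setD1P=> ge gW; apply: contra_neqN ge => cg; exact: h.
have c1 : connect (edge_rel (W :\ e)) x a by apply/edge_connP; exists p1.
have c2 : connect (edge_rel (W :\ e)) b y by apply/edge_connP; exists p2.
have h1 := uncrossed_conn un c1; have h2 := uncrossed_conn un c2.
by move: ce; rewrite (joins_crosses _ ej) h1 xy h2 eqxx.
Qed.

Lemma block_uncrossed Z X e : X \in components Z -> e \in Z -> ~~ crosses X e.
Proof.
case/componentsP=> x -> eZ; rewrite /crosses !inE negbK; apply/eqP.
by apply: same_connect_r (edge_connC Z) _ _ (edge_conn1 eZ (joins_ends e)) x.
Qed.

Definition cut_of F X := [set f in F | crosses X f].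

Lemma card_crossed_blocks Z e : (#|[set X in components Z | crosses X e]| <= 2)%N.
Proof.
apply: leq_trans (_ : #|[set block Z (ends e).1; block Z (ends e).2]| <= _)%N; last first.
  by rewrite cards2; case: (_ == _).
apply/subset_leq_card/subsetP => X; rewrite inE => /andP[/componentsP[x ->]].
rewrite /crosses !inE !block_eq.
by rewrite !(edge_connC Z x); case: (connect _ _ x); case: (connect _ _ x).
Qed.

(* Leaves of the forest F contracted along Z are active, hence the blocks in
   `act` have average degree at most 2. *)
Lemma active_degrees Z F (act : {set {set vert G}}) : act \subset components Z ->
  (forall f, f \in F -> ~~ connect (edge_rel (Z :|: F :\ f)) (ends f).1 (ends f).2) ->
  (forall X, X \in components Z -> X \notin act -> #|cut_of F X| != 1%N) ->
  (\sum_(X in act) #|cut_of F X| <= 2 * #|act|)%N.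
Proof.
move=> sact hF hdeg; set D := components Z.
have total : (\sum_(X in D) #|cut_of F X| <= 2 * #|F|)%N.
  rewrite double_count.
  apply: leq_trans (_ : \sum_(f in F) 2 <= _)%N.
    by apply: leq_sum => f _; exact: card_crossed_blocks.
  by rewrite sum_nat_const mulnC.
pose iso := [set X in D | #|cut_of F X| == 0%N].
(* A block that [F] does not meet is still a component of [Z :|: F]. *)
have count : (#|F| + #|iso| <= #|D|)%N.
  apply: leq_trans (card_components_free hF); rewrite leq_add2l.
  apply/subset_leq_card/subsetP => X; rewrite inE => /andP[XD /eqP/cards0_eq c0].
  have un e : e \in Z :|: F -> ~~ crosses X e.
    case/setUP=> [eZ|eF]; first exact: block_uncrossed XD eZ.
    apply/negP => ce; have : e \in cut_of F X by rewrite inE eF.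
    by rewrite c0 inE.
  case/componentsP: (XD) => x EX; apply/componentsP; exists x; apply/setP => y.
  apply/idP/idP; rewrite inE.
    by rewrite EX inE; apply: edge_conn_sub => e eZ; apply/setUP; left.
  by move=> /(uncrossed_conn un) ->; rewrite EX block_mem.
pose ina := [set X in D | (X \notin act) && (#|cut_of F X| != 0%N)].
(* Inactive blocks met by [F] have degree at least 2, so leaving them out cannot raise the average
   above 2. *)
have sum_ina : (2 * #|ina| <= \sum_(X in D | X \notin act) #|cut_of F X|)%N.
  rewrite mulnC -sum_nat_const big_mkcond [leqRHS]big_mkcond /=; apply: leq_sum => X _.
  rewrite inE; case XD: (X \in D) => //=; case Xa: (X \in act) => //=; case: ifP => // c0.
  by have := hdeg X XD (negbT Xa); case: #|cut_of F X| c0 => [|[|]].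
have part : (#|D| <= #|iso| + #|ina| + #|act|)%N.
  apply: leq_trans (_ : #|iso :|: ina :|: act| <= _)%N.
    apply/subset_leq_card/subsetP => X XD; rewrite !in_setU !in_set XD /=.
    by case: (_ == 0%N); case: (X \in act); rewrite ?orbT.
  apply: leq_trans (leq_card_setU _ _) _; rewrite leq_add2r; exact: leq_card_setU.
have split : (\sum_(X in D) #|cut_of F X| =
    \sum_(X in act) #|cut_of F X| + \sum_(X in D | X \notin act) #|cut_of F X|)%N.
  rewrite (bigID (mem act)) /=; congr addn; apply: eq_bigl => X.
  by rewrite andb_idl // => /(subsetP sact).
clear -total count sum_ina part split; lia.
Qed.

End Cuts.

Section SteinerForest.
Variables (R : realType) (G : mgraph R) (Q P : {set edge G}) (K : nat).
Hypothesis K0 : (0 < K)%N.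

Definition separates X := [exists e in P, @crosses R G X e].

Hypothesis cutK : forall X, separates X -> (K <= #|cut_of Q X|)%N.

Let connects (T : {set edge G}) := [forall e in P, connect (edge_rel T) (ends e).1 (ends e).2].

(** If an inactive block were met by a single edge of a minimal [F], that edge could go: the block
    separates no pair of [P], so no connection depends on crossing it. *)
Lemma minimal_connector Z (T : {set edge G}) : connects (Z :|: T) ->
  exists F : {set edge G}, [/\ F \subset T, connects (Z :|: F) &
    (\sum_(X in [set X in components Z | separates X]) #|cut_of F X| <=
      2 * #|[set X in components Z | separates X]|)%N].
Proof.
move=> hT; have hT' : (fun F : {set edge G} => (F \subset T) && connects (Z :|: F)) T.
  by rewrite /= subxx.
case: (@arg_minnP _ T (fun F : {set edge G} => (F \subset T) && connects (Z :|: F))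
  (fun F : {set edge G} => #|F|) hT') => F /andP[sFT cF] minF.
have needed f : f \in F -> ~~ connects (Z :|: F :\ f).
  move=> fF; apply/negP => h; have := minF (F :\ f).
  rewrite h (fintype.subset_trans (finset.subD1set _ _) sFT) => /(_ isT).
  by rewrite [leqLHS](cardsD1 f) fF add1n ltnn.
have sub f : Z :|: F \subset f |: (Z :|: F :\ f).
  by apply/subsetP => e; rewrite !inE; case: (e == f); case: (e \in Z).
have free f : f \in F -> ~~ connect (edge_rel (Z :|: F :\ f)) (ends f).1 (ends f).2.
  move=> fF; apply: contra (needed f fF) => cf; apply/forall_inP => e eP.
  move/forall_inP: cF => /(_ e eP); apply: edge_conn_repl => g gZF.
  have := subsetP (sub f) _ gZF; case/setU1P=> [->//|gZ].
  exact: edge_conn1 gZ (joins_ends g).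
exists F; split=> //; apply: active_degrees free _.
  by apply/subsetP => X; rewrite inE => /andP[].
move=> X XD; rewrite inE XD /= => nsep; apply/negP => /cards1P[f cf].
have /setIdP[fF fX] : f \in cut_of F X by rewrite cf set11.
have fZ : f \notin Z by apply: contraL fX => /(block_uncrossed XD).
have only g : g \in Z :|: F -> crosses X g -> g = f.
  case/setUP=> [gZ|gF] gX; first by move: gX; rewrite (negPf (block_uncrossed XD gZ)).
  by have : g \in cut_of F X; [rewrite inE gF|rewrite cf => /set1P].
case/negP: (needed f fF); apply/forall_inP => e eP.
have eX : ((ends e).1 \in X) = ((ends e).2 \in X).
  apply/eqP; apply: contraNT nsep => h; apply/existsP; exists e; by rewrite eP.
have -> : Z :|: F :\ f = (Z :|: F) :\ f.
  apply/setP => g; rewrite !inE; case: eqP => //= ->; by rewrite (negPf fZ).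
apply: single_cut_edge only fX eX _.
by move/forall_inP: cF; apply.
Qed.

Lemma sum_cuts (c : R) (F : {set edge G}) (act : {set {set vert G}}) :
  \sum_(e in F) c * #|[set X in act | crosses X e]|%:R =
  c * (\sum_(X in act) #|cut_of F X|)%:R.
Proof.
by rewrite -mulr_sumr -natr_sum double_count.
Qed.

(** The primal-dual method in local ratio form: costs drop by [delta] per active block crossed until
    a further edge is free. In such a round a minimal connector pays at most [2 * #|act|] and [Q] at
    least [K * #|act|], both times [delta]. *)
Lemma steiner_forest (c : edge G -> R) : (forall e, e \in Q -> 0 <= c e) ->
  exists T : {set edge G}, [/\ T \subset Q,
    forall e, e \in P -> connect (edge_rel T) (ends e).1 (ends e).2 &
    K%:R * \sum_(e in T) c e <= 2 * \sum_(e in Q) c e].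
Proof.
have [N] := ubnP #|[set e in Q | c e != 0]|; elim: N c => // N IHN c cN c0.
pose Z := [set e in Q | c e == 0].
have sZ : Z \subset Q by apply/subsetP => e /setIdP[].
have ZE e : e \in Z -> c e = 0 by rewrite inE => /andP[_ /eqP].
pose act := [set X in components Z | separates X].
have [act0|[X1 X1a]] := set_0Vmem act.
  exists Z; split=> //.
    move=> e eP; apply: contraT => ne.
    have : block Z (ends e).1 \in act.
      rewrite inE block_components; apply/existsP; exists e.
      by rewrite eP /crosses block_mem inE (negPf ne).
    by rewrite act0 inE.
  rewrite [X in K%:R * X]big1 ?mulr0; last by move=> e /ZE.
  by apply: mulr_ge0 => //; apply: sumr_ge0.
pose al e := #|[set X in act | crosses X e]|.
have alZ e : e \in Z -> al e = 0%N.
  move=> eZ; apply/eqP; rewrite cards_eq0 -subset0; apply/subsetP => X.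
  rewrite inE => /andP[/setIdP[XD _] cX]; by move: (block_uncrossed XD eZ); rewrite cX.
have [e1 [e1Q e1a]] : exists e, e \in Q /\ (0 < al e)%N.
  have /setIdP[_ /cutK] := X1a; move/(leq_trans K0)/card_gt0P => [e /setIdP[eQ ec]].
  by exists e; split=> //; apply/card_gt0P; exists X1; rewrite inE X1a.
(* The least ratio is the largest [delta] for which no cost in [Q] becomes negative. *)
have [e0 [e0Q e0a] e0m] := fin_min (P := fun e => e \in Q /\ (0 < al e)%N)
  (fun e => c e / (al e)%:R) (conj e1Q e1a).
pose delta := c e0 / (al e0)%:R.
have d0 : 0 <= delta by apply: divr_ge0 => //; exact: c0.
pose c' e := c e - delta * (al e)%:R.
have c'0 e : e \in Q -> 0 <= c' e.
  move=> eQ; rewrite /c' subr_ge0; have [->|ae] := posnP (al e); first by rewrite mulr0 c0.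
  by rewrite -ler_pdivlMr ?ltr0n //; exact: e0m.
have ce0 : c e0 != 0.
  apply: contraTneq e0a => z; rewrite alZ // inE e0Q z; exact/eqP.
have [|T' [sT' cT' wT']] := IHN c' _ c'0.
  rewrite -ltnS; apply: leq_trans cN; rewrite ltnS; apply: proper_card.
  apply/properP; split.
    apply/subsetP => e; rewrite !inE => /andP[eQ]; rewrite eQ /=; apply: contra => /eqP ce.
    have ae : al e = 0%N by apply: alZ; rewrite inE eQ ce eqxx.
    by rewrite /c' ae ce mulr0 subr0.
  exists e0; first by rewrite inE e0Q.
  by rewrite inE e0Q /c' /delta divfK ?subrr ?eqxx // pnatr_eq0 -lt0n.
have cZT' : connects (Z :|: T').
  apply/forall_inP => e eP; apply: edge_conn_sub (cT' e eP) => g gT.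
  by rewrite inE gT orbT.
have [F [sF cF degF]] := minimal_connector cZT'.
exists (Z :|: F); split.
- by rewrite subUset sZ (fintype.subset_trans sF sT').
- by move=> e eP; move/forall_inP: cF; apply.
have sumE (W : {set edge G}) : \sum_(e in W) c e =
    \sum_(e in W) c' e + delta * (\sum_(X in act) #|cut_of W X|)%:R.
  rewrite -sum_cuts -big_split /=; apply: eq_bigr => e _; rewrite /c'; by rewrite subrK.
have h1 : \sum_(e in Z :|: F) c e <= \sum_(e in F) c e.
  rewrite big_mkcond [leRHS]big_mkcond; apply: ler_sum => e _; rewrite in_setU.
  case eF: (e \in F); first by rewrite orbT.
  by rewrite orbF; case: ifP => // /ZE ->.
have h2 : \sum_(e in F) c' e <= \sum_(e in T') c' e.
  rewrite [leRHS](big_setID F) /= (finset.setIidPr sF) lerDl.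
  by apply: sumr_ge0 => e /finset.setDP[/(subsetP sT') eQ _]; exact: c'0.
have h3 : delta * (\sum_(X in act) #|cut_of F X|)%:R <= delta * (2 * #|act|)%:R.
  by apply: ler_wpM2l => //; rewrite ler_nat.
have h4 : delta * (K * #|act|)%:R <= delta * (\sum_(X in act) #|cut_of Q X|)%:R.
  apply: ler_wpM2l => //; rewrite ler_nat mulnC -sum_nat_const.
  by apply: leq_sum => X /setIdP[_ /cutK].
have h5 : K%:R * \sum_(e in Z :|: F) c e <=
    K%:R * (\sum_(e in T') c' e + delta * (2 * #|act|)%:R).
  by apply: ler_wpM2l => //; apply: le_trans h1 _; rewrite sumE lerD.
apply: le_trans h5 _; rewrite (sumE Q) !mulrDr; apply: lerD => //.
by move: h4; rewrite !natrM; lra.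
Qed.

End SteinerForest.

(** * The greedy spanner *)

Section SubGraph.
Variables (R : realType) (G : mgraph R) (W : {set edge G}).

(** All vertices are kept, so [lambda] at [#|vert G|] applies to it. *)
Definition sub_graph : mgraph R := @MGraph R (vert G) {e : edge G | e \in W}
  (fun e => ends (val e)) (fun e => wt (val e)) (fun e => wt_ge0 (val e)).

Let emb (S : {set edge sub_graph}) : {set edge G} := [set val e | e in S].
Let emb_walk (p : seq (edge sub_graph * vert sub_graph)) : seq (edge G * vert G) :=
  [seq (val s.1, s.2) | s <- p].

Lemma sub_walk x p y : @walk R sub_graph [set: edge sub_graph]%SET x p y ->
  walk W x (emb_walk p) y.
Proof.
elim: p x => [|[e v] p IHp] x //=; case/and3P=> _ ej /IHp ->.
by rewrite (valP e) andbT.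
Qed.

Lemma sub_cycle x p : @is_cycle R sub_graph [set: edge sub_graph]%SET x p ->
  is_cycle W x (emb_walk p).
Proof.
case/and4P=> s0 wp u1 u2; apply/and4P; split; rewrite ?size_map //.
- exact: sub_walk.
- by rewrite -map_comp (map_comp val fst) (map_inj_uniq val_inj).
- by rewrite -map_comp.
Qed.

Lemma sub_girth (g : R) : 1 <= g -> (forall x p e, is_cycle W x p -> e \in unzip1 p ->
    g * wt e < walk_weight p) -> (g%:E < weighted_girth sub_graph)%E.
Proof.
move=> g1 h; apply: girth_gt => x p /sub_cycle cp.
have g0 : 0 <= g by apply: le_trans g1.
have E1 : walk_weight p = walk_weight (emb_walk p) by rewrite /walk_weight big_map.
have E2 : \big[Num.max/0]_(s <- p) wt s.1 = \big[Num.max/0]_(s <- emb_walk p) @wt R G s.1.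
  by rewrite big_map.
have pos (q : seq (edge G * vert G)) : 0 <= \big[Num.max/0]_(s <- q) wt s.1.
  by elim/big_ind: _ => // [u v u0 v0|s _]; rewrite ?wt_ge0 // le_max u0.
rewrite /normalized_weight E1 E2 weight_ratio_gtE ?walk_weight_ge0 //.
have {E1 E2} : forall q : seq (edge G * vert G), (0 < size q)%N ->
    exists2 e, e \in unzip1 q & \big[Num.max/0]_(s <- q) wt s.1 <= wt e.
  elim=> [//|s q IHq] _; rewrite big_cons; case: q IHq => [|s' q] IHq.
    by exists s.1; rewrite ?mem_head // big_nil ge_max lexx wt_ge0.
  have [e eq le] := IHq isT; case: (leP (wt e) (wt s.1)) => h1.
    exists s.1; first exact: mem_head.
    by rewrite ge_max lexx (le_trans le h1).
  by exists e; [rewrite inE eq orbT|rewrite ge_max le ltW].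
have s0 : (0 < size (emb_walk p))%N by case/and4P: cp.
move=> /(_ _ s0)[e ep le]; apply: le_lt_trans (h _ _ _ cp ep).
by rewrite ler_wpM2l.
Qed.

Lemma weight_emb (S : {set edge sub_graph}) : weight S = weight (emb S).
Proof. by rewrite /weight big_imset //= => e e' _ _; exact: val_inj. Qed.

Lemma edge_rel_emb (S : {set edge sub_graph}) : @edge_rel R sub_graph S =2 edge_rel (emb S).
Proof.
move=> x y; apply/existsP/existsP => [[e /andP[eS ej]]|[e /andP[/imsetP[e' eS ->] ej]]].
  by exists (val e); rewrite imset_f.
by exists e'; rewrite eS.
Qed.

Lemma emb_setT : emb setT = W.
Proof.
apply/setP => e; apply/imsetP/idP => [[e' _ ->]|eW]; first exact: valP.
by exists (exist _ e eW).
Qed.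

Lemma sub_lightness (c : R) (F : {set edge G}) : F \subset W ->
  (forall x y, connect (edge_rel F) x y = connect (edge_rel W) x y) -> 0 <= c ->
  (lightness [set: edge sub_graph]%SET <= c%:E)%E -> weight W <= c * weight F.
Proof.
move=> sF cF c0.
have embF : emb [set e | val e \in F] = F.
  apply/setP => e; apply/imsetP/idP => [[e' + ->]|eF]; first by rewrite inE.
  by exists (exist _ e (subsetP sF e eF)); rewrite ?inE.
have [T [sT minT Tw]] := mst_exists [set: edge sub_graph]%SET.
have : (mst_weight [set: edge sub_graph]%SET <= (weight F)%:E)%E.
  rewrite -{1}embF -weight_emb; apply: mst_weight_le; first exact: finset.subsetT.
  move=> x y; rewrite !(eq_connect (edge_rel_emb _)) embF emb_setT; exact: cF.
rewrite /lightness Tw lee_fin => TF.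
rewrite weight_emb emb_setT weight_ratioE; case: eqP => [T0|/eqP T0].
  case: eqP => [-> _|/eqP W0]; first by rewrite mulr_ge0 ?weight_ge0.
  by rewrite gt0_muley ?leye_eq // lte_fin lt0r W0 weight_ge0.
rewrite lee_fin ler_pdivrMr ?lt0r ?T0 ?weight_ge0 // => h; apply: le_trans h _.
by rewrite ler_wpM2l.
Qed.

End SubGraph.

Section Exchange.
Variables (R : realType) (G : mgraph R).
Implicit Types (U F : {set edge G}).

Lemma exchange_connect F g h : ~~ connect (edge_rel (F :\ g)) (ends h).1 (ends h).2 ->
  connect (edge_rel F) (ends h).1 (ends h).2 ->
  connect (edge_rel (h |: F :\ g)) (ends g).1 (ends g).2.
Proof.
move=> nh /edge_connP[p /walk_simple[q [wq _ uq _ _]]].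
have [gq|gq] := boolP (g \in unzip1 q); last first.
  by case/negP: nh; apply/edge_connP; exists q; exact: walk_avoid.
have [a [b [p1 [p2 [gj w1 w2 _]]]]] := walk_split_edge wq uq gq.
have up x p0 y : walk (F :\ g) x p0 y -> connect (edge_rel (h |: F :\ g)) x y.
  by move=> w; apply/edge_connP; exists p0; apply: walk_sub w => e eF; apply/setU1P; right.
have hh : connect (edge_rel (h |: F :\ g)) (ends h).1 (ends h).2.
  by apply: edge_conn1 (joins_ends h); rewrite setU11.
have ab : connect (edge_rel (h |: F :\ g)) a b.
  apply: connect_trans (_ : connect _ a (ends h).1) _; first by rewrite edge_connC (up _ _ _ w1).
  by apply: connect_trans hh _; rewrite edge_connC (up _ _ _ w2).
by case/joins_endsP: gj => -[<- <-] //; rewrite edge_connC.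
Qed.

Lemma min_forest_cycle U F (W : {set edge G}) x p g : spanning_forest U F ->
  (forall F' : {set edge G}, spanning_forest U F' -> weight F <= weight F') ->
  W \subset U -> is_cycle W x p -> g \in unzip1 p -> g \in F ->
  exists h, [/\ h \in unzip1 p, h \notin F & wt g <= wt h].
Proof.
move=> [sF /eqP/components_eqP cF aF] minF sW cp gp gF; set C := [set f in unzip1 p].
have /existsP[h /andP[hC nh]] : [exists h in C :\ g, ~~ connect (edge_rel (F :\ g)) (ends h).1 (ends h).2].
  apply: contraT; rewrite negb_exists => /forallP no; case/negP: (acyclic_bridge aF gF).
  apply: edge_conn_repl (edge_conn_cycle cp gp) => e eC.
  by have := no e; rewrite eC negbK.
case/setD1P: hC => hg; rewrite inE => hp.
have hF : h \notin F.
  by apply: contra nh => hF; apply: edge_conn1 (joins_ends h); apply/setD1P.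
exists h; split=> //; have hU : h \in U.
  by apply: (subsetP sW); case/and4P: cp => _ wp _ _; exact: walk_edges wp hp.
have chF : connect (edge_rel F) (ends h).1 (ends h).2.
  by rewrite cF; exact: edge_conn1 hU (joins_ends h).
have sU : h |: F :\ g \subset U.
  apply/subsetP => e /setU1P[->//|/setD1P[_]]; exact: subsetP.
have cU z y : connect (edge_rel (h |: F :\ g)) z y = connect (edge_rel U) z y.
  apply/idP/idP; first by apply: edge_conn_sub; exact/subsetP.
  rewrite -cF; apply: edge_conn_repl => e eF; have [->|eg] := eqVneq e g.
    exact: exchange_connect nh chF.
  by apply: edge_conn1 (joins_ends e); rewrite !inE eg eF orbT.
have [F' sF' FF'] := spanning_sub sU cU.
have := le_trans (minF _ sF') (weight_sub FF').
rewrite weightU1; last by rewrite !inE negb_and hF orbT.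
by rewrite (weightD1 gF) lerD2r.
Qed.

End Exchange.

(** * Accepted edges without conflicts *)

Section ConflictFree.
Variables (R : realType) (G : mgraph R) (T S : {set edge G}) (rk : edge G -> nat) (t L : R).
Hypotheses (t0 : 0 <= t) (L0 : 0 <= L).
Hypothesis rk_inj : {in S &, injective rk}.
Hypothesis rk_wt : {in S &, forall e e', (rk e <= rk e')%N -> wt e <= wt e'}.
Hypothesis far : forall e p, e \in S ->
  walk (T :|: [set e' in S | (rk e' < rk e)%N]) (ends e).1 p (ends e).2 ->
  t * wt e < walk_weight p.
Hypothesis connT : forall e, e \in S -> connect (edge_rel T) (ends e).1 (ends e).2.
Hypothesis lightL : forall W : {set edge G}, ((t + 1)%:E < weighted_girth (sub_graph W))%E ->
  (lightness [set: edge (sub_graph W)]%SET <= L%:E)%E.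

(* Together with a minimum spanning forest F of T and S, the edges of S form a
   graph of girth above t + 1: a heaviest edge of a cycle may be taken in S,
   where the last one in the order closes a cycle of weight > (t + 1) times its own. *)
Lemma conflict_free_weight : weight S <= L * weight T.
Proof.
pose U := T :|: S.
have [F [sfF minF _]] := mst_exists U.
have [sF /eqP/components_eqP cF aF] := sfF.
pose W := F :|: S.
have sW : W \subset U by rewrite subUset sF finset.subsetUr.
have FT : weight F <= weight T.
  have cT x y : connect (edge_rel T) x y = connect (edge_rel U) x y.
    apply/idP/idP; first by apply: edge_conn_sub => e eT; apply/setUP; left.
    apply: edge_conn_repl => e /setUP[eT|eS]; last exact: connT.
    exact: edge_conn1 eT (joins_ends e).
  have [F' sF' FT] := spanning_sub (finset.subsetUl T S) cT.
  exact: le_trans (minF _ sF') (weight_sub FT).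
apply: le_trans (_ : L * weight F <= _); last by rewrite ler_wpM2l.
apply: le_trans (_ : weight W <= _); first by rewrite weight_sub // finset.subsetUr.
apply: sub_lightness => //; first exact: finset.subsetUl.
  move=> x y; apply/idP/idP; first by apply: edge_conn_sub => e eF; apply/setUP; left.
  by rewrite cF; apply: edge_conn_sub; exact/subsetP.
apply/lightL/sub_girth => [|x p e cp ep]; first by rewrite lerDr.
have pW f : f \in unzip1 p -> f \in W.
  by case/and4P: cp => _ wp _ _; exact: walk_edges wp.
have [e1 e1p] : exists e1, (e1 \in unzip1 p) && (e1 \in S).
  apply/existsP; apply: contraT; rewrite negb_exists => /forallP no.
  case/negP: (aF x p); apply: cycle_sub cp _ => f fp.
  by case/setUP: (pW f fp) => // fS; have := no f; rewrite fp fS.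
case: (@arg_maxnP _ e1 (fun e => (e \in unzip1 p) && (e \in S)) rk e1p) => es /andP[esp esS] maxs.
have les f : f \in unzip1 p -> f \in S -> wt f <= wt es.
  by move=> fp fS; apply: rk_wt => //; apply: maxs; rewrite fp.
have le_es : wt e <= wt es.
  have [eS|eS] := boolP (e \in S); first exact: les.
  have eF : e \in F by case/setUP: (pW e ep) => // h; rewrite h in eS.
  have [h [hp hF eh]] := min_forest_cycle sfF minF sW cp ep eF.
  apply: le_trans eh (les h hp _).
  by case/setUP: (pW h hp) => // h'; rewrite h' in hF.
apply: le_lt_trans (_ : _ <= (t + 1) * wt es) _.
  by rewrite ler_wpM2l // addr_ge0.
pose C := [set f in unzip1 p].
have /and4P[_ wp up _] : is_cycle C x p by apply: cycle_sub cp _ => f; rewrite inE.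
have [a [b [p1 [p2 [ej w1 w2 ->]]]]] := walk_split_edge wp up esp.
have wq : walk (C :\ es) b (p2 ++ p1) a by exact: walk_cat w2 w1.
rewrite (addrC (walk_weight p1)) -walk_weight_cat mulrDl mul1r addrC ltrD2l.
have CT f : f \in C :\ es -> f \in T :|: [set e' in S | (rk e' < rk es)%N].
  case/setD1P=> fes; rewrite inE => fp; have [fS|fS] := boolP (f \in S).
    have mle : (rk f <= rk es)%N by apply: maxs; rewrite fp.
    apply/setUP; right; rewrite inE fS /= ltn_neqAle mle andbT.
    by apply: contraNneq fes => /rk_inj ->.
  have fF : f \in F by case/setUP: (pW f fp) => // h; rewrite h in fS.
  by case/setUP: (subsetP sF f fF) => [fT|h]; [apply/setUP; left|rewrite h in fS].
have wq' := walk_sub CT wq.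
case/joins_endsP: ej => -[Ea Eb]; last by apply: far => //; rewrite -Ea -Eb.
have [q [wqr <- _]] := walk_rev wq'; apply: far => //; by rewrite -Ea -Eb.
Qed.

End ConflictFree.

Section Greedy.
Variables (R : realType) (G : mgraph R) (Q : {set edge G}) (f : nat) (t : R).
Implicit Types (S H F : {set edge G}).

Lemma spanner_replace H : 1 <= t ->
  (forall e F, e \notin H -> (#|F| <= f)%N ->
    reach (H :\: F) (ends e).1 (ends e).2 (t * wt e)) -> eft_spanner f t H.
Proof.
move=> t1 hH F Ff u v; have t0 : 0 < t by apply: lt_le_trans t1.
rewrite -lee_pdivrMl //; apply: le_ereal_inf_tmp => _ [p /= wp <-].
rewrite lee_pdivrMl // -EFinM.
have [q wq ww] : reach (H :\: F) u v (t * walk_weight p).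
  have [mono sy tr] := reach_is_law (H :\: F).
  elim: p u wp => [|[e x] p IHp] u /=.
    by move/eqP->; rewrite walk_weight_nil mulr0; exact: reach_refl.
  case/and3P=> eF ej /IHp; rewrite walk_weight_cons mulrDr; apply: tr.
  have {eF} eF : e \notin F by move: eF; rewrite !inE andbT.
  have [eH|eH] := boolP (e \in H).
    apply: (mono _ _ (wt e)); first by rewrite ler_peMl ?wt_ge0.
    by apply: reach_edge ej; apply/finset.setDP.
  by case/joins_endsP: ej => -[-> ->]; [|apply: sy]; exact: hH.
apply: le_trans (_ : (walk_weight q)%:E <= _)%E; last by rewrite lee_fin.
by apply: ereal_inf_lbound; exists q.
Qed.

Lemma weight_order : exists rk : edge G -> nat, injective rk /\
  forall e e', (rk e <= rk e')%N -> wt e <= wt e'.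
Proof.
pose s := sort (fun a b : edge G => wt a <= wt b) (enum (edge G)).
have ins e : e \in s by rewrite mem_sort mem_enum.
exists (fun e => index e s); split=> [e e' h|e e' h].
  by rewrite -(nth_index e (ins e)) h nth_index.
have ss : sorted (fun a b : edge G => wt a <= wt b) s.
  by apply: sort_sorted => a b; exact: le_total.
apply: (@sorted_leq_index _ (fun a b : edge G => wt a <= wt b) _ _ _ ss e e') => //.
by move=> a b c; exact: le_trans.
Qed.

(** Ranks refine weights so that ties are broken. [Fe e] is the witness of acceptance against the
    edges before [e]; rejection persists, since later edges only add walks. *)
Lemma greedy : exists (S : {set edge G}) (rk : edge G -> nat) (Fe : edge G -> {set edge G}),
  [/\ injective rk, forall e e', (rk e <= rk e')%N -> wt e <= wt e',
   forall e, e \in S -> [/\ e \notin Q, (#|Fe e| <= f)%N &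
     forall p, walk ((Q :|: [set e' in S | (rk e' < rk e)%N]) :\: Fe e) (ends e).1 p (ends e).2 ->
       t * wt e < walk_weight p] &
   forall e F, e \notin Q :|: S -> (#|F| <= f)%N ->
     reach ((Q :|: S) :\: F) (ends e).1 (ends e).2 (t * wt e)].
Proof.
have [rk [rk_inj rk_wt]] := weight_order.
suff [S [Fe [h1 h2]]] : exists (S : {set edge G}) (Fe : edge G -> {set edge G}),
  (forall e, e \in S -> [/\ e \notin Q, (#|Fe e| <= f)%N, (rk e < (\max_e rk e).+1)%N &
     forall p, walk ((Q :|: [set e' in S | (rk e' < rk e)%N]) :\: Fe e) (ends e).1 p (ends e).2 ->
       t * wt e < walk_weight p]) /\
  (forall e F, (rk e < (\max_e rk e).+1)%N -> e \notin Q :|: S -> (#|F| <= f)%N ->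
     reach ((Q :|: S) :\: F) (ends e).1 (ends e).2 (t * wt e)).
  exists S, rk, Fe; split=> // [e /h1[]//|e F]; apply: h2.
  by rewrite ltnS leq_bigmax.
elim: (\max_e rk e).+1 => [|m [S [Fe [h1 h2]]]].
  by exists finset.set0, (fun=> finset.set0); split=> // e; rewrite inE.
have up e F e0 : reach ((Q :|: S) :\: F) (ends e).1 (ends e).2 (t * wt e) ->
    reach ((Q :|: (e0 |: S)) :\: F) (ends e).1 (ends e).2 (t * wt e).
  by apply: reach_sub => g; rewrite !inE => /andP[-> /orP[->//|->]]; rewrite !orbT.
have [[e0 [F0 [r0 e0Q F0f far]]]|no] := pselect (exists e0 F0, [/\ rk e0 = m, e0 \notin Q,
  (#|F0| <= f)%N & forall p, walk ((Q :|: S) :\: F0) (ends e0).1 p (ends e0).2 ->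
     t * wt e0 < walk_weight p]).
- have e0S : e0 \notin S by apply/negP => /h1[_ _]; rewrite r0 ltnn.
  have before e : (rk e <= m)%N -> [set e' in e0 |: S | (rk e' < rk e)%N] = [set e' in S | (rk e' < rk e)%N].
    move=> em; apply/setP => g; rewrite !inE; have [->|_] := eqVneq g e0 => //=.
    by rewrite (negPf e0S) r0 ltnNge em.
  exists (e0 |: S), (fun e => if e == e0 then F0 else Fe e); split.
    move=> e /setU1P[->|eS].
      rewrite eqxx r0; split=> // p; rewrite -r0 before ?r0 // => wp; apply: far.
      by apply: walk_sub wp => g; rewrite !inE => /andP[-> /orP[->//|/andP[-> _]]]; rewrite orbT.
    have [e1 e2 e3 e4] := h1 e eS.
    have -> : (e == e0) = false by apply: contraNF e0S => /eqP <-.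
    by split=> //; [exact: ltnW|rewrite before // ltnW].
  move=> e F; rewrite ltnS leq_eqVlt => /predU1P[em|em].
    by have -> : e = e0 by [apply: rk_inj; rewrite r0]; rewrite !inE eqxx orbT.
  rewrite finset.setUCA in_setU1 negb_or => /andP[_ eQS] Ff.
  by rewrite finset.setUCA; apply: up; exact: h2.
- exists S, Fe; split.
    by move=> e /h1[e1 e2 e3 e4]; split=> //; exact: ltnW.
  move=> e F; rewrite ltnS leq_eqVlt => /predU1P[em|em]; last exact: h2.
  move=> eQS Ff; apply: contrapT => nr; apply: no; exists e, F; split=> //.
    by move: eQS; rewrite inE negb_or => /andP[].
  move=> p wp; rewrite ltNge; apply/negP => le; by apply: nr; exists p.
Qed.

(** Otherwise the cut of [Q] is itself an admissible fault set, and [e] survives it in the graph. *)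
Lemma preserver_cut X e : eft_connectivity_preserver f Q -> e \notin Q -> crosses X e ->
  (f < #|cut_of Q X|)%N.
Proof.
move=> hQ eQ eX; rewrite ltnNge; apply/negP => /hQ/eqP/components_eqP h.
have : connect (edge_rel (Q :\: cut_of Q X)) (ends e).1 (ends e).2.
  by rewrite h; apply: edge_conn1 (joins_ends e); rewrite !inE (negPf eQ).
move/(uncrossed_conn (X := X)) => E; move: eX; rewrite /crosses E ?eqxx //.
move=> g; rewrite !inE => /andP[+ gQ]; by rewrite gQ.
Qed.

End Greedy.

(** * The weight of the greedy spanner *)

Section UpperBound.
Variables (R : realType) (G : mgraph R) (Q S : {set edge G}) (f : nat) (t L : R).
Variables (rk : edge G -> nat) (Fe : edge G -> {set edge G}).
Hypotheses (t0 : 0 <= t) (L0 : 0 <= L).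
Hypothesis presQ : eft_connectivity_preserver (2 * f) Q.
Hypothesis rk_inj : injective rk.
Hypothesis rk_wt : forall e e', (rk e <= rk e')%N -> wt e <= wt e'.
Hypothesis accepted : forall e, e \in S -> [/\ e \notin Q, (#|Fe e| <= f)%N &
     forall p, walk ((Q :|: [set e' in S | (rk e' < rk e)%N]) :\: Fe e) (ends e).1 p (ends e).2 ->
       t * wt e < walk_weight p].
Hypothesis lightL : forall W : {set edge G}, ((t + 1)%:E < weighted_girth (sub_graph W))%E ->
  (lightness [set: edge (sub_graph W)]%SET <= L%:E)%E.

(** [c(T)] bounds the weight of [S']: its first part pays for the edges whose faults avoid [T], its
    second for those with a fault on [T]. In [c(Q)] the faults reappear with the factor
    [2 * #|Fe e :&: Q| <= 2 * (f - r)], which leaves [2 * r + 1] of the [2 * f + 1]. *)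
Lemma class_weight (S' : {set edge G}) r : S' \subset S ->
  (forall e e', e \in S' -> e' \in S' -> e != e' -> e' \notin Fe e) ->
  (forall e, e \in S' -> (r <= #|Fe e :\: Q|)%N) ->
  (2 * r%:R + 1) * weight S' <= 2 * (L * weight Q).
Proof.
move=> sS nc hr; pose c (g : edge G) : R := L * wt g + \sum_(e in S' | g \in Fe e) wt e.
have c0 g : g \in Q -> 0 <= c g.
  move=> _; apply: addr_ge0; first by rewrite mulr_ge0 // wt_ge0.
  by apply: sumr_ge0 => e _; exact: wt_ge0.
have sumc (W : {set edge G}) :
    \sum_(g in W) c g = L * weight W + \sum_(e in S') #|Fe e :&: W|%:R * wt e.
  rewrite big_split /= -mulr_sumr; congr (_ + _).
  under eq_bigr => g _ do rewrite big_mkcondr /=.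
  rewrite exchange_big /=; apply: eq_bigr => e _.
  rewrite mulr_natl -sumr_const -big_mkcondr /=; apply: eq_bigl => g.
  by rewrite inE andbC.
have cutQ X : separates S' X -> ((2 * f).+1 <= #|cut_of Q X|)%N.
  case/existsP=> e /andP[eS']; have [eQ _ _] := accepted (subsetP sS e eS').
  exact: preserver_cut presQ eQ.
have [T [sT cT wT]] := steiner_forest (ltn0Sn _) cutQ c0.
pose ST := [set e in S' | Fe e :&: T == finset.set0].
have sST : ST \subset S' by apply/subsetP => e /setIdP[].
(* Failing [Fe e] spares [T] and, without conflicts, all earlier edges of [ST]; so the acceptance of
   [e] carries over to [T :|: ST]. *)
have hST : weight ST <= L * weight T.
  apply: (@conflict_free_weight _ _ _ _ rk t) => //.
  - by move=> e e' _ _; exact: rk_inj.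
  - by move=> e e' _ _; exact: rk_wt.
  - move=> e p; rewrite inE => /andP[eS' /eqP eT] wp.
    have [_ _ far] := accepted (subsetP sS e eS'); apply: far; apply: walk_sub wp => g.
    case/setUP=> [gT|/setIdP[/(subsetP sST) gS rg]]; apply/finset.setDP; split.
    + by apply/setUP; left; exact: (subsetP sT).
    + by apply/negP => gF; have := finset.in_set0 g; rewrite -eT inE gF gT.
    + by apply/setUP; right; rewrite inE rg (subsetP sS).
    + by apply: nc => //; apply: contraTneq rg => ->; rewrite ltnn.
  - by move=> e /(subsetP sST); exact: cT.
have hS : weight S' <= L * weight T + \sum_(e in S') #|Fe e :&: T|%:R * wt e.
  rewrite /weight (big_setID ST) /= (finset.setIidPr sST); apply: lerD => //.
  rewrite big_mkcond [leRHS]big_mkcond; apply: ler_sum => e _.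
  rewrite !in_setD in_set; case eS: (e \in S') => //=; rewrite andbT.
  case: ifP => [hc|_]; last by rewrite mulr_ge0 ?wt_ge0.
  by rewrite ler_peMl ?wt_ge0 // ler1n card_gt0.
have hK : (2 * f).+1%:R * weight S' <=
    2 * (L * weight Q) + 2 * \sum_(e in S') #|Fe e :&: Q|%:R * wt e.
  rewrite -mulrDr -sumc; apply: le_trans wT; rewrite sumc; exact: ler_wpM2l.
have hr' : (2 * r%:R + 1) * weight S' + 2 * \sum_(e in S') #|Fe e :&: Q|%:R * wt e <=
    (2 * f).+1%:R * weight S'.
  rewrite /weight !mulr_sumr -big_split /=; apply: ler_sum => e eS'.
  rewrite mulrA -mulrDl; apply: ler_wpM2r; first exact: wt_ge0.
  have [_ Ff _] := accepted (subsetP sS e eS').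
  have : (r + #|Fe e :&: Q| <= f)%N.
    apply: leq_trans Ff; rewrite -(cardsID Q (Fe e)) addnC leq_add2l; exact: hr.
  by rewrite -(ler_nat R) natrD -(natr1 (2 * f)%N) natrM; lra.
by move: hK hr'; lra.
Qed.

Lemma degree_class_weight (S1 : {set edge G}) r B : S1 \subset S ->
  (forall e, e \in S1 -> (r <= #|Fe e :\: Q| <= B)%N) ->
  (2 * r%:R + 1) * weight S1 <= (2 * B%:R + 1) * (2 * (L * weight Q)).
Proof.
move=> sS hb; have [col hcol] := @digraph_coloring _ (fun e => Fe e :\: Q) B S1
  (fun e eS => proj2 (andP (hb e eS))).
rewrite /weight (partition_big col xpredT) //= mulr_sumr.
apply: le_trans (_ : \sum_(i < B.*2.+1) 2 * (L * weight Q) <= _).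
  apply: ler_sum => i _; have -> : \sum_(e in S1 | col e == i) wt e = weight [set e in S1 | col e == i].
    by apply: eq_bigl => e; rewrite inE.
  have sub : [set e in S1 | col e == i] \subset S1 by apply/subsetP => e /setIdP[].
  apply: class_weight; first exact: fintype.subset_trans sub sS.
    move=> e e' /setIdP[eS /eqP ei] /setIdP[eS' /eqP ei'] ne; apply/negP => eF.
    have [eQ _ _] := accepted (subsetP sS e' eS').
    by have := hcol e e' eS eS' ne; rewrite inE eQ eF ei ei' eqxx => /(_ isT).
  by move=> e /setIdP[/hb/andP[]].
have -> : 2 * B%:R + 1 = (B.*2.+1)%:R :> R by rewrite -mul2n -natrM natr1.
by rewrite sumr_const card_ord [leRHS]mulr_natl.
Qed.

(** Below the threshold the factor is [2 * (2 * r + 1) <= 6 * sqrt f]; above it [2 * (2 * f + 1) /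
    (2 * r + 1) <= 6 * sqrt f], as [2 * r + 1 >= sqrt f]. With [Q] itself this makes 13. *)
Lemma greedy_weight : (0 < f)%N -> 1 <= L ->
  weight (Q :|: S) <= 13 * (Num.sqrt f%:R * L) * weight Q.
Proof.
move=> f0 L1; set x := Num.sqrt f%:R; pose r := Num.truncn x.
have x0 : 0 <= x by exact: sqrtr_ge0.
have xx : x * x = f%:R by rewrite -expr2 sqr_sqrtr.
have x1 : 1 <= x by rewrite -[leLHS]sqrtr1 ler_sqrt // ler1n.
have rx : r%:R <= x by rewrite truncn_le.
have xr : x < r%:R + 1 by have := truncnS_gt x; rewrite -natr1.
pose S1 := [set e in S | (#|Fe e :\: Q| <= r)%N].
have w1 := @degree_class_weight S1 0 r.
have w2 := @degree_class_weight (S :\: S1) r f.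
have Q0 := weight_ge0 Q; have LQ : 0 <= L * weight Q by rewrite mulr_ge0.
have h1 : weight S1 <= 6 * (x * (L * weight Q)).
  have := w1 _ _; rewrite mulr0 add0r mul1r => h; apply: le_trans (h _ _) _.
  - by apply/subsetP => e /setIdP[].
  - by move=> e /setIdP[].
  - have : (2 * r%:R + 1) * (L * weight Q) <= (3 * x) * (L * weight Q).
      by apply: ler_wpM2r => //; lra.
    by lra.
have h2 : weight (S :\: S1) <= 6 * (x * (L * weight Q)).
  have {w2} : (2 * r%:R + 1) * weight (S :\: S1) <= (2 * f%:R + 1) * (2 * (L * weight Q)).
    apply: w2; first exact: finset.subsetDl.
    move=> e /finset.setDP[eS]; rewrite inE eS /= -ltnNge => /ltnW-> /=.
    have [_ Ff _] := accepted eS; apply: leq_trans Ff.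
    by apply: subset_leq_card; exact: finset.subsetDl.
  have w0 := weight_ge0 (S :\: S1).
  have : x * weight (S :\: S1) <= (2 * r%:R + 1) * weight (S :\: S1).
    by have r0 : 0 <= r%:R :> R by []; apply: ler_wpM2r => //; lra.
  have : (2 * f%:R + 1) * (2 * (L * weight Q)) <= (3 * f%:R) * (2 * (L * weight Q)).
    have f1 : 1 <= f%:R :> R by rewrite ler1n.
    by apply: ler_wpM2r; [exact: mulr_ge0|lra].
  move=> a b c; have x_gt0 : 0 < x by apply: lt_le_trans x1.
  rewrite -(ler_pM2l x_gt0); apply: le_trans b (le_trans c (le_trans a _)).
  by rewrite -xx; lra.
have h3 : weight (Q :|: S) <= weight Q + (weight S1 + weight (S :\: S1)).
  rewrite /weight [\sum_(e in S1) _ + _](_ : _ = \sum_(e in S) wt e).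
    rewrite big_mkcond [in leRHS]big_mkcond [X in _ + X]big_mkcond -big_split /=.
    apply: ler_sum => e _; rewrite inE; case: (e \in Q); case: (e \in S) => /=;
    rewrite ?addr0 ?add0r // lerDl ?wt_ge0 //.
  rewrite [RHS](big_setID S1) /=; congr (_ + _); apply: eq_bigl => e.
  by rewrite !inE; case: (e \in S).
have h4 : 1 * weight Q <= x * L * weight Q.
  by apply: ler_wpM2r => //; rewrite -[leLHS]mulr1 ler_pM.
by move: h1 h2 h3 h4; lra.
Qed.

End UpperBound.

Section UpperBoundGraph.
Variable R : realType.

Lemma sub_graph_light (G : mgraph R) (g L : R) : lambda #|vert G| g = L%:E ->
  forall W : {set edge G}, (g%:E < weighted_girth (sub_graph W))%E ->
  (lightness [set: edge (sub_graph W)]%SET <= L%:E)%E.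
Proof.
by move=> <- W hg; apply: ereal_sup_ubound; exists (sub_graph W).
Qed.

Lemma upper_bound (G : mgraph R) (f : nat) (t L : R) : (0 < f)%N -> 1 <= t ->
  lambda #|vert G| (t + 1) = L%:E -> exists H : {set edge G}, eft_spanner f t H /\
  (competitive_lightness (2 * f)%N H <= (Num.sqrt f%:R)%:E * (13%:E * L%:E))%E.
Proof.
move=> f0 t1 EL.
have L1 : 1 <= L by rewrite -lee_fin -EL lambda_ge1.
have [Q [presQ _ ratQ]] := preserver_min G (2 * f).
have [S [rk [Fe [rk_inj rk_wt acc rej]]]] := greedy Q f t.
exists (Q :|: S); split; first by apply: spanner_replace => // e F; exact: rej.
have t0 : 0 <= t by apply: le_trans t1.
have L0 : 0 <= L by apply: le_trans L1.
have x1 : 1 <= Num.sqrt f%:R :> R by rewrite -[leLHS]sqrtr1 ler_sqrt // ler1n.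
rewrite ratQ -!EFinM; apply: weight_ratio_le; rewrite ?weight_ge0 //.
  apply: le_trans (_ : 1 * (1 * 1) <= _); first by rewrite !mulr1.
  by do 2! (apply: ler_pM => //); rewrite ?ler1n.
have := greedy_weight t0 L0 presQ rk_inj rk_wt acc (sub_graph_light EL) f0 L1.
by rewrite mulrCA.
Qed.

End UpperBoundGraph.

Theorem theorem1p11 (R : realType) :
  (exists (C : R) (Ceps : R -> R), 0 < C /\
    forall (f k n : nat) (eps : R),
      (0 < f)%N -> (0 < k)%N -> (0 < n)%N -> 0 < eps ->
      (forall G : mgraph R, #|vert G| = n ->
        exists H : {set edge G},
          eft_spanner f ((1 + eps) * (2 * k%:R - 1)) H /\
          (competitive_lightness (2 * f)%N H <=
            (Num.sqrt f%:R)%:E *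
              (C%:E * lambda n ((1 + eps) * (2 * k%:R) - eps)))%E) /\
      ((Num.sqrt f%:R)%:E *
          (C%:E * lambda n ((1 + eps) * (2 * k%:R) - eps)) <=
        (Num.sqrt f%:R * (Ceps eps * n%:R `^ k%:R^-1))%:E)%E)
  /\
  (exists c c' : R, 0 < c /\ 0 < c' /\
    forall (f k n : nat) (eps : R),
      (0 < f)%N -> (0 < k)%N -> (0 < n)%N -> 0 < eps ->
      (exists G : mgraph R, #|vert G| = n /\
        forall H : {set edge G},
          eft_spanner f ((1 + eps) * (2 * k%:R - 1)) H ->
          (c%:E * lambda (Num.truncn (n%:R / Num.sqrt (2 * f%:R) : R))
                         ((1 + eps) * (2 * k%:R)) <=
            competitive_lightness (2 * f)%N H)%E) /\
      (forall gamma : nat -> R, erdos_girth_conjecture gamma ->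
        eps < k%:R^-1 ->
        ((f%:R `^ (- (2 * k%:R)^-1) * (c' * gamma k * n%:R `^ k%:R^-1))%:E <=
          c%:E * lambda (Num.truncn (n%:R / Num.sqrt (2 * f%:R) : R))
                        ((1 + eps) * (2 * k%:R)))%E)).
Proof.
split; last first.
  exists 4^-1, 32^-1; split; first by rewrite invr_gt0.
  split; first by rewrite invr_gt0.
  move=> f k n eps f0 k0 n0 eps0; split; first exact: lower_bound.
  by move=> gamma hg ek; exact: erdos_lower_bound.
have hex (eps : R) : exists C : R, 0 < eps -> forall k n : nat, (0 < k)%N -> (0 < n)%N ->
    (lambda n ((1 + eps) * (2 * k%:R) - eps)%R <= (C * n%:R `^ k%:R^-1)%:E)%E.
  have [e0|e0] := boolP (0 < eps); last by exists 0.
  by have [C _ hC] := lambda_bound e0; exists C.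
have [Ce hCe] := choice hex.
exists 13, (fun eps => 13 * Ce eps); split=> // f k n eps f0 k0 n0 eps0.
have le := hCe eps eps0 k n k0 n0; split; last first.
  rewrite EFinM; apply: lee_wpmul2l; first by rewrite lee_fin sqrtr_ge0.
  by rewrite -mulrA EFinM; apply: lee_wpmul2l => //; rewrite lee_fin.
(* The growth bound makes [lambda] finite, so the estimates for real [L] apply. *)
move=> G nG; have [L EL] : exists L : R, lambda n ((1 + eps) * (2 * k%:R) - eps)%R = L%:E.
  have := lambda_ge1 n ((1 + eps) * (2 * k%:R) - eps); move: le.
  by case: (lambda _ _) => [l _ _|//|//]; exists l.
have kk : 1 <= k%:R :> R by rewrite ler1n.
have t1 : 1 <= (1 + eps) * (2 * k%:R - 1).
  by rewrite -[leLHS]mulr1; apply: ler_pM => //; lra.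
rewrite EL; apply: upper_bound => //; rewrite nG -EL; congr lambda; ring.
Qed.
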